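(* Let $H$ be a countable residually finite group. Then there exist a compact group $K$ and a finitely generated dense subgroup $\Lambda_4$ of $K$ such that all of the following hold: - $\Lambda_4$ contains an isomorphic copy of $H$; - $\Lambda_4$ admits a finitely generated subgroup $\Lambda_1$ that is a locally-finite-lift of $\mathbb{Z}$ and is dense in $K$; and - the action $\Lambda_4\curvearrowright K$ by left multiplication has a spectral gap with respect to the Haar probability measure of $K$.
   Context: Compact groups are Hausdorff topological groups; ''finitely generated'' refers to algebraic generation. Locally finite: a countable group $N$ is locally finite if every non-empty finite subset of $N$ generates a finite subgroup. A countable discrete group $\tilde G$ is a locally-finite-lift of a group $G$ if there is a short exact sequence $1\to N\to\tilde G\to G\to 1$ with $N$ locally finite. Spectral gap: let $G$ be a finitely generated group and $G\curvearrowright(\Omega,\kappa)$ a measure preserving action (possibly non-ergodic). $G$ acts on $L_2(\Omega,\kappa)$ by $(g\cdot f)(\omega)=f(g^{-1}\omega)$; let $L_2(\Omega,\kappa)^G$ be the subspace of $G$-invariant vectors and $f\mapsto\overline f$ the quotient map $L_2(\Omega,\kappa)\to L_2(\Omega,\kappa)/L_2(\Omega,\kappa)^G$ (with the quotient norm). The action has a spectral gap if for some (equivalently, every) finite generating set $S$ of $G$ there exists $\epsilon>0$ such that for every $f\in L_2(\Omega,\kappa)$, $$\sup_{s\in S}\|\overline{s\cdot f}-\overline f\|\ \ge\ \epsilon\|\overline f\|,$$ where the norms are those of $L_2(\Omega,\kappa)/L_2(\Omega,\kappa)^G$. *)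

(* Defs.v *)
From HB Require Import structures.
From mathcomp Require Import all_boot all_order all_algebra all_fingroup.
From mathcomp Require Import all_classical all_reals all_analysis.

Set Implicit Arguments.
Unset Strict Implicit.
Unset Printing Implicit Defensive.

Import Order.TTheory GRing.Theory Num.Theory.
Import numFieldNormedType.Exports.

Local Open Scope classical_set_scope.

Section GroupTheory.
Local Open Scope group_scope.

Definition is_subgroup (G : groupType) (A : set G) : Prop :=
  [/\ A 1, (forall x y, A x -> A y -> A (x * y)) & (forall x, A x -> A x^-1)].

Record subgroup (G : groupType) := Subgroup {
  subgroup_set :> set G;
  subgroupP : is_subgroup subgroup_set
}.

Definition subgroup_type (G : groupType) (L : subgroup G) : Type :=
  set_type (subgroup_set L).

HB.instance Definition _ (G : groupType) (L : subgroup G) :=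
  SubChoice.on (subgroup_type L).

Lemma subgroup_group_closed (G : groupType) (L : subgroup G) :
  group_closed (fun x : G => x \in subgroup_set L).
Proof.
have [L1 LM LV] := subgroupP L.
split; first exact: mem_set.
by move=> x y /set_mem Lx /set_mem Ly; apply/mem_set/LM => //; exact: LV.
Qed.

HB.instance Definition _ (G : groupType) (L : subgroup G) :=
  SubChoice_isSubGroup.Build G (fun x : G => x \in subgroup_set L)
    (subgroup_type L) (subgroup_group_closed L).

Definition generated (G : groupType) (S : set G) : set G :=
  smallest (@is_subgroup G) S.

Definition generates (G : groupType) (S : set G) : Prop :=
  generated S = [set: G].

Definition finitely_generated (G : groupType) : Prop :=
  exists S : set G, finite_set S /\ generates S.

Definition residually_finite (G : groupType) : Prop :=
  forall x : G, x != 1 ->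
    exists (Q : finGroupType) (f : {multiplicative G -> Q}), f x != 1.

Definition locally_finite (N : groupType) : Prop :=
  countable [set: N] /\
  forall S : set N, S !=set0 -> finite_set S -> finite_set (generated S).

Definition locally_finite_lift (E G : groupType) : Prop :=
  countable [set: E] /\
  exists (N : groupType) (i : {multiplicative N -> E})
         (p : {multiplicative E -> G}),
    [/\ locally_finite N, injective i, range i = [set x | p x = 1]
      & range p = [set: G]].

End GroupTheory.

(* The infinite cyclic group: [groupType] is multiplicative, so the additive
   group of [int] is put on an alias. *)
Definition Zgroup : Type := int.
HB.instance Definition _ := Choice.on Zgroup.
HB.instance Definition _ := isGroup.Build Zgroup
  (@addrA int) (@add0r int) (@addr0 int) (@addNr int) (@addrN int).

(* The base point (arbitrary) is only there because the measurable types of the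
   library are pointed. *)
HB.mixin Record isTopologicalGroup G & PointedTopological G & monoid.Group G := {
  mulg_continuous : continuous (fun x : G * G => (x.1 * x.2)%g);
  invg_continuous : continuous (fun x : G => (x^-1)%g)
}.

#[short(type="topologicalGroupType")]
HB.structure Definition TopologicalGroup :=
  {G of PointedTopological G & monoid.Group G & isTopologicalGroup G}.

Definition compact_group (K : topologicalGroupType) : Prop :=
  compact [set: K] /\ hausdorff_space K.

Definition borel (T : ptopologicalType) := g_sigma_algebraType (@open T).

Section Haar.
Local Open Scope ereal_scope.
Context (R : realType) (K : topologicalGroupType).
Implicit Type mu : probability (borel K) R.

Definition left_invariant mu : Prop :=
  forall (g : K) (A : set (borel K)), measurable A ->
    mu ((fun x : K => (g * x)%g) @^-1` A) = mu A.

Definition regular mu : Prop :=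
  (forall A : set (borel K), measurable A ->
     mu A = ereal_inf [set mu U | U in [set U : set K | open U /\ A `<=` U]]) /\
  (forall U : set K, open U ->
     mu U = ereal_sup [set mu C | C in [set C : set K | compact C /\ C `<=` U]]).

(* Regularity is automatic for metrizable K; in general it is what makes the
   Haar probability measure unique. *)
Definition haar_probability mu : Prop := left_invariant mu /\ regular mu.

End Haar.

Section SpectralGap.
Local Open Scope ring_scope.
Context d (T : measurableType d) (R : realType) (mu : {measure set T -> \bar R}).
Context (G : groupType) (act : G -> T -> T).

Definition measure_preserving_action : Prop :=
  [/\ forall x, act 1%g x = x,
      forall g h x, act (g * h)%g x = act g (act h x),
      forall g, measurable_fun setT (act g)
    & forall g A, measurable A -> mu (act g @^-1` A) = mu A].

Definition translate (g : G) (f : T -> R) : T -> R :=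
  fun x => f (act (g^-1)%g x).

(* Real scalars. L_2 is handled through representatives: square-integrable
   functions with the L_2 seminorm, equality being almost everywhere. *)
Definition L2_norm (f : T -> R) : R := fine ('N[mu]_2%:E[EFin \o f]).

Definition L2_invariant : set (T -> R) :=
  [set h | h \in Lfun mu 2%:E /\ forall g, translate g h = h %[ae mu]].

(* Norm of the class of [f] in L_2 modulo the invariant vectors. *)
Definition L2_quotient_norm (f : T -> R) : R :=
  inf [set L2_norm (f \- h) | h in L2_invariant].

(* S is finite, so the supremum is a maximum, and the real supremum of the
   empty set is 0. Since the quotient map is linear, the norm of the difference
   of the classes of [translate s f] and [f] is the norm of the class of their
   difference. *)
Definition spectral_gap : Prop :=
  measure_preserving_action /\
  exists S : set G, [/\ finite_set S, generates S
    & exists2 eps : R, 0 < eps & forall f : T -> R, f \in Lfun mu 2%:E ->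
        eps * L2_quotient_norm f <=
        sup [set L2_quotient_norm (translate s f \- f) | s in S]].

End SpectralGap.

Definition left_translation (K : topologicalGroupType) (L : subgroup K) :
    subgroup_type L -> borel K -> borel K :=
  fun g x => ((\val g : K) * (x : K))%g.

(* Main.v *)
Require Import Defs.
From HB Require Import structures.
From mathcomp Require Import all_boot all_order all_algebra all_fingroup.
From mathcomp Require Import finmap all_classical all_reals all_analysis.
From mathcomp Require Import measurable_realfun.
From mathcomp Require Import ring lra zify.

(** The compact group is a product [K] of finite groups [E3 A n], the groups
    generated by the elementary 3 by 3 matrices over the matrix rings
    [A n = 'M['F_53]_(m n + 1)], with [m n] even and strictly increasing.  A
    sequence [x] with [x n] in [A n] gives elements [elem_seq i j x] of [K], and the
    commutator relation of elementary matrices makes the set of sequences all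
    of whose [elem_seq i j x] lie in a given subgroup [L] closed under ring
    operations ([offdiagD], [offdiagM]).  So generating a subgroup of [K] amounts
    to generating a ring of sequences.

    _Density_.  Let [cshift] be the cyclic permutation matrix in each
    coordinate and [unit_seq k l] the matrix unit at [k, l], the indices being
    reduced modulo the size.  The product of the matrix units at [0, m n + 1]
    and at [0, 0] is nonzero in coordinate [k] exactly when [m k + 1] divides
    [m n + 1]; since the sizes increase, an induction isolates each coordinate
    ([single_full]).  Hence a subgroup containing the elementary matrices of all
    matrix units is dense ([finite_coords_dense]).

    _The lift of the integers_.  Let [tau] be the diagonal matrix with entries
    [cshift]; it lies in [K] because [cshift] is a square of a permutation matrix
    that an involution conjugates to its inverse ([tau_exists], by
    [weyl_diag]).  With the elementary matrices of [unit_seq 0 0], [unit_seq 1 0]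
    and [unit_seq 0 1], it generates a dense subgroup, because conjugation by
    [tau] moves matrix units along the diagonal.  Elements of [K] which, in all
    coordinates from [v] on, differ from 1 by one matrix supported by the
    indices at most [v] form a finite group [window_group v]: they are described
    by this matrix and finitely many coordinates.  Conjugation by [tau] enlarges the
    window by one, and the positive powers of [tau] lie in no window, so the exponent of
    [tau] is well defined and its kernel is an ascending union of conjugates of
    finite groups ([ascending_lift]).

    _Spectral gap_.  The six generators [gap_gen] have order 53, and any two of
    them have a commutator which has order dividing 53 and commutes with both.
    For such a pair the subspaces of fixed vectors, off their intersection, make
    an angle whose cosine is at most [1 / sqrt 53], which is less than [1 / 7]; with six
    subgroups this is small enough for the Laplacian to have a gap, uniformly over
    all orthogonal representations on finite-dimensional spaces ([heis_gap]).
    Locally constant functions being dense in square-integrable functions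
    ([approx_all]), the gap passes to the Haar measure.  The norm of a displacement
    [s f - f] is at most twice its quotient seminorm when [s] has finite order
    ([torsion_displacement]), which turns the estimate into the one required
    ([haar_spectral_gap]).

    _The copy of H_.  Choose finite quotients [Q n] of [H] separating its
    points.  The regular representation of [Q n] acts on a corner of [A n] by
    permutation matrices [P h], and a coset-wise reflection conjugates [P h] to
    [P h^-1]; so [weyl_diag] writes the diagonal matrix with entries
    [P h, P h, 1] as a product of elementary matrices, and [h] is sent to this
    matrix ([copy]).  Countably many sequences supported by the corners
    are needed for this; placing them in disjoint blocks of a single sequence,
    from which shifts recover each of them up to finitely many coordinates
    ([offdiag_encoded]), finitely many generators suffice. *)

Set Implicit Arguments.
Unset Strict Implicit.
Unset Printing Implicit Defensive.

Import Order.TTheory GRing.Theory Num.Theory.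
Import numFieldNormedType.Exports.

Local Open Scope classical_set_scope.

(** * Products of finite groups as compact groups *)

(** Each factor carries the discrete topology, so that the product is
    profinite. *)
Definition prodgroup (G : nat -> finGroupType) : Type :=
  prod_topology (fun n => discrete_topology (G n)).

Section ProdGroup.
Context (G : nat -> finGroupType).
Local Open Scope group_scope.
Implicit Types x y z : prodgroup G.

HB.instance Definition _ := Topological.on (prodgroup G).

Definition pg1 : prodgroup G := fun n => (1 : G n).
Definition pgV x : prodgroup G := fun n => (x n : G n)^-1.
Definition pgM x y : prodgroup G := fun n => (x n : G n) * (y n : G n).

HB.instance Definition _ := isPointed.Build (prodgroup G) pg1.

Lemma pgA : associative pgM.
Proof. by move=> x y z; apply: functional_extensionality_dep => n; exact: mulgA. Qed.
Lemma pg1g : left_id pg1 pgM.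
Proof. by move=> x; apply: functional_extensionality_dep => n; exact: mul1g. Qed.
Lemma pgg1 : right_id pg1 pgM.
Proof. by move=> x; apply: functional_extensionality_dep => n; exact: mulg1. Qed.
Lemma pgVg : left_inverse pg1 pgV pgM.
Proof. by move=> x; apply: functional_extensionality_dep => n; exact: mulVg. Qed.
Lemma pggV : right_inverse pg1 pgV pgM.
Proof. by move=> x; apply: functional_extensionality_dep => n; exact: mulgV. Qed.

HB.instance Definition _ := isGroup.Build (prodgroup G) pgA pg1g pgg1 pgVg pggV.

Lemma prodgroupM x y i : (x * y) i = (x i : G i) * (y i : G i) :> G i. Proof. by []. Qed.
Lemma prodgroupV x i : x^-1 i = (x i : G i)^-1 :> G i. Proof. by []. Qed.

Definition cyl n x : set (prodgroup G) := [set y | forall i, (i < n)%N -> y i = x i].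

(** Continuity, openness and density in the product become statements about
    finitely many coordinates through this description of neighbourhoods. *)
Lemma nbhs_cyl x (A : set (prodgroup G)) : nbhs x A <-> exists n, cyl n x `<=` A.
Proof.
split.
  pose F : set_system (prodgroup G) := [set B | exists n, cyl n x `<=` B].
  have FF : Filter F.
    split; first by exists 0%N.
      move=> P Q [n nP] [m mQ]; exists (maxn n m) => y xy.
      by split; [apply: nP|apply: mQ] => i im; apply: xy; rewrite leq_max im ?orbT.
    by move=> P Q PQ [n nP]; exists n; exact: subset_trans PQ.
  suff : F --> x by move=> + xA; apply.
  apply/cvg_sup => i U [V] [[W] oW <-] WfN WU.
  exists i.+1 => y xy; apply: WU; rewrite /=.
  by rewrite /preimage/= xy// ltnSn.
case=> n nA; apply: (@filterS _ (nbhs x) (nbhs_filter x) (cyl n x)) => //.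
elim: n {nA} => [|n IH]; first by apply: (@filterS _ (nbhs x) (nbhs_filter x) setT) => //; exact: filterT.
have H := @proj_continuous _ (fun n => discrete_topology (G n)) n x [set x n] (discrete_set1 _).
apply: (@filterS _ (nbhs x) (nbhs_filter x) _ _ _ (@filterI _ (nbhs x) (nbhs_filter x) _ _ IH H)).
by move=> y [/= xy yx] i; rewrite ltnS leq_eqVlt => /orP[/eqP ->//|]; exact: xy.
Qed.

Lemma pg_mul_continuous : continuous (fun x : prodgroup G * prodgroup G => x.1 * x.2).
Proof.
move=> [x y] A /= /nbhs_cyl [n nA].
exists (cyl n x, cyl n y) => /=; first by split; apply/nbhs_cyl; exists n.
by move=> [a b] [/= ax bx]; apply: nA => i ni; rewrite /= /mulg/= /pgM ax// bx.
Qed.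

Lemma pg_inv_continuous : continuous (fun x : prodgroup G => x^-1).
Proof.
move=> x A /= /nbhs_cyl [n nA]; apply/nbhs_cyl; exists n => y xy.
by apply: nA => i ni; rewrite /invg/= /pgV xy.
Qed.

HB.instance Definition _ :=
  isTopologicalGroup.Build (prodgroup G) pg_mul_continuous pg_inv_continuous.

Lemma prodgroup_compact : compact_group (prodgroup G : topologicalGroupType).
Proof.
split.
  have fT n : finite_set [set: discrete_topology (G n)].
    exact: (@finite_finset (G n)).
  have := tychonoff (fun n => finite_compact (fT n)).
  set A := (X in compact X -> _).
  by suff -> : A = setT by []; rewrite eqEsubset.
apply: (@hausdorff_product _ (fun n => discrete_topology (G n))) => n.
by apply: discrete_hausdorff; exact: discrete_space_discrete.
Qed.

End ProdGroup.

(** * Locally constant functions and their averages *)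

Section Levels.
Context (G : nat -> finGroupType).
Implicit Types x y z : prodgroup G.

(** For a set, seen as a map to [Prop], this says that membership is decided
    by the first [n] coordinates. *)
Definition level n T (f : prodgroup G -> T) :=
  forall x y, (forall i, (i < n)%N -> x i = y i) -> f x = f y.

Definition upd x n (a : G n) : prodgroup G :=
  @dfwith nat (fun n => discrete_topology (G n)) x n a.

Lemma updE x n a : upd x a n = a :> G n.
Proof. exact: dfwithin. Qed.

Lemma updO x n (a : G n) i : i != n -> upd x a i = x i.
Proof. by rewrite eq_sym; exact: dfwithout. Qed.

Lemma level_le n m T (f : prodgroup G -> T) : (n <= m)%N -> level n f -> level m f.
Proof. by move=> nm lf x y xy; apply: lf => i /leq_trans/(_ nm); exact: xy. Qed.

Lemma level_upd n T (f : prodgroup G -> T) x (a : G n) : level n f -> f (upd x a) = f x.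
Proof. by move=> lf; apply: lf => i ni; rewrite updO// ltn_eqF. Qed.

Lemma level_upd_fix n T (f : prodgroup G -> T) (a : G n) :
  level n.+1 f -> level n (fun x => f (upd x a)).
Proof.
move=> lf x y xy; apply: lf => i; rewrite ltnS leq_eqVlt => /orP[/eqP ->|ni].
  by rewrite !updE.
by rewrite !updO ?ltn_eqF//; exact: xy.
Qed.

Lemma upd_mul (g x : prodgroup G) n (a : G n) :
  (g * upd x a)%g = upd (g * x)%g (g n * a : G n)%g.
Proof.
apply: functional_extensionality_dep => i; rewrite [LHS]/mulg/= /pgM.
have [->|ni] := eqVneq i n; first by rewrite !updE.
by rewrite !updO.
Qed.

Lemma level_preimage_mul n T (f : prodgroup G -> T) (g : prodgroup G) :
  level n f -> level n (fun x => f (g * x)%g).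
Proof. by move=> lf x y xy; apply: lf => i ni; rewrite /mulg/= /pgM xy. Qed.

Lemma level_open n (A : set (prodgroup G)) : level n A -> open A.
Proof.
move=> lA; rewrite openE => x Ax; apply/nbhs_cyl; exists n => y xy.
by rewrite (lA y x).
Qed.

Lemma level_setC n (A : set (prodgroup G)) : level n A -> level n (~` A).
Proof. by move=> lA x y xy; rewrite /setC/mkset (lA x y). Qed.

Lemma level_closed n (A : set (prodgroup G)) : level n A -> closed A.
Proof. by move=> lA; rewrite -[A]setCK closedC; exact: (level_open (level_setC lA)). Qed.

Lemma level_compact n (A : set (prodgroup G)) : level n A -> compact A.
Proof.
move=> /level_closed cA; apply: (subclosed_compact cA _ (subsetT A)).
by have [] := prodgroup_compact G.
Qed.

(** The union of the cylinders of level [n] contained in [U]: the largest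
    level-[n] subset of [U]. *)
Definition inner n (U : set (prodgroup G)) : set (prodgroup G) :=
  [set x | cyl n x `<=` U].

Lemma level_inner n U : level n (inner n U).
Proof.
move=> x y xy; rewrite /inner/mkset (_ : cyl n x = cyl n y)//.
by apply/seteqP; split => z /= H i ni; rewrite H// xy.
Qed.

Lemma inner_sub n U : inner n U `<=` U.
Proof. by move=> x; apply. Qed.

Lemma inner_nd U n m : (n <= m)%N -> inner n U `<=` inner m U.
Proof.
by move=> nm x xU y xy; apply: xU => i ni; apply: xy; exact: leq_trans nm.
Qed.

(** This exhaustion of an open set by clopen sets of finite level is what
    gives both the Borel structure and the inner regularity of the Haar
    measure. *)
Lemma open_inner U : open U -> \bigcup_n inner n U = U.
Proof.
move=> oU; apply/seteqP; split => [x [n _]|x Ux]; first exact: inner_sub.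
by have [n nU] := (nbhs_cyl x U).1 (open_nbhs_nbhs (conj oU Ux)); exists n.
Qed.

End Levels.

Section Average.
Context (R : realType) (G : nat -> finGroupType).
Local Open Scope ring_scope.

(** The mean over the first [n] coordinates, the remaining ones being trivial;
    it is iterated one coordinate at a time so that translation invariance
    reduces to reindexing a sum over one factor. *)
Fixpoint avg n (f : prodgroup G -> R) : R :=
  if n is m.+1 then #|G m|%:R^-1 * \sum_(a : G m) avg m (fun x => f (upd x a))
  else f (1%g).

Lemma cardG_neq0 n : #|G n|%:R != 0 :> R.
Proof. by rewrite pnatr_eq0 -lt0n; apply/card_gt0P; exists 1%g. Qed.

Lemma avgS_level n f : level n f -> avg n.+1 f = avg n f.
Proof.
move=> lf /=; rewrite (eq_bigr (fun=> avg n f)); last first.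
  by move=> a _; congr avg; apply/funext => x; rewrite level_upd.
by rewrite sumr_const -[X in _ * X]mulr_natl mulrA mulVf ?mul1r// cardG_neq0.
Qed.

Lemma avg_level n m f : (n <= m)%N -> level n f -> avg m f = avg n f.
Proof.
move=> /subnK <- lf; elim: (m - n)%N => // k <-.
by rewrite addSn avgS_level//; apply: level_le lf; exact: leq_addl.
Qed.

Lemma avgD n f g : avg n (fun x => f x + g x) = avg n f + avg n g.
Proof.
elim: n f g => //= n IH f g; rewrite -mulrDr -big_split/=; congr (_ * _).
by apply: eq_bigr => a _; rewrite IH.
Qed.

Lemma avg_cst n c : avg n (fun=> c) = c.
Proof. by rewrite (@avg_level 0 n)//. Qed.

Lemma avg_ge0 n f : (forall x, 0 <= f x) -> 0 <= avg n f.
Proof.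
elim: n f => //= n IH f f0; rewrite mulr_ge0 ?invr_ge0 ?ler0n//.
by apply: sumr_ge0 => a _; exact: IH.
Qed.

(** In each coordinate, translation only permutes the summands. *)
Lemma avg_translate n f (g : prodgroup G) : level n f -> avg n (fun x => f (g * x)%g) = avg n f.
Proof.
elim: n f => /= [|n IH] f lf; first exact: lf.
congr (_ * _); rewrite [in RHS](reindex_inj (mulgI (g n : G n)))/=.
apply: eq_bigr => a _.
rewrite -[RHS]IH; last exact: level_upd_fix.
by congr avg; apply: funext => x; rewrite upd_mul.
Qed.

(** Any level of a set of finite level; the mass does not depend on this
    choice, by [massE]. *)
Definition lev (A : set (prodgroup G)) : nat := xget 0%N [set n | level n A].
Definition mass A : R := avg (lev A) \1_A.

Lemma level_indic n (A : set (prodgroup G)) : level n A -> level n (\1_A : prodgroup G -> R).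
Proof.
move=> lA x y xy; rewrite !indicE; congr (_ _)%:R.
by apply/idP/idP; rewrite !inE (lA x y).
Qed.

Lemma massE n A : level n A -> mass A = avg n \1_A.
Proof.
move=> lA; rewrite /mass; have lA' : level (lev A) A.
  by rewrite /lev; case: xgetP => [m _ //|/(_ n)] /(_ lA).
have [h|/ltnW h] := leqP n (lev A).
  by rewrite (avg_level h)//; exact: level_indic.
by rewrite [RHS](avg_level h)//; exact: level_indic.
Qed.

Lemma mass_ge0 A : 0 <= mass A.
Proof. by apply: avg_ge0 => x; rewrite indicE. Qed.

Lemma massT : mass setT = 1.
Proof.
rewrite (@massE 0)// indicT; exact: avg_cst.
Qed.

Lemma mass0 : mass set0 = 0.
Proof. by rewrite (@massE 0)// indic0; exact: avg_cst. Qed.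

Lemma massU (A B : set (prodgroup G)) n : level n A -> level n B -> A `&` B = set0 ->
  mass (A `|` B) = mass A + mass B.
Proof.
move=> lA lB AB; rewrite !(@massE n)//.
- rewrite -avgD; congr avg; apply/funext => x; rewrite !indicE in_setU.
  have : ~ (x \in A /\ x \in B) by rewrite !inE => H; have : (A `&` B) x by []; rewrite AB.
  by case: (x \in A); case: (x \in B) => //= H; rewrite ?addr0 ?add0r//; case: H.
- by move=> x y xy; rewrite /setU/mkset (lA x y)// (lB x y).
Qed.

Lemma mass_translate (A : set (prodgroup G)) n (g : prodgroup G) : level n A ->
  mass ((fun x : prodgroup G => (g * x)%g) @^-1` A) = mass A.
Proof.
move=> lA; rewrite !(@massE n)//; last exact: level_preimage_mul.
by rewrite -(avg_translate g (level_indic lA)).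
Qed.

End Average.

(** * The Haar measure of a product of finite groups *)

(** An alias of the product carrying the algebra of sets of finite level, on
    which the premeasure is defined. *)
Definition cylalg (G : nat -> finGroupType) : Type := prodgroup G.
HB.instance Definition _ G := Pointed.on (cylalg G).

Section CylAlg.
Context (G : nat -> finGroupType).

Definition cylinder (A : set (prodgroup G)) : Prop := exists n, level n A.

Lemma cylinder0 : cylinder set0. Proof. by exists 0%N. Qed.
Lemma cylinderT : cylinder setT. Proof. by exists 0%N. Qed.

Lemma common_level (A B : set (prodgroup G)) : cylinder A -> cylinder B ->
  exists2 n, level n A & level n B.
Proof.
move=> [n lA] [m lB]; exists (maxn n m); first exact: level_le (leq_maxl _ _) lA.
exact: level_le (leq_maxr _ _) lB.
Qed.

Lemma cylinderU : setU_closed cylinder.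
Proof.
move=> A B cA cB; have [n lA lB] := common_level cA cB; exists n => x y xy.
by rewrite /setU/mkset (lA x y)// (lB x y).
Qed.

Lemma cylinderC : setC_closed cylinder.
Proof. by move=> A [n lA]; exists n; exact: level_setC. Qed.

HB.instance Definition _ := isAlgebraOfSets.Build default_measure_display
  (cylalg G) cylinder0 cylinderU cylinderC.

Lemma cylinder_open A : cylinder A -> open A.
Proof. by case=> n; exact: level_open. Qed.

Lemma cylinder_compact A : cylinder A -> compact A.
Proof. by case=> n; exact: level_compact. Qed.

Lemma open_cylinder_sigma (U : set (prodgroup G)) : open U -> <<s cylinder >> U.
Proof.
move=> oU; rewrite -(open_inner oU).
apply: sigma_algebra_bigcup => n; apply: sub_sigma_algebra.
by exists n; exact: level_inner.
Qed.

Lemma borel_cylinder_sigma (A : set (borel (prodgroup G))) : measurable A -> <<s cylinder >> A.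
Proof.
apply: smallest_sub; first exact: smallest_sigma_algebra.
exact: open_cylinder_sigma.
Qed.

(** Cylinders are compact and open, so countable additivity on the algebra is
    a finite matter. *)
Lemma cylinder_cover_finite (F : (set (prodgroup G))^nat) C :
  (forall i, cylinder (F i)) -> cylinder C -> C `<=` \bigcup_i F i ->
  exists N, C `<=` \big[setU/set0]_(i < N) F i.
Proof.
move=> cF /cylinder_compact; rewrite compact_cover => /(_ nat setT F) H CF.
have [|//|D _ CD] := H; first by move=> i _; exact: cylinder_open.
exists (\max_(i <- D) i).+1 => x /CD[i /= iD Fix].
rewrite -bigcup_mkord; exists i => //=; rewrite ltnS.
by apply: (@leq_bigmax_seq _ (finmap.enum_fset D) xpredT (fun i => i)).
Qed.

End CylAlg.

Section HaarMeasure.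
Context (R : realType) (G : nat -> finGroupType).
Local Open Scope ereal_scope.

Definition cylmass (A : set (cylalg G)) : \bar R := (mass R A)%:E.

Lemma cylmass0 : cylmass set0 = 0. Proof. by rewrite /cylmass mass0. Qed.

Lemma cylmass_ge0 A : 0 <= cylmass A.
Proof. by rewrite lee_fin mass_ge0. Qed.

Lemma cylmass_sum (F : (set (cylalg G))^nat) n :
  (forall i, measurable (F i)) -> trivIset setT F ->
  \sum_(0 <= i < n) cylmass (F i) = cylmass (\big[setU/set0]_(i < n) F i).
Proof.
move=> mF tF; elim: n => [|n IH]; first by rewrite big_nil big_ord0 cylmass0.
rewrite big_nat_recr//= IH big_ord_recr/= /cylmass.
have mU : measurable (\big[setU/set0]_(i < n) F i) by exact: bigsetU_measurable.
have [k lU lF] := common_level mU (mF n).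
rewrite -EFinD -(massU _ lU lF)//.
rewrite -bigcup_mkord setI_bigcupl bigcup0// => i /= ni.
have /trivIsetP := tF; apply => //; by rewrite ltn_eqF.
Qed.

Lemma cylmass_sigma_additive : semi_sigma_additive cylmass.
Proof.
move=> F mF tF mU; have [N UN] := cylinder_cover_finite mF mU (@subset_refl _ _).
apply: cvg_near_cst; near=> n.
rewrite cylmass_sum//; congr cylmass; apply/seteqP; split.
  by apply: (@bigsetU_bigcup _ F n).
apply: (subset_trans UN); rewrite -!bigcup_mkord => x [i /= iN Fi].
exists i => //=; apply: (leq_trans iN); near: n; exact: nbhs_infty_ge.
Unshelve. all: by end_near. Qed.

HB.instance Definition _ := isMeasure.Build _ (cylalg G) R cylmass
  cylmass0 cylmass_ge0 cylmass_sigma_additive.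

(** The Caratheodory extension of the mass of cylinders. *)
Definition haar (A : set (borel (prodgroup G))) : \bar R := mu_ext cylmass A.

Let haar0 : haar set0 = 0. Proof. exact: mu_ext0. Qed.
Let haar_ge0 A : 0 <= haar A. Proof. exact: mu_ext_ge0. Qed.
Let haar_sigma_additive : semi_sigma_additive haar.
Proof.
move=> F mF tF mU; have mC (A : set (borel (prodgroup G))) : measurable A ->
    (mu_ext cylmass).-cara.-measurable A.
  by move=> /borel_cylinder_sigma; exact: (@sub_caratheodory _ (cylalg G) R cylmass).
exact: (@caratheodory_measure_sigma_additive R (cylalg G) (mu_ext cylmass)
  F (fun i => mC _ (mF i)) tF (mC _ mU)).
Qed.

HB.instance Definition _ := isMeasure.Build _ (borel (prodgroup G)) R haar
  haar0 haar_ge0 haar_sigma_additive.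

Lemma haar_cylinder A : cylinder A -> haar A = (mass R A)%:E.
Proof. by move=> cA; exact: (@measurable_mu_extE _ _ (cylalg G) cylmass). Qed.

Let haarT : haar setT = 1.
Proof. by rewrite haar_cylinder ?massT//; exact: cylinderT. Qed.

HB.instance Definition _ := Measure_isProbability.Build _ _ R haar haarT.

Lemma open_measurable_borel (U : set (prodgroup G)) : open U -> measurable (U : set (borel (prodgroup G))).
Proof. exact: sub_sigma_algebra. Qed.

Lemma cylinder_measurable (U : set (prodgroup G)) : cylinder U -> measurable (U : set (borel (prodgroup G))).
Proof. by move=> /cylinder_open; exact: open_measurable_borel. Qed.

Lemma translate_measurable (g : prodgroup G) (A : set (borel (prodgroup G))) :
  measurable A -> measurable ((fun x : prodgroup G => (g * x)%g) @^-1` A : set (borel (prodgroup G))).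
Proof.
move=> mA.
have mg : measurable_fun [set: borel (prodgroup G)] (fun x : borel (prodgroup G) => (g * x)%g : borel (prodgroup G)).
  apply: (@measurability _ _ (borel (prodgroup G)) (borel (prodgroup G)) setT _ (@open (prodgroup G))) => //.
  move=> _ [U oU <-]; rewrite setTI; apply: open_measurable_borel.
  rewrite openE => x Ugx.
  have [n nU] := (nbhs_cyl (g * x)%g U).1 (open_nbhs_nbhs (conj oU Ugx)).
  by apply/nbhs_cyl; exists n => y xy; apply: nU => i ni; rewrite /mulg/= /pgM xy.
by have := mg measurableT A mA; rewrite setTI.
Qed.

(** The translated measure agrees with the original one on cylinders, a
    generating family closed under intersection. *)
Lemma haar_left_invariant : left_invariant (haar : probability (borel (prodgroup G)) R).
Proof.
move=> g A mA; pose f (x : borel (prodgroup G)) : borel (prodgroup G) := (g * x)%g.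
have mf : measurable_fun setT f by move=> _ B mB; rewrite setTI; exact: translate_measurable.
suff : pushforward haar f A = haar A by [].
apply: (@measure_unique _ R (borel (prodgroup G)) (@cylinder G) (fun=> setT) _ _ _ _
   (measure_function_pushforward__canonical__measure_function_Measure haar mf) haar) => //.
- apply/seteqP; split => B; first exact: borel_cylinder_sigma.
  apply: smallest_sub; first exact: smallest_sigma_algebra.
  by move=> C cC; exact: cylinder_measurable.
- by move=> B C mB mC; exact: (@measurableI _ (cylalg G)).
- by move=> _; exact: cylinderT.
- by rewrite bigcup_const//; exists 0%N.
- move=> B [n lB]; change (haar (f @^-1` B) = haar B); rewrite !haar_cylinder; first by rewrite (mass_translate _ _ lB).
    by exists n.
  by exists n; exact: level_preimage_mul.
- by move=> _; rewrite /= /pushforward preimage_setT haarT ltry.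
Qed.

(** Outer measure is computed by countable covers with cylinders, which are
    open. *)
Lemma haar_outer (A : set (prodgroup G)) (e : R) : (0 < e)%R ->
  exists U : set (prodgroup G), [/\ open U, A `<=` U & haar U <= haar A + e%:E].
Proof.
move=> e0; have fA : haar A \is a fin_num.
  rewrite ge0_fin_numE ?haar_ge0//; apply: (@le_lt_trans _ _ 1); last exact: ltry.
  by rewrite -haarT; apply: le_mu_ext.
have [_ [F [mF AF] <-] Fe] := lb_ereal_inf_adherent e0 fA.
exists (\bigcup_i F i); split => //.
  by apply: bigcup_open => i _; exact: (cylinder_open (mF i)).
apply: le_trans (ltW Fe); apply: ereal_inf_lbound.
by exists F => //; split.
Qed.

(** Inner regularity on open sets uses compact sets of finite level exhausting
    [U]. *)
Lemma haar_regular : regular (haar : probability (borel (prodgroup G)) R).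
Proof.
split=> [A mA|U oU]; apply/eqP; rewrite eq_le; apply/andP; split.
- apply: le_ereal_inf_tmp => _ [U [oU AU] <-]; exact: le_mu_ext.
- apply/lee_addgt0Pr => e e0; have [U [oU AU Ue]] := haar_outer A e0.
  by apply: le_trans Ue; apply: ereal_inf_lbound; exists U.
- have mU n : measurable (inner n U : set (borel (prodgroup G))).
    by apply: cylinder_measurable; exists n; exact: level_inner.
  have : haar (inner n U) @[n --> \oo] --> haar U.
    rewrite -[in X in _ --> X](open_inner oU); apply: nondecreasing_cvg_mu => //.
      exact: bigcupT_measurable.
    by move=> n m nm; apply/subsetPset; exact: inner_nd.
  move=> H; rewrite -[leLHS]/(haar U) -(cvg_lim _ H)//; apply: lime_le.
    by apply: ereal_nondecreasing_is_cvgn => n m nm; apply: le_mu_ext; exact: inner_nd.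
  apply: nearW => n; apply: ereal_sup_ubound; exists (inner n U) => //; split; last exact: inner_sub.
  exact: level_compact (@level_inner G n U).
- apply: ge_ereal_sup => _ [C [_ CU] <-]; exact: le_mu_ext.
Qed.

End HaarMeasure.

(** * Spectral gap from Heisenberg pairs in finite dimension *)

Section FiniteGap.
Context (R : realFieldType) (V : vectType R) (Gam : groupType).
Local Open Scope ring_scope.
Context (dot : V -> V -> R) (U : Gam -> V -> V).
Hypotheses (dotDl : forall u v w, dot (u + v) w = dot u w + dot v w)
  (dotZl : forall (a : R) u v, dot (a *: u) v = a * dot u v)
  (dotC : forall u v, dot u v = dot v u)
  (dot_ge0 : forall u, 0 <= dot u u)
  (dot_eq0 : forall u, dot u u = 0 -> u = 0)
  (UD : forall g u v, U g (u + v) = U g u + U g v)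
  (UZ : forall g a u, U g (a *: u) = a *: U g u)
  (U1 : forall u, U 1%g u = u)
  (UM : forall g h u, U (g * h)%g u = U g (U h u))
  (dotU : forall g u v, dot (U g u) (U g v) = dot u v).

Let dotDr u v w : dot u (v + w) = dot u v + dot u w.
Proof. by rewrite dotC dotDl !(dotC _ u). Qed.
Let dotZr a u v : dot u (a *: v) = a * dot u v.
Proof. by rewrite dotC dotZl dotC. Qed.
Let dotNl u v : dot (- u) v = - dot u v.
Proof. by rewrite -scaleN1r dotZl mulN1r. Qed.
Let dotNr u v : dot u (- v) = - dot u v.
Proof. by rewrite dotC dotNl dotC. Qed.
Let dot0l v : dot 0 v = 0.
Proof. by have := dotZl 0 0 v; rewrite scale0r mul0r. Qed.
Let dot_suml (I : Type) (r : seq I) (P : pred I) (F : I -> V) v :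
  dot (\sum_(i <- r | P i) F i) v = \sum_(i <- r | P i) dot (F i) v.
Proof.
by elim/big_rec2: _ => [|i x y _ xy]; [exact: dot0l|rewrite dotDl xy].
Qed.
Let dot_sumr (I : Type) (r : seq I) (P : pred I) (F : I -> V) v :
  dot v (\sum_(i <- r | P i) F i) = \sum_(i <- r | P i) dot v (F i).
Proof. by rewrite dotC dot_suml; apply: eq_bigr => i _; rewrite dotC. Qed.

Let U0 g : U g 0 = 0.
Proof. by have := UZ g 0 0; rewrite !scale0r. Qed.
Let UN g u : U g (- u) = - U g u.
Proof. by rewrite -scaleN1r UZ scaleN1r. Qed.
Let U_sum g (I : Type) (r : seq I) (P : pred I) (F : I -> V) :
  U g (\sum_(i <- r | P i) F i) = \sum_(i <- r | P i) U g (F i).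
Proof.
by elim/big_rec2: _ => [|i x y _ xy]; [exact: U0|rewrite UD xy].
Qed.
Let UV g u : U g^-1%g (U g u) = u.
Proof. by rewrite -UM mulVg U1. Qed.
Let dotUl g u v : dot (U g u) v = dot u (U g^-1%g v).
Proof. by rewrite -(dotU g^-1%g) UV. Qed.

Lemma fix_expg g u k : U g u = u -> U (g ^+ k)%g u = u.
Proof. by move=> gu; elim: k => [|k IH]; rewrite ?U1// expgS UM IH. Qed.

Lemma fix_invg g u : U g u = u -> U g^-1%g u = u.
Proof. by move=> gu; rewrite -{1}gu UV. Qed.

Context (p : nat) (p_pr : prime p).
Let p_neq0 : p%:R != 0 :> R.
Proof. by rewrite pnatr_eq0 -lt0n prime_gt0. Qed.

(** The orthogonal projection onto the vectors fixed by [g], when [g] has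
    order dividing [p]: the average of the powers of [g]. *)
Definition proj g (u : V) : V := p%:R^-1 *: \sum_(k < p) U (g ^+ k)%g u.

Lemma proj_linear g a u v : proj g (a *: u + v) = a *: proj g u + proj g v.
Proof.
rewrite /proj scalerA mulrC -scalerA -scalerDr; congr (_ *: _).
by rewrite scaler_sumr -big_split/=; apply: eq_bigr => k _; rewrite UD UZ.
Qed.

Lemma projD g u v : proj g (u + v) = proj g u + proj g v.
Proof. by rewrite -[u]scale1r proj_linear !scale1r. Qed.

Lemma proj_fixed g u : U g u = u -> proj g u = u.
Proof.
move=> gu; rewrite /proj (eq_bigr (fun=> u)); last by move=> k _; rewrite fix_expg.
by rewrite sumr_const card_ord -[u *+ p]scaler_nat scalerA mulVf// scale1r.
Qed.

Lemma U_proj g u : (g ^+ p = 1)%g -> U g (proj g u) = proj g u.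
Proof.
move=> gp; rewrite /proj UZ U_sum; congr (_ *: _).
case: p p_pr gp => // q _ gp.
rewrite big_ord_recr [RHS]big_ord_recl/= addrC; congr (_ + _).
  by rewrite -UM -expgS gp.
by apply: eq_bigr => i _; rewrite -UM -expgS.
Qed.

Lemma proj_idem g u : (g ^+ p = 1)%g -> proj g (proj g u) = proj g u.
Proof. by move=> gp; rewrite proj_fixed// U_proj. Qed.

Lemma dot_proj2 g u v : (g ^+ p = 1)%g -> dot (proj g u) (proj g v) = dot (proj g u) v.
Proof.
move=> gp; rewrite {2}/proj dotZr dot_sumr (eq_bigr (fun=> dot (proj g u) v)).
  by rewrite sumr_const card_ord -[X in _ * X]mulr_natl mulrA mulVf// mul1r.
move=> k _; rewrite dotC dotUl dotC; congr dot.
by apply: fix_invg; apply: fix_expg; exact: U_proj.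
Qed.

Lemma dot_projC g u v : (g ^+ p = 1)%g -> dot (proj g u) v = dot u (proj g v).
Proof.
move=> gp; rewrite [RHS]dotC -(dot_proj2 u v gp) -(dot_proj2 v u gp).
by rewrite dotC.
Qed.

Lemma projU_comm g h u : commute g h -> proj g (U h u) = U h (proj g u).
Proof.
move=> gh; rewrite /proj UZ U_sum; congr (_ *: _); apply: eq_bigr => k _.
by rewrite -!UM (commuteX k (commute_sym gh)).
Qed.

Lemma projZ g a u : proj g (a *: u) = a *: proj g u.
Proof.
rewrite /proj scalerA mulrC -scalerA; congr (_ *: _).
by rewrite scaler_sumr; apply: eq_bigr => k _.
Qed.

Lemma projN g u : proj g (- u) = - proj g u.
Proof. by rewrite -scaleN1r projZ scaleN1r. Qed.

Lemma proj_sum g (I : Type) (r : seq I) (F : I -> V) :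
  proj g (\sum_(i <- r) F i) = \sum_(i <- r) proj g (F i).
Proof.
elim: r => [|i r IH]; last by rewrite !big_cons projD IH.
by rewrite !big_nil /proj big1 ?scaler0.
Qed.

Lemma proj_proj_comm g h u : commute g h -> proj g (proj h u) = proj h (proj g u).
Proof.
move=> gh; rewrite {2}/proj projZ proj_sum; congr (_ *: _).
by apply: eq_bigr => k _; rewrite projU_comm//; exact: commuteX.
Qed.

(** For [j] prime to [p], the power [g ^+ j] has the same fixed vectors as
    [g]. *)
Lemma proj_pow g j u : (g ^+ p = 1)%g -> coprime j p -> proj (g ^+ j)%g u = proj g u.
Proof.
move=> gp cjp.
have [j' jj'] : exists j', (g ^+ (j * j') = g)%g.
  have j0 : (0 < j)%N by case: j cjp => //; rewrite /coprime gcd0n; case: p p_pr => [|[]].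
  have /(coprimeP _ j0)[[x y] /= xy] := cjp.
  exists x; rewrite mulnC; have -> : (x * j = 1 + y * p)%N by lia.
  by rewrite expgnDr expg1 mulnC expgnA gp expg1n mulg1.
have gjp : ((g ^+ j) ^+ p = 1)%g by rewrite -expgnA mulnC expgnA gp expg1n.
have cgj : commute g (g ^+ j)%g by apply: commuteX.
have fixg v : U g (proj (g ^+ j)%g v) = proj (g ^+ j)%g v.
  rewrite -[X in U X _]jj' expgnA; apply: fix_expg; exact: U_proj.
rewrite -[LHS](proj_fixed (fixg u)) proj_proj_comm// proj_fixed//.
by apply: fix_expg; exact: U_proj.
Qed.

(** The elementary inequality behind the angle estimate. Here [x] and [y] are
    the projections of [g] on two subspaces and [v] is the projection of [x]
    on the second one. If [v] is shorter than [x] by a factor [eps], then the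
    components [g - x] and [g - y] have almost nonnegative inner product. The
    two auxiliary squares express that the second projection contracts [x],
    and that two almost orthogonal projections of [g] cannot both be long. *)
Lemma angle_of_norm (eps : R) g x y v : 0 < eps -> eps < 1 -> 1 <= p%:R * eps ^+ 2 ->
  p%:R * dot v v <= dot x x -> dot x g = dot x x -> dot y g = dot y y ->
  dot v y = dot x y ->
  - (eps / 2) * (dot (g - x) (g - x) + dot (g - y) (g - y)) <= dot (g - x) (g - y).
Proof.
move=> eps0 eps1 peps W xg yg vy.
have H1 := dot_ge0 (v - eps *: y).
have H2 := dot_ge0 (x + y - (1 + eps) *: g).
have v0 := dot_ge0 v.
move: W H1 H2 v0.
rewrite !(dotDl, dotDr, dotNl, dotNr, dotZl, dotZr) (dotC y v) vy.
rewrite !(dotC g) (dotC y x) xg yg.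
set w := dot v v; set A := dot x x; set B := dot y y; set C := dot x y; set N := dot g g.
move=> W H1 H2 w0.
have w_le : w <= eps ^+ 2 * A.
  apply: (@le_trans _ _ (p%:R * eps ^+ 2 * w)); first by rewrite ler_peMl.
  by rewrite mulrAC mulrC ler_wpM2l// exprn_ge0// ltW.
have C2 : 2 * C <= eps * (A + B).
  by rewrite -(ler_pM2l eps0); nra.
have sN : A + B <= (1 + eps) * N.
  have e1 : 0 < 1 + eps by lra.
  rewrite -(ler_pM2l e1); nra.
have : 0 <= (1 - eps) * ((1 + eps) * N - (A + B)).
  by rewrite mulr_ge0// subr_ge0// ltW.
nra.
Qed.

Section Pair.
Context (a b z : Gam).
Hypotheses (ap : (a ^+ p = 1)%g) (bp : (b ^+ p = 1)%g) (zp : (z ^+ p = 1)%g)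
  (abz : (a * b = b * a * z)%g) (caz : commute a z) (cbz : commute b z).

Lemma heis_comm k j : (a ^+ k * b ^+ j = b ^+ j * z ^+ (k * j) * a ^+ k)%g.
Proof.
have H1 i : (a * b ^+ i = b ^+ i * (a * z ^+ i))%g.
  elim: i => [|i IH]; first by rewrite !expg0 !mul1g !mulg1.
  rewrite expgSr mulgA IH -!mulgA; congr (_ * _)%g.
  have -> : (z ^+ i * b = b * z ^+ i)%g by apply/commute_sym/commuteX.
  by rewrite !mulgA abz expgS !mulgA.
elim: k => [|k IH]; first by rewrite mul0n !expg0 mul1g !mulg1.
rewrite expgSr -mulgA H1 mulgA IH -!mulgA; congr (_ * _)%g.
rewrite mulSn expgnDr -(mulgA (z ^+ j)%g).
have -> : (a ^+ k * (a * z ^+ j) = z ^+ j * (a ^+ k * a))%g.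
  rewrite mulgA -expgSr; exact/commuteX2.
have zz : commute (z ^+ (k * j))%g (z ^+ j)%g by apply: commuteX2.
by rewrite !mulgA (zz : _ * _ = _ * _)%g.
Qed.

Let R_ u := proj a (proj b (proj z u)).

Let UaR u : U a (R_ u) = R_ u.
Proof. exact: U_proj. Qed.

Let R_C u : R_ u = proj b (proj a (proj z u)).
Proof.
rewrite /R_.
have UabP v : U a (U b (proj z v)) = U b (U a (proj z v)).
  rewrite -!UM abz !UM; congr (U b (U a _)); exact: U_proj.
have zP v : proj z (proj z v) = proj z v by exact: proj_idem.
set w := proj z u; have wz : proj z w = w by exact: zP.
have Zw k j : U (a ^+ k)%g (U (b ^+ j)%g w) = U (b ^+ j)%g (U (a ^+ k)%g w).
  rewrite -!UM heis_comm !UM; congr (U _ _).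
  rewrite -UM -(commuteX2 k (k * j)%N caz : _ * _ = _ * _)%g UM; congr (U _ _).
  by apply: fix_expg; rewrite -wz U_proj.
rewrite /proj; congr (_ *: _).
under eq_bigr do rewrite UZ U_sum scaler_sumr.
under [RHS]eq_bigr do rewrite UZ U_sum scaler_sumr.
rewrite exchange_big/=; apply: eq_bigr => k _; apply: eq_bigr => j _.
by rewrite Zw.
Qed.

Let UbR u : U b (R_ u) = R_ u.
Proof. by rewrite R_C U_proj. Qed.

(** Write [u] for the projection of [g] on the vectors fixed by [a]. For [j]
    prime to [p], the elements [a] and [b ^+ j] commute up to a generator of
    the group of [z], so averaging over the powers of [a] replaces [u] by its
    [z]-fixed part in the inner product of [b ^+ j u] with [u]. On [z]-fixed
    vectors [a] and [b] commute, so the inner products of this part add up to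
    zero over all [j], because [R_ g = 0]. Up to a nonpositive term, only [j =
    0] contributes to the average over [b], which gives the factor [p]. *)
Lemma heis_norm g : R_ g = 0 ->
  p%:R * dot (proj b (proj a g)) (proj b (proj a g)) <= dot (proj a g) (proj a g).
Proof.
move=> Rg; set u := proj a g.
have au : proj a u = u by exact: proj_idem.
have PbPz : proj b (proj z u) = 0.
  have caz' := commute_sym caz.
  by rewrite /u (proj_proj_comm g caz') -R_C.
move: u au PbPz => u au PbPz.
rewrite dot_proj2// {1}/proj dotZl mulrA mulfV// mul1r dot_suml.
have term (j : 'I_p) : (0 < j)%N -> dot (U (b ^+ j)%g u) u = dot (U (b ^+ j)%g (proj z u)) u.
  move=> j0; have cjp : coprime j p.
    by rewrite coprime_sym prime_coprime// gtnNdvd.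
  rewrite -{2}au -dot_projC// -(proj_pow u zp cjp); congr dot.
  rewrite {1 2}/proj UZ; congr (_ *: _).
  rewrite U_sum; apply: eq_bigr => k _.
  have auk : U (a ^+ k)%g u = u by apply: fix_expg; rewrite -au U_proj.
  by rewrite -!UM heis_comm [LHS]UM auk mulnC expgnA.
have sum0 : \sum_(j < p) dot (U (b ^+ j)%g (proj z u)) u = 0.
  by rewrite -dot_suml -[X in dot X _]scale1r -(mulfV p_neq0) -scalerA -/(proj b _) PbPz scaler0 dot0l.
have pz : 0 <= dot (proj z u) u by rewrite -dot_proj2.
pose j0 : 'I_p := Ordinal (prime_gt0 p_pr).
rewrite (bigD1 j0)//=.
rewrite (bigD1 j0)//= in sum0.
rewrite (eq_bigr (fun j : 'I_p => dot (U (b ^+ j)%g (proj z u)) u)).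
  move: sum0; rewrite !expg0 !U1 => /(canRL (addKr _)); rewrite addr0 => ->.
  by rewrite lerBlDr lerDl.
by move=> j jj0; apply: term; rewrite lt0n.
Qed.

(** Vectors fixed by both [a] and [b] are fixed by [z]; they contribute to
    neither side, and off them [heis_norm] gives the hypothesis of
    [angle_of_norm]. *)
Lemma heis_angle (eps : R) f : 0 < eps -> eps < 1 -> 1 <= p%:R * eps ^+ 2 ->
  - (eps / 2) * (dot (f - proj a f) (f - proj a f) + dot (f - proj b f) (f - proj b f))
    <= dot (f - proj a f) (f - proj b f).
Proof.
move=> eps0 eps1 peps.
(* [R_ f] is the component fixed by [a] and [b]; it is removed from [f]. *)
have UzR : U z (R_ f) = R_ f.
  have : U (a * b)%g (R_ f) = R_ f by rewrite UM UbR UaR.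
  rewrite abz !UM => h; rewrite -[LHS](UV a) -[U a _](UV b) h.
  by rewrite (fix_invg (UbR f)) (fix_invg (UaR f)).
pose g := f - R_ f.
have Rg : R_ g = 0.
  rewrite /g /R_ !(projD, projN) -/(R_ f).
  by rewrite (proj_fixed UzR) (proj_fixed (UbR f)) (proj_fixed (UaR f)) subrr.
have -> : f - proj a f = g - proj a g.
  by rewrite /g !(projD, projN) (proj_fixed (UaR f)) opprB addrA addrNK.
have -> : f - proj b f = g - proj b g.
  by rewrite /g !(projD, projN) (proj_fixed (UbR f)) opprB addrA addrNK.
apply: (angle_of_norm (v := proj b (proj a g))) => //.
- exact: heis_norm.
- by rewrite dot_proj2.
- by rewrite dot_proj2.
- by rewrite dot_proj2// dot_projC// dotC [RHS]dotC dot_projC.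
Qed.

End Pair.

Section Gap.
Context (I : finType) (g : I -> Gam) (eps : R).
Hypotheses (gp : forall i, (g i ^+ p = 1)%g)
  (gheis : forall i j, i != j -> exists z, [/\ (z ^+ p = 1)%g,
    (g i * g j = g j * g i * z)%g, commute (g i) z & commute (g j) z])
  (eps0 : 0 < eps) (epsI : #|I|%:R * eps < 1) (peps : 1 <= p%:R * eps ^+ 2).

Let Q i f := f - proj (g i) f.
Let lap f := \sum_i Q i f.
Let q i f := dot (Q i f) (Q i f).

Let lap_linear : linear lap.
Proof.
move=> a u v; rewrite /lap scaler_sumr -big_split/=; apply: eq_bigr => i _.
by rewrite /Q proj_linear scalerBr opprD addrACA.
Qed.

Let dot_Q i f h : dot (Q i f) h = dot f (Q i h).
Proof. by rewrite /Q dotDl dotNl dotDr dotNr dot_projC. Qed.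

Let dot_lapC f h : dot (lap f) h = dot f (lap h).
Proof. by rewrite dot_suml dot_sumr; apply: eq_bigr => i _; exact: dot_Q. Qed.

Let QQ i f : Q i (Q i f) = Q i f.
Proof. by rewrite /Q projD projN proj_idem// subrr subr0. Qed.

Let dot_lap f : dot (lap f) f = \sum_i q i f.
Proof. by rewrite dot_suml; apply: eq_bigr => i _; rewrite /q [RHS]dot_Q QQ dot_Q. Qed.

Let lap_sq f : (1 - #|I|%:R * eps) * dot (lap f) f <= dot (lap f) (lap f).
Proof.
have q0 i : 0 <= q i f by exact: dot_ge0.
have H i j : (i == j)%:R * q i f - eps / 2 * (q i f + q j f) <= dot (Q i f) (Q j f).
  have [<-|ij] := eqVneq i j.
    by rewrite mul1r -/(q i f) lerBlDr lerDl mulr_ge0 ?divr_ge0 ?addr_ge0// ltW.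
  have [z [zp abz caz cbz]] := gheis ij.
  have eps1 : eps < 1.
    apply: le_lt_trans epsI; rewrite ler_peMl ?(ltW eps0)//.
    by rewrite (ler_nat _ 1); apply/card_gt0P; exists i.
  rewrite mul0r add0r -mulNr; exact: (@heis_angle (g i) (g j) z).
rewrite dot_lap {1}/lap dot_suml.
have -> : \sum_i dot (Q i f) (lap f) = \sum_i \sum_j dot (Q i f) (Q j f).
  by apply: eq_bigr => i _; rewrite dot_sumr.
have -> : (1 - #|I|%:R * eps) * (\sum_i q i f) =
    \sum_i \sum_j ((i == j)%:R * q i f - eps / 2 * (q i f + q j f)).
  set S := \sum_i q i f.
  have E i : \sum_j ((i == j)%:R * q i f - eps / 2 * (q i f + q j f)) =
      q i f - eps / 2 * (#|I|%:R * q i f + S).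
    rewrite big_split/= sumrN -mulr_sumr big_split/= sumr_const mulr_natl.
    rewrite (bigD1 i)//= eqxx mul1r big1 ?addr0// => j ji.
    by rewrite eq_sym (negbTE ji) mul0r.
  rewrite (eq_bigr _ (fun i _ => E i)) big_split/= sumrN -mulr_sumr big_split/=.
  by rewrite -mulr_sumr sumr_const -/S -[S *+ _]mulr_natl; field.
by apply: ler_sum => i _; apply: ler_sum => j _; exact: H.
Qed.

(** The Laplacian [lap], the sum of the projections [1 - proj (g i)],
    satisfies [lap ^2 >= (1 - #|I| eps) lap]: expanding the square, the
    diagonal terms give [lap] and the other ones are controlled by
    [heis_angle]. Hence its nonzero spectrum is bounded below. Eigenvectors
    are avoided: on the image of [lap], the bound follows from the positivity
    of [lap] at one well-chosen vector. *)
Theorem heis_gap (f : V) : exists k : V, (forall i, U (g i) k = k) /\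
  (1 - #|I|%:R * eps) * dot (f - k) (f - k) <= \sum_i q i f.
Proof.
have lam0 : 0 < 1 - #|I|%:R * eps by rewrite subr_gt0.
pose L : {linear V -> V} := HB.pack lap (GRing.isLinear.Build R V V _ lap lap_linear).
pose D := linfun L.
have DE v : D v = lap v by rewrite lfunE.
have kerP v : v \in lker D -> forall i, U (g i) v = v.
  rewrite memv_ker DE => /eqP lv i.
  have : \sum_i q i v = 0 by rewrite -dot_lap lv dot0l.
  move/eqP; rewrite psumr_eq0; last by move=> j _; exact: dot_ge0.
  move/allP => /(_ i); rewrite mem_index_enum => /(_ isT) /eqP /dot_eq0 /eqP.
  by rewrite subr_eq0 => /eqP ->; exact: U_proj.
have cap0 : (lker D :&: limg D = 0)%VS.
  apply/eqP; rewrite -subv0; apply/subvP => v; rewrite memv_cap memv_ker => /andP[/eqP Dv].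
  case/memv_imgP => h _ vh; rewrite memv0; apply/eqP/dot_eq0.
  by rewrite {1}vh DE dot_lapC -DE Dv dotC dot0l.
have full : (lker D + limg D = fullv)%VS.
  apply/eqP; rewrite -[_ == _]/(_) eqEdim subvf/=.
  have := limg_ker_dim D fullv; rewrite capfv => <-.
  by rewrite dimv_disjoint_sum.
have : f \in (lker D + limg D)%VS by rewrite full memvf.
case/memv_addP => k kD [_ /memv_imgP[h _ ->] fE].
exists k; split; first exact: kerP.
have Qf i : Q i f = Q i (D h).
  by rewrite fE /Q projD (proj_fixed (kerP _ kD i)) opprD addrACA subrr add0r.
have -> : f - k = D h by rewrite fE addrC addKr.
rewrite (eq_bigr (fun i => q i (D h))); last by move=> i _; rewrite /q Qf.
rewrite -dot_lap; set v := D h.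
have vE : v = lap h by rewrite /v DE.
set lam := 1 - _ in lam0 *.
have psd x : 0 <= dot (lap x) x.
  by rewrite dot_lap; apply: sumr_ge0 => i _; exact: dot_ge0.
(* With [v = lap h], positivity at this vector and [lam <v, h> <= <v, v>] give [lam <v, v> <= <lap v, v>]. *)
have := psd (lam *: h - v).
have -> : lap (lam *: h - v) = lam *: v - lap v.
  by rewrite addrC -scaleN1r lap_linear scaleN1r -[lam *: h]addr0 lap_linear vE
    /lap [\sum_i Q i 0]big1 ?addr0 1?addrC// => i _; rewrite /Q (proj_fixed (U0 _)) subrr.
have := lap_sq h; rewrite -/lam -vE.
have wh : dot (lap v) h = dot v v by rewrite dot_lapC -vE.
clearbody v; move: (lap v) wh {Qf vE} => w wh la.
rewrite !(dotDl, dotDr, dotNl, dotNr, dotZl, dotZr) wh.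
set a := dot v h in la *; set N := dot v v in la *; set b := dot w v.
nra.
Qed.

(** A vector moved little by all powers of [g i] is close to its average over
    these powers. *)
Lemma proj_defect i (f : V) (M : R) :
  (forall k, (k < p)%N -> dot (f - U (g i ^+ k)%g f) (f - U (g i ^+ k)%g f) <= M) ->
  q i f <= M.
Proof.
move=> fM; have M0 : 0 <= M by apply: le_trans (fM 0%N (prime_gt0 p_pr)).
have E k : (k < p)%N -> dot (f - U (g i ^+ k)%g f) f <= M.
  move=> kp; have := fM k kp; move: (U _ _) (dotU (g i ^+ k)%g f f) => w.
  rewrite !(dotDl, dotDr, dotNl, dotNr) (dotC f w); lra.
have -> : q i f = dot (f - proj (g i) f) f by rewrite /q dot_Q QQ -dot_Q.
rewrite dotDl dotNl /proj dotZl dot_suml.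
have -> : dot f f - p%:R^-1 * (\sum_(k < p) dot (U (g i ^+ k)%g f) f) =
    p%:R^-1 * \sum_(k < p) dot (f - U (g i ^+ k)%g f) f.
  rewrite [in RHS](eq_bigr (fun k : 'I_p => dot f f - dot (U (g i ^+ k)%g f) f)); last first.
    by move=> k _; rewrite dotDl dotNl.
  by rewrite sumrB sumr_const card_ord mulrBr -[dot f f *+ p]mulr_natl mulKf.
rewrite mulrC ler_pdivrMr ?ltr0n ?prime_gt0//.
apply: (@le_trans _ _ (\sum_(k < p) M)).
  by apply: ler_sum => k _; exact: E.
by rewrite sumr_const card_ord -[M *+ p]mulr_natr.
Qed.

Corollary heis_spectral_gap (f : V) (M : R) :
  (forall i k, (k < p)%N -> dot (f - U (g i ^+ k)%g f) (f - U (g i ^+ k)%g f) <= M) ->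
  exists k : V, (forall i, U (g i) k = k) /\
    (1 - #|I|%:R * eps) * dot (f - k) (f - k) <= #|I|%:R * M.
Proof.
move=> fM; have [k [gk Hk]] := heis_gap f; exists k; split=> //.
apply: (le_trans Hk); apply: (@le_trans _ _ (\sum_(i : I) M)).
  by apply: ler_sum => i _; apply: proj_defect => n; exact: fM.
by rewrite sumr_const -[M *+ _]mulr_natl.
Qed.

End Gap.
End FiniteGap.

(** * The seminorm of square-integrable functions *)

Section L2.
Local Open Scope ring_scope.
Context d (T : measurableType d) (R : realType) (mu : probability T R).
Implicit Types f g : T -> R.

(** The square of the L_2 norm as an extended real, for which integration
    lemmas apply directly. *)
Definition sqint f : \bar R := (\int[mu]_x (f x ^+ 2)%:E)%E.

Lemma sqint_ge0 f : (0 <= sqint f)%E.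
Proof. by apply: integral_ge0 => x _; rewrite lee_fin sqr_ge0. Qed.

Lemma Lnorm2E f : ('N[mu]_2%:E[EFin \o f] = sqint f `^ 2^-1)%E.
Proof.
rewrite unlock /Lnorm; congr (poweR _ _); apply: eq_integral => x _ /=.
by rewrite -[LHS]/((`|f x| `^ 2)%:E) powR_mulrn// real_normK// num_real.
Qed.

Lemma Lfun2P f : measurable_fun setT f -> (sqint f < +oo)%E -> f \in Lfun mu 2%:E.
Proof.
move=> mf ff; rewrite inE/=; apply/andP; split; rewrite inE//=.
by rewrite /finite_norm Lnorm2E poweR_lty.
Qed.

Lemma Lfun2_measurable f : f \in Lfun mu 2%:E -> measurable_fun setT f.
Proof. by rewrite inE => /andP[]; rewrite inE. Qed.

Lemma Lfun2_sqint f : f \in Lfun mu 2%:E -> (sqint f < +oo)%E.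
Proof. by move=> /Lfun2_integrable_sqr /integrable_lty; exact. Qed.

Lemma L2_norm_ge0 f : 0 <= L2_norm mu f.
Proof. by rewrite /L2_norm fine_ge0// Lnorm_ge0. Qed.

Lemma L2_norm_sq f : f \in Lfun mu 2%:E -> ((L2_norm mu f ^+ 2)%:E = sqint f)%E.
Proof.
move=> /Lfun2_sqint ff; have fin : sqint f \is a fin_num.
  by rewrite ge0_fin_numE// sqint_ge0.
have s0 : 0 <= fine (sqint f) by rewrite fine_ge0// sqint_ge0.
rewrite /L2_norm Lnorm2E fine_poweR -powR_mulrn ?powR_ge0//.
by rewrite -powRrM mulVf// powRr1// fineK.
Qed.

Lemma L2_norm_le f (c : R) : 0 <= c -> (sqint f <= (c ^+ 2)%:E)%E -> f \in Lfun mu 2%:E -> L2_norm mu f <= c.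
Proof.
move=> c0 fc lf; rewrite -(@ler_pXn2r _ 2)// ?nnegrE ?L2_norm_ge0//.
by rewrite -lee_fin L2_norm_sq.
Qed.

Let p1 : (1 <= 2%:E :> \bar R)%E. Proof. by rewrite lee_fin ler1n. Qed.

Lemma L2_normD f g : f \in Lfun mu 2%:E -> g \in Lfun mu 2%:E ->
  L2_norm mu (f \+ g) <= L2_norm mu f + L2_norm mu g.
Proof.
move=> lf lg.
exact: (@ler_LnormD _ _ _ mu _ p1 (Lfun_Sub p1 lf) (Lfun_Sub p1 lg)).
Qed.

Lemma L2_normB f g : f \in Lfun mu 2%:E -> g \in Lfun mu 2%:E ->
  L2_norm mu (f \- g) <= L2_norm mu f + L2_norm mu g.
Proof.
move=> lf lg; have lg' : - g \in Lfun mu 2%:E by rewrite rpredN.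
apply: le_trans (L2_normD lf lg') _; rewrite lerD2l.
by rewrite [leLHS](@LnormrN _ _ _ mu _ p1 (Lfun_Sub p1 lg)).
Qed.

Lemma Lfun2D f g : f \in Lfun mu 2%:E -> g \in Lfun mu 2%:E -> f \+ g \in Lfun mu 2%:E.
Proof. exact: (Lfun_addr_closed mu p1).2. Qed.

Lemma Lfun2B f g : f \in Lfun mu 2%:E -> g \in Lfun mu 2%:E -> f \- g \in Lfun mu 2%:E.
Proof. by move=> lf lg; apply: Lfun2D lf _; rewrite (_ : (fun x => - g x) = - g) ?rpredN. Qed.

Lemma Lfun2Z a f : f \in Lfun mu 2%:E -> (fun x => a * f x) \in Lfun mu 2%:E.
Proof.
move=> lf; rewrite (_ : (fun x => _) = a \o* f); last by apply/funext => x /=; rewrite mulrC.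
by apply: Lfun_scale => //; rewrite ler1n.
Qed.

End L2.

(** * Density of locally constant functions *)

Section Restriction.
Local Open Scope ring_scope.
Context (G : nat -> finGroupType).

Definition restr n (x : prodgroup G) : {dffun forall i : 'I_n, G i} :=
  [ffun i : 'I_n => (x i : G i)].

(** A section of the restriction to the first [n] coordinates; functions of
    level [n] are recovered from their values on its image. *)
Definition ext n (y : {dffun forall i : 'I_n, G i}) : prodgroup G := fun i =>
  match @idP (i < n)%N with
  | ReflectT h => y (Ordinal h) : G i
  | ReflectF _ => (1%g : G i)
  end.

Lemma ext_restr n (x : prodgroup G) i : (i < n)%N -> ext (restr n x) i = x i.
Proof.
move=> ni; rewrite /ext; case: {-}_ / idP => [h|/negP]; last by rewrite ni.
by rewrite ffunE.
Qed.

Lemma restr_ext n (y : {dffun forall i : 'I_n, G i}) : restr n (ext y) = y.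
Proof.
apply/ffunP => -[i ni]; rewrite ffunE /ext/=; case: {-}_ / idP => [h|/negP]; last by rewrite ni.
by rewrite (bool_irrelevance h ni).
Qed.

Lemma level_ext n T (f : prodgroup G -> T) x : level n f -> f (ext (restr n x)) = f x.
Proof. by move=> lf; apply: lf => i ni; exact: ext_restr. Qed.

Lemma restrP n (x y : prodgroup G) : restr n x = restr n y <-> forall i, (i < n)%N -> x i = y i.
Proof.
split=> [/ffunP xy i ni|xy]; first by have := xy (Ordinal ni); rewrite !ffunE.
by apply/ffunP => i; rewrite !ffunE xy.
Qed.

Lemma level_fiber n (y : {dffun forall i : 'I_n, G i}) :
  level n ([set x | restr n x = y] : set (prodgroup G)).
Proof. by move=> a b /restrP ab; rewrite /mkset ab. Qed.

End Restriction.

Section LocallyConstant.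
Import HBNNSimple.
Local Open Scope ring_scope.
Context (R : realType) (G : nat -> finGroupType).
Let K := borel (prodgroup G).
Let mu : probability K R := @haar R G.

Lemma level_measurable n (f : K -> R) : level n f -> measurable_fun setT f.
Proof.
move=> lf _ B mB; rewrite setTI; apply: cylinder_measurable; exists n => x y xy.
by rewrite /preimage/mkset (lf x y).
Qed.

(** The common mass of the fibres of [restr n]: they are translates of each
    other. *)
Definition fibmass n : R := fine (mu [set x | restr n x = restr n (1%g : prodgroup G)]).

Lemma haar_fiber n (y : {dffun forall i : 'I_n, G i}) :
  (mu [set x | restr n x = y] = (fibmass n)%:E)%E.
Proof.
rewrite /fibmass fineK; last by apply: fin_num_measure; apply: cylinder_measurable; exists n; exact: level_fiber.
have mF : measurable ([set x | restr n x = restr n (1%g : prodgroup G)] : set K).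
  by apply: cylinder_measurable; exists n; exact: level_fiber.
rewrite -(@haar_left_invariant R G ((ext y)^-1)%g _ mF); congr (mu _).
apply/seteqP; split => x /=.
  move=> xy; apply/restrP => i ni.
  have := ext_restr x ni; rewrite xy /mulg/= /pgM /invg/= /pgV => ->.
  by rewrite mulVg.
move=> /restrP xy; rewrite -[y]restr_ext; apply/restrP => i ni.
have := xy i ni; rewrite /mulg/= /pgM /invg/= /pgV => /(congr1 (fun z => (ext y i : G i) * z)%g).
by rewrite mulKVg mulg1.
Qed.

Lemma fibmass_ge0 n : 0 <= fibmass n.
Proof. by rewrite fine_ge0. Qed.

Lemma sqint_level n (f : K -> R) : level n f ->
  (sqint mu f = (fibmass n * \sum_(y : {dffun forall i : 'I_n, G i}) f (ext y) ^+ 2)%:E)%E.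
Proof.
move=> lf; rewrite /sqint.
pose D (y : {dffun forall i : 'I_n, G i}) : set K := [set x | restr n x = y].
have mD y : measurable (D y) by apply: cylinder_measurable; exists n; exact: level_fiber.
transitivity (\int[mu]_x \sum_(y : {dffun forall i : 'I_n, G i}) (f (ext y) ^+ 2 * \1_(D y) x)%:E)%E.
  apply: eq_integral => x _; rewrite (bigD1 (restr n x))//= big1.
    by rewrite adde0 indicE mem_set// mulr1 level_ext.
  by move=> y yx; rewrite indicE memNset ?mulr0// => /esym/eqP; apply/negP.
rewrite ge0_integral_sum//; last 2 first.
- by move=> y; apply/measurable_EFinP; apply: measurable_funM => //.
- by move=> y x _; rewrite lee_fin mulr_ge0 ?sqr_ge0.
rewrite mulrC mulr_suml -sumEFin; apply: eq_bigr => y _.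
under eq_integral do rewrite EFinM.
rewrite ge0_integralZl//; last 2 first.
- by apply/measurable_EFinP.
- by rewrite lee_fin sqr_ge0.
by rewrite integral_indic// setIT [X in (_ * X)%E](haar_fiber y).
Qed.

Lemma level_Lfun n (f : K -> R) : level n f -> f \in Lfun mu 2%:E.
Proof.
by move=> lf; apply: Lfun2P; [exact: level_measurable lf|rewrite (sqint_level lf) ltry].
Qed.

(** Up to the factor [fibmass n], the norm is that of a finite-dimensional
    Euclidean space; this is what transfers the finite-dimensional gap to the
    Haar measure. *)
Lemma L2_norm_level n (f : K -> R) : level n f ->
  L2_norm mu f ^+ 2 = fibmass n * \sum_(y : {dffun forall i : 'I_n, G i}) f (ext y) ^+ 2.
Proof.
by move=> lf; apply/EFin_inj; rewrite (L2_norm_sq (level_Lfun lf)) (sqint_level lf).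
Qed.

Definition approximable (f : K -> R) := f \in Lfun mu 2%:E /\
  forall e : R, 0 < e -> exists n (g : K -> R), level n g /\ L2_norm mu (f \- g) <= e.

(** By outer regularity, [A] is close to an open set, which is close to one of
    the cylinder sets exhausting it. *)
Lemma haar_approx (A : set K) (e : R) : measurable A -> 0 < e ->
  exists C : set K, cylinder C /\ (mu (A `\` C) + mu (C `\` A) <= e%:E)%E.
Proof.
move=> mA e0; have e20 : 0 < e / 2 by rewrite divr_gt0.
have [U [oU AU Ue]] := haar_outer A e20.
have mU : measurable (U : set K) by exact: open_measurable_borel.
have mI n : measurable (inner n U : set K).
  by apply: cylinder_measurable; exists n; exact: level_inner.
have cv : mu (inner n U) @[n --> \oo] --> mu U.
  rewrite -[in X in _ --> X](open_inner oU); apply: nondecreasing_cvg_mu => //.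
    exact: bigcupT_measurable.
  by move=> n m nm; apply/subsetPset; exact: inner_nd.
have [n Hn] : exists n, (mu U - (e / 2)%:E < mu (inner n U))%E.
  have fU : mu U \is a fin_num by exact: fin_num_measure.
  have lt : (mu U - (e / 2)%:E < mu U)%E by rewrite lteBlDr// lteDl// lte_fin.
  apply: contrapT => /forallNP H; move: lt; apply/negP; rewrite -leNgt.
  rewrite -{1}(cvg_lim _ cv)//; apply: lime_le; first by apply/cvg_ex; eexists; exact: cv.
  by apply: nearW => n; rewrite leNgt; apply/negP/H.
exists (inner n U); split; first by exists n; exact: level_inner.
have fin (B : set K) : measurable B -> mu B \is a fin_num by exact: fin_num_measure.
rewrite [e]splitr EFinD; apply: leeD.
  apply: (@le_trans _ _ (mu (U `\` inner n U))).
    by apply: le_measure; rewrite ?inE; [exact: measurableD|exact: measurableD|exact: setSD].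
  rewrite measureD// ?ltey_eq ?fin// setIidr; last exact: inner_sub.
  by rewrite leeBlDr ?fin// addeC -leeBlDr ?ltW.
apply: (@le_trans _ _ (mu (U `\` A))).
  by apply: le_measure; rewrite ?inE; [exact: measurableD|exact: measurableD|apply: setSD; exact: inner_sub].
rewrite measureD// ?ltey_eq ?fin// setIidr//.
by rewrite leeBlDr ?fin// addeC.
Qed.

Lemma Lfun_indic (A : set K) : measurable A -> (\1_A : K -> R) \in Lfun mu 2%:E.
Proof.
move=> mA; apply: Lfun2P => //.
rewrite /sqint (eq_integral (fun x => (\1_A x)%:E)); last first.
  by move=> x _; rewrite indicE; case: (x \in A); rewrite ?expr1n ?expr0n.
by rewrite integral_indic// setIT -ge0_fin_numE//; exact: fin_num_measure.
Qed.

Lemma approx_indic (A : set K) : measurable A -> approximable \1_A.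
Proof.
move=> mA; split; first exact: Lfun_indic.
move=> e e0; have e20 : 0 < e ^+ 2 by rewrite exprn_gt0.
have [C [[n lC] Ce]] := haar_approx mA e20.
have mC : measurable C by apply: cylinder_measurable; exists n.
exists n, \1_C; split; first exact: level_indic.
apply: L2_norm_le; first exact: ltW.
  apply: le_trans Ce.
  rewrite /sqint (eq_integral (fun x => (\1_(A `\` C) x)%:E + (\1_(C `\` A) x)%:E)%E).
    rewrite ge0_integralD//; last 2 first.
    - by apply/measurable_EFinP; apply: measurable_indic; exact: measurableD.
    - by apply/measurable_EFinP; apply: measurable_indic; exact: measurableD.
    by rewrite !integral_indic ?setIT//; exact: measurableD.
  move=> x _; rewrite -EFinD /= !indicE !in_setD.
  by case: (x \in A); case: (x \in C); rewrite /= ?subrr ?subr0 ?sub0r ?sqrrN ?expr1n ?expr0n ?addr0 ?add0r.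
exact: (Lfun2B (Lfun_indic mA) (Lfun_indic mC)).
Qed.

Lemma approxD f g : approximable f -> approximable g -> approximable (f \+ g).
Proof.
move=> [lf af] [lg ag]; split; first exact: Lfun2D.
move=> e e0; have e20 : 0 < e / 2 by rewrite divr_gt0.
have [n [f' [lf' ff']]] := af _ e20; have [m [g' [lg' gg']]] := ag _ e20.
exists (maxn n m), (f' \+ g'); split.
  move=> x y xy /=; congr (_ + _).
    by apply: (level_le (leq_maxl n m) lf').
  by apply: (level_le (leq_maxr n m) lg').
rewrite (_ : _ \- _ = (f \- f') \+ (g \- g')); last first.
  by apply/funext => x /=; rewrite opprD addrACA.
have l1 := level_Lfun lf'; have l2 := level_Lfun lg'.
apply: le_trans (L2_normD _ _) _; try exact: Lfun2B.
by rewrite [leRHS]splitr lerD.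
Qed.

Lemma approx0 : approximable (fun=> 0).
Proof.
split; first exact: (@level_Lfun 0).
move=> e e0; exists 0%N, (fun=> 0); split => //.
by apply: L2_norm_le (ltW e0) _ _; [rewrite /sqint (eq_integral (fun=> 0%E)) ?integral0 ?lee_fin ?sqr_ge0//= => x _; rewrite subrr expr0n
  |exact: (@level_Lfun 0)].
Qed.

Lemma L2_normZ a f : f \in Lfun mu 2%:E -> L2_norm mu (fun x => a * f x) = `|a| * L2_norm mu f.
Proof.
move=> lf; have laf : (fun x => a * f x) \in Lfun mu 2%:E by exact: Lfun2Z.
have : (L2_norm mu (fun x => a * f x)) ^+ 2 = (`|a| * L2_norm mu f) ^+ 2.
  apply/EFin_inj; rewrite L2_norm_sq// exprMn EFinM (L2_norm_sq lf) /sqint.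
  rewrite -ge0_integralZl//; last 2 first.
  - by apply/measurable_EFinP; apply: measurable_funX; exact: (Lfun2_measurable lf).
  - by move=> x _; rewrite lee_fin sqr_ge0.
  by apply: eq_integral => x _; rewrite -EFinM exprMn real_normK// num_real.
by move/eqP; rewrite eqrXn2 ?mulr_ge0 ?L2_norm_ge0// => /eqP.
Qed.

Lemma approxZ a f : approximable f -> approximable (fun x => a * f x).
Proof.
move=> [lf af]; split; first exact: Lfun2Z.
move=> e e0; have e20 : 0 < e / (`|a| + 1) by rewrite divr_gt0// ltr_wpDl.
have [n [f' [lf' ff']]] := af _ e20.
exists n, (fun x => a * f' x); split; first by move=> x y /lf' ->.
rewrite (_ : _ \- _ = fun x => a * (f \- f') x); last first.
  by apply/funext => x /=; rewrite mulrBr.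
have l1 := level_Lfun lf'.
rewrite L2_normZ; last exact: Lfun2B.
apply: le_trans (ler_wpM2l _ ff') _ => //.
by rewrite mulrCA ger_pMr// ler_pdivrMr ?mul1r ?ltr_wpDl// lerDl.
Qed.

Lemma approx_closed f : f \in Lfun mu 2%:E ->
  (forall e : R, 0 < e -> exists2 h, approximable h & L2_norm mu (f \- h) <= e) -> approximable f.
Proof.
move=> lf H; split=> // e e0; have e20 : 0 < e / 2 by rewrite divr_gt0.
have [h [lh ah] fh] := H _ e20; have [n [g [lg hg]]] := ah _ e20.
exists n, g; split => //.
rewrite (_ : _ \- _ = (f \- h) \+ (h \- g)); last first.
  by apply/funext => x /=; rewrite addrA subrK.
have l1 := level_Lfun lg.
apply: le_trans (L2_normD _ _) _; try exact: Lfun2B.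
by rewrite [leRHS]splitr lerD.
Qed.

Lemma approx_nnsfun (h : {nnsfun K >-> R}) : approximable h.
Proof.
have -> : (h : K -> R) = fun x => \sum_(y <- fset_set (range h)) (y * \1_(h @^-1` [set y]) x).
  by apply/funext => x; rewrite [LHS](fimfunE h) fsbig_finite.
elim: (finmap.enum_fset _) => [|y s IH].
  by under eq_fun do rewrite big_nil; exact: approx0.
under eq_fun do rewrite big_cons.
apply: approxD IH; apply: approxZ; apply: approx_indic.
by rewrite -[X in measurable X]setTI; exact: measurable_funP.
Qed.

Lemma approx_ge0 f : f \in Lfun mu 2%:E -> (forall x, 0 <= f x) -> approximable f.
Proof.
move=> lf f0; apply: approx_closed => // e e0.
have mf := Lfun2_measurable lf.
have mEf : measurable_fun setT (EFin \o f) by apply/measurable_EFinP.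
pose h := nnsfun_approx measurableT mEf.
have Ef0 (x : K) : setT x -> (0 <= (EFin \o f) x)%E by rewrite lee_fin.
have h_le n x : h n x <= f x.
  rewrite -lee_fin /h nnsfun_approxE.
  exact: (le_approx n Ef0 I).
have h_cvg x : (h n x)%:E @[n --> \oo] --> (f x)%:E.
  exact: (cvg_nnsfun_approx measurableT mEf Ef0 I).
have [] := @dominated_convergence _ _ _ mu setT measurableT
  (fun n x => ((f x - h n x) ^+ 2)%:E) (fun=> 0%E) (fun x => (f x ^+ 2)%:E).
- by move=> n; apply/measurable_EFinP; apply: measurable_funX; apply: measurable_funB.
- exact: measurable_cst.
- apply: aeW => x _.
  have : (f x - h n x) ^+ 2 @[n --> \oo] --> (f x - f x) ^+ 2.
    have c1 : f x - h n x @[n --> \oo] --> f x - f x.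
      apply: cvgB; first exact: cvg_cst.
      by have /fine_cvgP[_] := h_cvg x; exact.
    rewrite expr2; under eq_fun do rewrite expr2; exact: cvgM.
  rewrite subrr expr0n/= => c2.
  by apply/fine_cvgP; split; [exact: nearW|].
- exact: Lfun2_integrable_sqr.
- apply: aeW => x n _; rewrite gee0_abs ?lee_fin ?sqr_ge0//.
  rewrite ler_sqr ?nnegrE ?subr_ge0//.
  by rewrite lerBlDr lerDl.
move=> _ _; rewrite integral0 => cv.
have [n Hn] : exists n, (sqint mu (f \- h n)%R <= (e ^+ 2)%:E)%E.
  apply: contrapT => /forallNP H.
  have : ((e ^+ 2)%:E <= 0 :> \bar R)%E.
    rewrite -(cvg_lim _ cv)//; apply: lime_ge; first by apply/cvg_ex; eexists; exact: cv.
    by apply: nearW => n; rewrite ltW// ltNge; apply/negP/H.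
  by rewrite leNgt lte_fin exprn_gt0.
have ah := approx_nnsfun (h n); exists (h n) => //.
by apply: L2_norm_le (ltW e0) Hn _; apply: Lfun2B lf _; case: ah.
Qed.

(** From indicators to simple functions by linearity, to nonnegative functions
    by monotone approximation, and to all functions by splitting into positive
    and negative parts. *)
Lemma approx_all f : f \in Lfun mu 2%:E -> approximable f.
Proof.
move=> lf; have mf := Lfun2_measurable lf.
have sq_le (g : K -> R) : measurable_fun setT g -> (forall x, g x ^+ 2 <= f x ^+ 2) -> g \in Lfun mu 2%:E.
  move=> mg gf; apply: Lfun2P => //; apply: le_lt_trans (Lfun2_sqint lf).
  apply: ge0_le_integral => //=.
  - by move=> x; rewrite lee_fin sqr_ge0.
  - by apply/measurable_EFinP; apply: measurable_funX.
  - by apply/measurable_EFinP; apply: measurable_funX.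
  - by move=> x _; rewrite lee_fin.
have posl : f^\+ \in Lfun mu 2%:E.
  apply: sq_le; first exact: measurable_funrpos.
  by move=> x; rewrite /funrpos; case: (leP (f x) 0) => // h; rewrite ?expr0n ?sqr_ge0.
have negl : f^\- \in Lfun mu 2%:E.
  apply: sq_le; first exact: measurable_funrneg.
  by move=> x; rewrite /funrneg; case: (leP (- f x) 0) => // h; rewrite ?expr0n ?sqr_ge0 ?sqrrN.
have -> : f = (f^\+ \+ (fun x => -1 * f^\- x)).
  by rewrite -[LHS]funrposBneg; apply/funext => x /=; rewrite mulN1r.
by apply: approxD; [|apply: approxZ]; apply: approx_ge0.
Qed.

End LocallyConstant.

(** * Generated subgroups and left translations *)

Section Generated.
Local Open Scope ring_scope.
Context (G : groupType).
Implicit Types (S : set G) (L : subgroup G).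

Lemma generated_subgroup S : is_subgroup (Defs.generated S).
Proof.
split.
- by move=> A [[A1 _ _] _].
- by move=> x y Sx Sy A SA; have [[_ AM _] _] := SA; apply: AM; [exact: Sx|exact: Sy].
- by move=> x Sx A SA; have [[_ _ AV] _] := SA; apply: AV; exact: Sx.
Qed.

Lemma sub_generated S : S `<=` Defs.generated S.
Proof. by move=> x Sx A [_ SA]; exact: SA. Qed.

Lemma generated_min S (A : set G) : is_subgroup A -> S `<=` A -> Defs.generated S `<=` A.
Proof. by move=> gA SA x; apply. Qed.

Definition gensub S : subgroup G := Subgroup (generated_subgroup S).

End Generated.

Section GeneratedSubgroup.
Local Open Scope ring_scope.
Context (G : groupType).
Implicit Types (S : set G) (L : subgroup G).

Lemma subgroup_preimage_generates S L : Defs.generated S = L ->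
  generates ((fun s : subgroup_type L => \val s : G) @^-1` S).
Proof.
move=> SL; apply/seteqP; split => // s _.
pose T := Defs.generated ((fun s : subgroup_type L => \val s : G) @^-1` S).
pose A : set G := [set x | exists2 s : subgroup_type L, T s & \val s = x].
have [T1 TM TV] := generated_subgroup ((fun s : subgroup_type L => \val s : G) @^-1` S).
have gA : is_subgroup A.
  split.
  - by exists 1%g => //; exact: gmulf1.
  - move=> _ _ [a Ta <-] [b Tb <-]; exists (a * b)%g; first exact: TM.
    exact: gmulfM.
  - move=> _ [a Ta <-]; exists (a^-1)%g; first exact: TV.
    exact: gmulfV.
have SA : S `<=` A.
  move=> x Sx; have Lx : x \in (L : set G) by rewrite -SL; apply: mem_set; exact: sub_generated.
  have e : \val (Sub x Lx : subgroup_type L) = x by rewrite SubK.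
  by exists (Sub x Lx : subgroup_type L) => //; apply: sub_generated; rewrite /preimage/mkset e.
have : A (\val s) by apply: (generated_min gA SA); rewrite SL; exact: set_mem (valP s).
by case=> s' Ts' /val_inj <-.
Qed.

Lemma finite_val_preimage S L : finite_set S ->
  finite_set ((fun s : subgroup_type L => \val s : G) @^-1` S).
Proof. by move=> fS; apply: finite_preimage => // x y _ _; exact: val_inj. Qed.

Lemma gensub_finitely_generated S : finite_set S ->
  finitely_generated (subgroup_type (gensub S)).
Proof.
move=> fS; exists ((fun s : subgroup_type (gensub S) => \val s : G) @^-1` S).
by split; [exact: finite_val_preimage|exact: subgroup_preimage_generates].
Qed.

End GeneratedSubgroup.

Section Translation.
Local Open Scope ring_scope.
Context (R : realType) (G : nat -> finGroupType).
Let K := borel (prodgroup G).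
Let mu : probability K R := @haar R G.
Implicit Types (f : K -> R) (g : prodgroup G).

Definition ltrans g f : K -> R := fun x => f (g^-1 * (x : prodgroup G))%g.

Lemma ltransM g h f : ltrans (g * h)%g f = ltrans g (ltrans h f).
Proof. by apply/funext => x; rewrite /ltrans invgM mulgA. Qed.

Lemma ltrans1 f : ltrans 1%g f = f.
Proof. by apply/funext => x; rewrite /ltrans invg1 mul1g. Qed.

Lemma mulg_measurable g : measurable_fun setT ((fun x => g * x)%g : K -> K).
Proof. by move=> _ B mB; rewrite setTI; exact: translate_measurable. Qed.

Lemma sqint_ltrans g f : measurable_fun setT f -> sqint mu (ltrans g f) = sqint mu f.
Proof.
move=> mf; have mg := mulg_measurable g^-1%g.
have mf2 : measurable_fun setT (fun x : K => (f x ^+ 2)%:E).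
  by apply/measurable_EFinP; apply: measurable_funX.
transitivity (\int[pushforward mu ((fun x => g^-1 * x)%g : K -> K)]_x (f x ^+ 2)%:E)%E.
  rewrite ge0_integral_pushforward//.
  by move=> x _; rewrite lee_fin sqr_ge0.
apply: eq_measure_integral => A mA _.
exact: haar_left_invariant.
Qed.

Lemma ltrans_Lfun g f : f \in Lfun mu 2%:E -> ltrans g f \in Lfun mu 2%:E.
Proof.
move=> lf; have mf := Lfun2_measurable lf.
apply: Lfun2P; last by rewrite sqint_ltrans//; exact: Lfun2_sqint.
exact: (measurableT_comp mf (mulg_measurable g^-1%g)).
Qed.

Lemma L2_norm_ltrans g f : f \in Lfun mu 2%:E -> L2_norm mu (ltrans g f) = L2_norm mu f.
Proof.
by move=> lf; rewrite /L2_norm !Lnorm2E sqint_ltrans//; exact: Lfun2_measurable lf.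
Qed.

Lemma L2_norm_sum (I : Type) (r : seq I) (F : I -> K -> R) :
  (forall i, F i \in Lfun mu 2%:E) ->
  (fun x => \sum_(i <- r) F i x) \in Lfun mu 2%:E /\
  L2_norm mu (fun x => \sum_(i <- r) F i x) <= \sum_(i <- r) L2_norm mu (F i).
Proof.
move=> lF; elim: r => [|i r [IH1 IH2]].
  under eq_fun do rewrite big_nil; rewrite big_nil.
  have l0 : (fun=> 0) \in Lfun mu 2%:E by exact: (@level_Lfun _ _ 0).
  split=> //; apply: L2_norm_le => //.
  by rewrite /sqint (eq_integral (fun=> 0%E)) ?integral0 ?lee_fin ?sqr_ge0//= => x _; rewrite expr0n.
under eq_fun do rewrite big_cons; rewrite big_cons; split; first exact: Lfun2D.
by apply: le_trans (L2_normD _ _) _ => //; rewrite lerD2l.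
Qed.

Lemma L2_norm_ae0 f : f \in Lfun mu 2%:E -> f = (fun=> 0) %[ae mu] -> L2_norm mu f = 0.
Proof.
move=> lf f0; apply/eqP; rewrite eq_le L2_norm_ge0 andbT.
apply: L2_norm_le => //; rewrite expr0n/= /sqint.
have mf := Lfun2_measurable lf.
rewrite (ae_eq_integral (fun=> 0%E))// ?integral0//.
- by apply/measurable_EFinP; apply: measurable_funX.
- by apply: filterS f0 => x /= H _; rewrite H// expr0n.
Qed.

(** Let [u] be the displacement. The translates of [u] by [1, s, ..., s^(p-1)]
    have sum zero because [s ^+ p = 1], while [h] equals all its translates;
    so averaging the translates of [u - h] over the powers of [s] yields
    [- h]. Hence the norm of [h] is at most that of [u - h], and the norm of
    [u] is at most twice that of [u - h]. *)
Lemma torsion_displacement s p f h : (0 < p)%N -> (s ^+ p = 1)%g ->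
  f \in Lfun mu 2%:E -> h \in Lfun mu 2%:E ->
  (forall k, ltrans (s ^+ k)%g h = h %[ae mu]) ->
  L2_norm mu (ltrans s f \- f) <= 2 * L2_norm mu ((ltrans s f \- f) \- h).
Proof.
move=> p0 sp lf lh sh; set u := ltrans s f \- f.
have lu : u \in Lfun mu 2%:E by apply: Lfun2B => //; exact: ltrans_Lfun.
have luh : u \- h \in Lfun mu 2%:E by exact: Lfun2B.
have tele : forall n x, \sum_(k < n) ltrans (s ^+ k)%g u x = ltrans (s ^+ n)%g f x - f x.
  move=> n x; elim: n => [|n IH]; first by rewrite big_ord0 expg0 ltrans1 subrr.
  rewrite big_ord_recr/= IH expgSr ltransM.
  by rewrite {1}/u {2}/ltrans/= -/(ltrans _ _ _) addrC addrA; congr (_ - _); rewrite /ltrans/= subrK.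
have hE : (fun x => p%:R * h x) =
   (fun x => \sum_(k < p) ((fun x => -1 * ltrans (s ^+ k)%g (u \- h) x) \- (ltrans (s ^+ k)%g h \- h)) x).
  apply/funext => x.
  transitivity (\sum_(k < p) (h x - ltrans (s ^+ k)%g u x)).
    by rewrite sumrB tele sp ltrans1 subrr subr0 sumr_const card_ord mulr_natl.
  by apply: eq_bigr => k _; rewrite /ltrans/=; ring.
have lsh k : ltrans (s ^+ k)%g h \- h \in Lfun mu 2%:E by apply: Lfun2B => //; exact: ltrans_Lfun.
have lsuh k : (fun x => -1 * ltrans (s ^+ k)%g (u \- h) x) \in Lfun mu 2%:E.
  by apply: Lfun2Z; exact: ltrans_Lfun.
have hn : L2_norm mu h <= L2_norm mu (u \- h).
  have p0' : 0 < p%:R :> R by rewrite ltr0n.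
  rewrite -(ler_pM2l p0') -{1}[p%:R]ger0_norm// -L2_normZ// hE.
  apply: le_trans (L2_norm_sum _ _).2 _; first by move=> k; exact: Lfun2B.
  have -> : p%:R * L2_norm mu (u \- h) = \sum_(k < p) L2_norm mu (u \- h).
    by rewrite sumr_const card_ord mulr_natl.
  apply: ler_sum => k _.
  apply: le_trans (L2_normB _ _) _ => //.
  rewrite [X in _ + X]L2_norm_ae0// ?addr0.
    by rewrite L2_normZ ?ltrans_Lfun// normrN1 mul1r L2_norm_ltrans.
  by apply: filterS (sh k) => x /= H I; rewrite H// subrr.
have -> : u = (u \- h) \+ h by apply/funext => x /=; rewrite subrK.
rewrite (_ : _ \- h = u \- h); last by apply/funext => x /=; rewrite addrK.
apply: le_trans (L2_normD _ _) _ => //; lra.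
Qed.

End Translation.

(** * Spectral gap for the Haar measure *)

Section LevelGap.
Local Open Scope ring_scope.
Context (R : realType) (G : nat -> finGroupType) (n : nat).
Let X := {dffun forall i : 'I_n, G i}.
Implicit Types (f : {ffun X -> R^o}) (g h : prodgroup G).

(** The action of the product group on the finite quotient formed by the first
    [n] coordinates. *)
Definition lact g (y : X) : X := restr n (g * ext y)%g.
Definition lrep g f : {ffun X -> R^o} := [ffun y => f (lact g^-1%g y)].
Definition ldot (u v : {ffun X -> R^o}) : R := \sum_y u y * v y.

Lemma lactM g h y : lact (g * h)%g y = lact g (lact h y).
Proof.
by apply/restrP => i ni; rewrite [LHS]prodgroupM [RHS]prodgroupM ext_restr// !prodgroupM mulgA.
Qed.

Lemma lact1 y : lact 1%g y = y.
Proof. by rewrite /lact mul1g restr_ext. Qed.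

Lemma lact_inj g : injective (lact g).
Proof. by move=> x y /(congr1 (lact g^-1%g)); rewrite -!lactM mulVg !lact1. Qed.

Lemma lrepM g h f : lrep (g * h)%g f = lrep g (lrep h f).
Proof. by apply/ffunP => y; rewrite !ffunE invgM lactM. Qed.

Lemma lrep1 f : lrep 1%g f = f.
Proof. by apply/ffunP => y; rewrite ffunE invg1 lact1. Qed.

Lemma level_lact T (F : prodgroup G -> T) g y : level n F -> F (ext (lact g y)) = F (g * ext y)%g.
Proof. by move=> lF; rewrite level_ext. Qed.

Context (I : finType) (a : I -> prodgroup G) (p : nat) (eps : R).
Hypotheses (p_pr : prime p) (ap : forall i, (a i ^+ p = 1)%g)
  (aheis : forall i j, i != j -> exists z, [/\ (z ^+ p = 1)%g,
    (a i * a j = a j * a i * z)%g, commute (a i) z & commute (a j) z])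
  (eps0 : 0 < eps) (epsI : #|I|%:R * eps < 1) (peps : 1 <= p%:R * eps ^+ 2).
Hypothesis adense : forall x : prodgroup G, exists2 y, Defs.generated (range a) y &
  forall i, (i < n)%N -> y i = x i.

(** Functions on the finite quotient fixed by the [a i] are constant, because
    the [a i] generate a transitive group there. *)
Lemma fixed_cst f : (forall i, lrep (a i) f = f) -> exists c : R, forall y, f y = c.
Proof.
move=> af; exists (f (restr n 1%g)) => y.
have fixg g : Defs.generated (range a) g -> lrep g f = f.
  apply: (@generated_min _ _ [set g | lrep g f = f]).
    split => /=; first exact: lrep1.
      by move=> g1 g2 gf hf; rewrite lrepM hf.
    by move=> g1 gf; rewrite -{1}gf -lrepM mulVg lrep1.
  by move=> _ [i _ <-]; exact: af.
have [g /fixg/ffunP/(_ y) + gy] := adense (ext y).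
rewrite ffunE => <-; congr (fun_of_fin f _); apply/restrP => i ni.
by rewrite prodgroupM prodgroupV gy// mulVg.
Qed.

Lemma level_gap (F : prodgroup G -> R) (M : R) : level n F ->
  (forall i k, (k < p)%N -> \sum_(y : X) (F (ext y) - ltrans (a i ^+ k)%g F (ext y)) ^+ 2 <= M) ->
  exists c : R, (1 - #|I|%:R * eps) * (\sum_(y : X) (F (ext y) - c) ^+ 2) <= #|I|%:R * M.
Proof.
move=> lF FM; pose f : {ffun X -> R^o} := [ffun y => F (ext y)].
have [|||||||||k] := @heis_spectral_gap R {ffun X -> R^o} (prodgroup G) ldot lrep
  _ _ _ _ _ _ _ lrep1 lrepM _ p p_pr I a eps ap aheis eps0 epsI peps f M.
- by move=> u v w; rewrite /ldot -big_split/=; apply: eq_bigr => y _; rewrite ffunE mulrDl.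
- by move=> c u v; rewrite /ldot mulr_sumr; apply: eq_bigr => y _; rewrite ffunE -mulrA.
- by move=> u v; apply: eq_bigr => y _; rewrite mulrC.
- by move=> u; apply: sumr_ge0 => y _; rewrite -expr2 sqr_ge0.
- move=> u /eqP; rewrite psumr_eq0; last by move=> y _; rewrite -expr2 sqr_ge0.
  move=> /allP H; apply/ffunP => y; have := H y; rewrite mem_index_enum => /(_ isT).
  by rewrite -expr2 sqrf_eq0 ffunE => /eqP.
- by move=> g u v; apply/ffunP => y; rewrite !ffunE.
- by move=> g c u; apply/ffunP => y; rewrite !ffunE.
- move=> g u v; rewrite /ldot (reindex_inj (@lact_inj g))/=; apply: eq_bigr => y _.
  by rewrite !ffunE -lactM mulVg lact1.
- move=> i k kp; apply: le_trans (FM i k kp); rewrite le_eqVlt; apply/orP; left; apply/eqP.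
  by apply: eq_bigr => y _; rewrite !ffunE level_lact.
move=> [/fixed_cst[c kc]] H; exists c; apply: le_trans H.
rewrite le_eqVlt; apply/orP; left; apply/eqP; congr (_ * _).
by apply: eq_bigr => y _; rewrite !ffunE kc.
Qed.

End LevelGap.

Section HaarGap.
Local Open Scope ring_scope.
Context (R : realType) (G : nat -> finGroupType).

Lemma finite_has_ubound (E : set R) : finite_set E -> has_ubound E.
Proof.
move=> /finite_seqP[s ->]; exists (\sum_(y <- s) `|y|) => x /= xs.
apply: (le_trans (ler_norm x)); rewrite (big_rem x)//= lerDl.
exact: sumr_ge0.
Qed.
Let K := borel (prodgroup G).
Let mu : probability K R := @haar R G.

Lemma left_translation_preserving (L : subgroup (prodgroup G)) :
  measure_preserving_action mu (@left_translation (prodgroup G) L).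
Proof.
split.
- by move=> x; rewrite /left_translation gmulf1 mul1g.
- by move=> g h x; rewrite /left_translation gmulfM mulgA.
- by move=> g; exact: mulg_measurable.
- by move=> g A mA; exact: haar_left_invariant.
Qed.

Lemma translateE (L : subgroup (prodgroup G)) (s : subgroup_type L) (f : K -> R) :
  translate (@left_translation (prodgroup G) L) s f = ltrans (\val s : prodgroup G) f.
Proof. by apply/funext => x; rewrite /translate /left_translation /ltrans gmulfV. Qed.

Context (I : finType) (a : I -> prodgroup G) (p : nat) (eps : R).
Hypotheses (p_pr : prime p) (ap : forall i, (a i ^+ p = 1)%g)
  (aheis : forall i j, i != j -> exists z, [/\ (z ^+ p = 1)%g,
    (a i * a j = a j * a i * z)%g, commute (a i) z & commute (a j) z])
  (eps0 : 0 < eps) (epsI : #|I|%:R * eps < 1) (peps : 1 <= p%:R * eps ^+ 2).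
Hypothesis adense : forall n (x : prodgroup G), exists2 y, Defs.generated (range a) y &
  forall i, (i < n)%N -> y i = x i.

Lemma level_gap_norm n (h : K -> R) (M : R) : level n h -> 0 <= M ->
  (forall i k, (k < p)%N -> L2_norm mu (ltrans (a i ^+ k)%g h \- h) <= M) ->
  exists c : R, L2_norm mu (h \- cst c) <= (#|I|%:R / (1 - #|I|%:R * eps) + 1) * M.
Proof.
move=> lh M0 hM.
have lam0 : 0 < 1 - #|I|%:R * eps by rewrite subr_gt0.
have w0 := fibmass_ge0 R G n.
have C1 : 0 <= #|I|%:R / (1 - #|I|%:R * eps) :> R by rewrite divr_ge0// ltW.
have lB (f g : K -> R) : level n f -> level n g -> level n (f \- g).
  by move=> lf lg x y xy /=; rewrite (lf x y)// (lg x y).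
have ls g : level n (ltrans g h) by exact: level_preimage_mul.
have sqM i k : (k < p)%N -> fibmass R G n * \sum_(y : {dffun forall i : 'I_n, G i})
   (h (ext y) - ltrans (a i ^+ k)%g h (ext y)) ^+ 2 <= M ^+ 2.
  move=> kp; have := hM i k kp; rewrite -(@ler_pXn2r _ 2)// ?nnegrE ?L2_norm_ge0//.
  rewrite (L2_norm_level (lB _ _ (ls _) lh)) => H; apply: le_trans H.
  rewrite ler_wpM2l// le_eqVlt; apply/orP; left; apply/eqP; apply: eq_bigr => y _ /=.
  by rewrite -sqrrN opprB.
have [w_eq0|w_neq0] := eqVneq (fibmass R G n) 0.
  exists 0; rewrite -(@ler_pXn2r _ 2)// ?nnegrE ?L2_norm_ge0// ?mulr_ge0 ?addr_ge0//.
  rewrite (L2_norm_level (lB _ _ lh _))// w_eq0 mul0r.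
  by rewrite sqr_ge0.
have wp : 0 < fibmass R G n by rewrite lt_def w_neq0.
have [|c Hc] := @level_gap R G n I a p eps p_pr ap aheis eps0 epsI peps (adense n) h (M ^+ 2 / fibmass R G n) lh.
  by move=> i k kp; rewrite ler_pdivlMr// mulrC; exact: sqM.
exists c; rewrite -(@ler_pXn2r _ 2)// ?nnegrE ?L2_norm_ge0// ?mulr_ge0 ?addr_ge0//.
rewrite (L2_norm_level (lB _ _ lh _))//=.
set S := \sum_ _ _ in Hc *.
set C := #|I|%:R / _ in C1 *.
have CE : #|I|%:R = C * (1 - #|I|%:R * eps) by rewrite divfK// gt_eqF.
have HS : fibmass R G n * S <= C * M ^+ 2.
  move: Hc => /(ler_wpM2l w0).
  have -> : fibmass R G n * (#|I|%:R * (M ^+ 2 / fibmass R G n)) = #|I|%:R * M ^+ 2 by field.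
  rewrite [X in _ <= X * _]CE => Hc; rewrite -(ler_pM2l lam0).
  by move: Hc; rewrite [in X in X -> _]mulrCA [C * (_ - _)]mulrC -mulrA.
apply: le_trans HS _; rewrite exprMn ler_wpM2r ?sqr_ge0//; nra.
Qed.

(** Spectral gap may be tested on any finite generating set, so the powers of
    the [a i] are added to [S]. By [torsion_displacement] the quotient
    seminorms bound the displacements of [f] by these powers; the estimate of
    [level_gap_norm], applied to a locally constant approximation of [f],
    shows that [f] is close to a constant, which is an invariant vector. *)
Theorem haar_spectral_gap (S : set (prodgroup G)) (L : subgroup (prodgroup G)) :
  finite_set S -> Defs.generated S = L -> (forall i, (L : set _) (a i)) ->
  spectral_gap mu (@left_translation (prodgroup G) L).
Proof.
move=> fS SL La; split; first exact: left_translation_preserving.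
pose pw (ik : I * 'I_p) : prodgroup G := (a ik.1 ^+ ik.2)%g.
pose S1 := S `|` range pw.
have fS1 : finite_set S1.
  by rewrite finite_setU; split=> //; apply: finite_image; exact: finite_finset.
have powL ik : (L : set _) (pw ik).
  have [L1 LM _] := subgroupP L; rewrite /pw.
  by elim: (nat_of_ord ik.2) => [|k IH]; rewrite ?expg0// expgS; apply: LM.
have S1L : Defs.generated S1 = L.
  apply/seteqP; split.
    apply: generated_min; first exact: subgroupP.
    by move=> x [Sx|[ik _ <-//]]; rewrite -SL; exact: sub_generated.
  by rewrite -SL; apply: generated_min; [exact: generated_subgroup|move=> x Sx; apply: sub_generated; left].
pose SS := (fun s : subgroup_type L => \val s : prodgroup G) @^-1` S1.
have fSS : finite_set SS by exact: finite_val_preimage.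
exists SS; split => //; first exact: subgroup_preimage_generates.
pose C : R := #|I|%:R / (1 - #|I|%:R * eps) + 1.
have C0 : 0 < C by rewrite ltr_wpDl// divr_ge0// ltW// subr_gt0.
exists (2 * C)^-1; first by rewrite invr_gt0 mulr_gt0.
move=> f lf.
set act := left_translation (L:=L).
set B := sup _.
have inv0 : L2_invariant mu act (fun=> 0).
  by split; [exact: (@level_Lfun _ _ 0)|move=> g; exact: ae_eq_refl].
have invc c : L2_invariant mu act (cst c).
  by split; [exact: (@level_Lfun _ _ 0)|move=> g; exact: ae_eq_refl].
have ubB : has_ubound [set L2_quotient_norm mu act (translate act s f \- f) | s in SS].
  by apply: finite_has_ubound; exact: finite_image.
have lbq u : has_lbound [set L2_norm mu (u \- h) | h in L2_invariant mu act].
  by exists 0 => _ [h _ <-]; exact: L2_norm_ge0.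
have disp i k : (k < p)%N -> L2_norm mu (ltrans (a i ^+ k)%g f \- f) <= 2 * B.
  move=> kp; pose x := pw (i, Ordinal kp).
  have Lx : x \in (L : set _) by apply: mem_set; exact: powL.
  pose s : subgroup_type L := Sub x Lx.
  have sE : \val s = x by exact: SubK.
  have xp : (x ^+ p = 1)%g by rewrite /x /pw/= -expgnA mulnC expgnA ap expg1n.
  apply: (@le_trans _ _ (2 * L2_quotient_norm mu act (translate act s f \- f))); last first.
    rewrite ler_pM2l//; apply: ub_le_sup => //.
    by exists s => //; rewrite /SS /preimage /mkset sE; right; exists (i, Ordinal kp).
  rewrite translateE sE mulrC -ler_pdivrMr//; apply: lb_le_inf.
    by exists (L2_norm mu ((ltrans x f \- f) \- (fun=> 0))); exists (fun=> 0).
  move=> _ [h [lh hinv] <-]; rewrite ler_pdivrMr// mulrC.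
  apply: (torsion_displacement (prime_gt0 p_pr) xp) => // j.
  have := hinv (s ^+ j)%g; rewrite translateE.
  suff -> : \val (s ^+ j)%g = (x ^+ j)%g by [].
  by rewrite gmulfXn; congr (_ ^+ _)%g.
have B0 : 0 <= B.
  have [E0|/set0P[_ [s Ss _]]] := eqVneq [set L2_quotient_norm mu act (translate act s f \- f) | s in SS] set0.
    by rewrite /B E0 sup0.
  apply: (@le_trans _ _ (L2_quotient_norm mu act (translate act s f \- f))).
    apply: lb_le_inf; first by exists (L2_norm mu ((translate act s f \- f) \- (fun=> 0))); exists (fun=> 0).
    by move=> _ [h _ <-]; exact: L2_norm_ge0.
  by apply: ub_le_sup => //; exists s.
rewrite mulrC ler_pdivrMr ?mulr_gt0//.
apply/ler_addgt0Pr => e e0.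
(* The approximation error [dl] enters once directly, and with the factor [2 * C] through the displacements of the approximation. *)
pose dl := e / (1 + 2 * C).
have dl0 : 0 < dl by rewrite divr_gt0// addr_gt0// mulr_gt0.
have [_ /(_ _ dl0)[n [h [lh fh]]]] := approx_all lf.
have lh2 := level_Lfun (R := R) lh.
have [|i k kp|c hc] := @level_gap_norm n h (2 * B + 2 * dl) lh.
- by rewrite addr_ge0// mulr_ge0// ltW.
- rewrite (_ : _ \- _ = (ltrans (a i ^+ k)%g f \- f) \+ ((f \- h) \- ltrans (a i ^+ k)%g (f \- h))); last first.
    by apply/funext => x; rewrite /ltrans/=; ring.
  have l1 : f \- h \in Lfun mu 2%:E by exact: Lfun2B.
  have l2 := ltrans_Lfun (a i ^+ k)%g l1.
  have l3 := ltrans_Lfun (a i ^+ k)%g lf.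
  apply: le_trans (L2_normD _ _) _; [exact: Lfun2B|exact: Lfun2B|].
  apply: lerD; first exact: disp.
  apply: le_trans (L2_normB _ _) _ => //.
  rewrite L2_norm_ltrans// mulr_natl mulr2n; exact: lerD.
apply: (@le_trans _ _ (L2_norm mu (f \- cst c))).
  by apply: ge_inf => //; exists (cst c).
rewrite (_ : _ \- _ = (f \- h) \+ (h \- cst c)); last first.
  by apply/funext => x /=; ring.
have lc : cst c \in Lfun mu 2%:E by exact: (@level_Lfun _ _ 0).
apply: le_trans (L2_normD _ _) _; [exact: Lfun2B|exact: Lfun2B|].
apply: le_trans (lerD fh hc) _; rewrite -/C.
have -> : e = dl * (1 + 2 * C) by rewrite divfK// gt_eqF// addr_gt0// mulr_gt0.
lra.
Qed.

End HaarGap.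

(** * Elementary matrices over a non-commutative ring *)

Section UnitGroup.
Context (B : finNzRingType).
Local Open Scope ring_scope.

Definition is_unit_pair (x : B * B) := (x.1 * x.2 == 1) && (x.2 * x.1 == 1).

(** Units are pairs of mutually inverse elements: over a non-commutative ring
    this avoids any appeal to determinants and makes the group visibly finite. *)
Record unitgrp := Ugrp { upair :> B * B; upairP : is_unit_pair upair }.

HB.instance Definition _ := [isSub for upair].
HB.instance Definition _ := [Finite of unitgrp by <:].

Lemma unitgrp1_subproof : is_unit_pair (1, 1).
Proof. by rewrite /is_unit_pair/= mulr1 eqxx. Qed.
Lemma unitgrpV_subproof (x : unitgrp) : is_unit_pair (x.2, x.1).
Proof. by rewrite /is_unit_pair andbC; exact: (upairP x). Qed.
Lemma unitgrpM_subproof (x y : unitgrp) : is_unit_pair (x.1 * y.1, y.2 * x.2).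
Proof.
have /andP[/eqP x12 /eqP x21] := upairP x; have /andP[/eqP y12 /eqP y21] := upairP y.
rewrite /is_unit_pair/= -mulrA [y.1 * _]mulrA y12 mul1r x12 eqxx/=.
by rewrite -mulrA [x.2 * _]mulrA x21 mul1r y21.
Qed.

Lemma unitgrp_eq (x y : unitgrp) : x.1 = y.1 -> x = y.
Proof.
move=> xy; apply: val_inj; rewrite [val x]surjective_pairing [val y]surjective_pairing.
have /andP[_ /eqP x21] := upairP x; have /andP[/eqP y12 _] := upairP y.
congr (_, _) => //.
by rewrite /= -[LHS]mulr1 -y12 mulrA -xy x21 mul1r.
Qed.

Definition unitgrp1 := Ugrp unitgrp1_subproof.
Definition unitgrpV x := Ugrp (unitgrpV_subproof x).
Definition unitgrpM x y := Ugrp (unitgrpM_subproof x y).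

Lemma unitgrpA : associative unitgrpM.
Proof. by move=> x y z; apply: unitgrp_eq; rewrite /= mulrA. Qed.
Lemma unitgrp1g : left_id unitgrp1 unitgrpM.
Proof. by move=> x; apply: unitgrp_eq; rewrite /= mul1r. Qed.
Lemma unitgrpVg : left_inverse unitgrp1 unitgrpV unitgrpM.
Proof. by move=> x; apply: unitgrp_eq; have /andP[_ /eqP] := upairP x. Qed.

HB.instance Definition _ := Finite_isGroup.Build unitgrp unitgrpA unitgrp1g unitgrpVg.

Definition uval (x : unitgrp) : B := x.1.
Lemma uval_inj : injective uval. Proof. exact: unitgrp_eq. Qed.
Lemma uvalM x y : uval (x * y)%g = uval x * uval y. Proof. by []. Qed.
Lemma uvalV x : uval x^-1%g = x.2. Proof. by []. Qed.

End UnitGroup.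

Section Elementary.
Context (A : finNzRingType).
Local Open Scope ring_scope.
Implicit Types (i j k : 'I_3) (x y u v : A).

Definition ent_mx i j x : 'M[A]_3 := \matrix_(k, l) (if (k == i) && (l == j) then x else 0).

Lemma ent_mxM i j k l x y : ent_mx i j x * ent_mx k l y = if j == k then ent_mx i l (x * y) else 0.
Proof.
apply/matrixP => a b; rewrite mxE (bigD1 j)//= !mxE eqxx andbT big1 ?addr0.
  case: (eqVneq j k) => [_|_]; last by rewrite mulr0 mxE.
  by rewrite mxE; case: (a == i); case: (b == l); rewrite /= ?mulr0 ?mul0r.
by move=> c cj; rewrite !mxE (negbTE cj) andbF mul0r.
Qed.

Lemma ent_mxD i j x y : ent_mx i j (x + y) = ent_mx i j x + ent_mx i j y.
Proof. by apply/matrixP => a b; rewrite !mxE; case: ifP; rewrite ?addr0. Qed.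
Lemma ent_mxN i j x : ent_mx i j (- x) = - ent_mx i j x.
Proof. by apply/matrixP => a b; rewrite !mxE; case: ifP; rewrite ?oppr0. Qed.
Lemma ent_mx0 i j : ent_mx i j 0 = 0.
Proof. by apply/matrixP => a b; rewrite !mxE; case: ifP. Qed.
Lemma ent_mxDN i j x : ent_mx i j x + ent_mx i j (- x) = 0.
Proof. by rewrite ent_mxN subrr. Qed.

Lemma elem_subproof i j x : is_unit_pair (if i == j then (1, 1) else (1 + ent_mx i j x, 1 + ent_mx i j (- x)) : 'M[A]_3 * 'M[A]_3).
Proof.
case: eqVneq => [_|ij]; first exact: unitgrp1_subproof.
rewrite /is_unit_pair/= !mulrDl !mulrDr !mulr1 !mul1r !ent_mxM !(eq_sym j i) (negbTE ij) !addr0.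
by rewrite -!addrA [ent_mx i j (- x) + _]addrC ent_mxDN addr0 eqxx.
Qed.

Definition elem i j x : unitgrp 'M[A]_3 := Ugrp (elem_subproof i j x).

Lemma uval_elem i j x : i != j -> uval (elem i j x) = 1 + ent_mx i j x.
Proof. by move=> ij; rewrite /uval/= (negbTE ij). Qed.

Lemma uval_elemV i j x : i != j -> uval (elem i j x)^-1%g = 1 + ent_mx i j (- x).
Proof. by move=> ij; rewrite uvalV/= (negbTE ij). Qed.

Lemma elemD i j x y : i != j -> elem i j (x + y) = (elem i j x * elem i j y)%g.
Proof.
move=> ij; apply: uval_inj; rewrite uvalM !uval_elem// mulrDl mulrDr mulr1 !mul1r.
by rewrite mulrDr mulr1 ent_mxM eq_sym (negbTE ij) addr0 -addrA [ent_mx i j y + _]addrC ent_mxD.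
Qed.

Lemma elemN i j x : i != j -> elem i j (- x) = (elem i j x)^-1%g.
Proof. by move=> ij; apply: uval_inj; rewrite uval_elemV// uval_elem. Qed.

Lemma elem0 i j : elem i j 0 = 1%g.
Proof.
by apply: uval_inj; rewrite /uval/=; case: eqVneq => //= _; rewrite ent_mx0 addr0.
Qed.

Lemma elem_comm i j k x y : i != j -> j != k -> i != k ->
  (elem i j x * elem j k y = elem j k y * elem i j x * elem i k (x * y)%R)%g.
Proof.
move=> ij jk ik; apply: uval_inj; rewrite !uvalM !uval_elem//.
rewrite !(mulrDl, mulrDr, mulr1, mul1r, ent_mxM) eqxx (eq_sym k i) (eq_sym j i) (negbTE ij) (negbTE ik).
by rewrite !mul0r ?addr0 ?add0r -!addrA; congr (_ + _); rewrite addrCA.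
Qed.

Lemma elem_commute i j k l x y : i != j -> k != l -> j != k -> i != l ->
  commute (elem i j x) (elem k l y).
Proof.
move=> ij kl jk il; apply: uval_inj; rewrite !uvalM !uval_elem//.
rewrite !mulrDl !mulrDr !mulr1 !mul1r !ent_mxM (negbTE jk) (eq_sym l i) (negbTE il).
by rewrite !addr0 -!addrA [ent_mx i j x + _]addrC.
Qed.

Definition diag3 (d : 'I_3 -> A) : 'M[A]_3 := \matrix_(k, l) (if k == l then d k else 0).

Lemma diag3M d d' : diag3 d * diag3 d' = diag3 (fun k => d k * d' k).
Proof.
apply/matrixP => a b; rewrite !mxE (bigD1 a)//= !mxE eqxx big1 ?addr0.
  by case: eqVneq => // _; rewrite mulr0.
by move=> c ca; rewrite !mxE eq_sym (negbTE ca) mul0r.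
Qed.

Lemma diag31 : diag3 (fun=> 1) = 1.
Proof. by apply/matrixP => a b; rewrite !mxE; case: eqVneq. Qed.

Lemma diag_ent d i j x : diag3 d * ent_mx i j x = ent_mx i j (d i * x).
Proof.
apply/matrixP => a b; rewrite mxE (bigD1 a)//= !mxE eqxx big1 ?addr0.
  by case: eqVneq => [->|_]; case: (b == j); rewrite /= ?mulr0.
by move=> c ca; rewrite !mxE eq_sym (negbTE ca) mul0r.
Qed.

Lemma ent_diag d i j x : ent_mx i j x * diag3 d = ent_mx i j (x * d j).
Proof.
apply/matrixP => a b; rewrite mxE (bigD1 b)//= !mxE eqxx big1 ?addr0.
  by case: (a == i); case: (eqVneq b j) => [->|_]; rewrite /= ?mul0r.
by move=> c ca; rewrite !mxE (negbTE ca) mulr0.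
Qed.

(** When [u] and [v] are mutually inverse, this is the monomial matrix
    exchanging the coordinates [i] and [j], with entries [u] and [- v]. *)
Definition weyl i j u v := (elem i j u * elem j i (- v) * elem i j u)%g.

Lemma uval_weyl i j u v : i != j -> u * v = 1 -> v * u = 1 ->
  uval (weyl i j u v) = diag3 (fun k => ((k != i) && (k != j))%:R) + ent_mx i j u + ent_mx j i (- v).
Proof.
move=> ij uv vu; have ji : j != i by rewrite eq_sym.
have -> : diag3 (fun k => ((k != i) && (k != j))%:R) = 1 - ent_mx i i 1 - ent_mx j j 1.
  apply/matrixP => a b; rewrite !mxE; have [<-|ab] := eqVneq a b.
    rewrite !andbb; case: (eqVneq a i) => [->|ai]; first by rewrite (negbTE ij) /= subrr subr0.
    by case: (eqVneq a j) => [_|_]/=; rewrite !subr0 ?subrr.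
  have -> : (a == i) && (b == i) = false by apply/negP => /andP[/eqP ai /eqP bi]; rewrite ai bi eqxx in ab.
  have -> : (a == j) && (b == j) = false by apply/negP => /andP[/eqP ai /eqP bi]; rewrite ai bi eqxx in ab.
  by rewrite !subr0.
rewrite !uvalM !uval_elem//.
set P := ent_mx i i 1; set Q := ent_mx j j 1.
have XX : ent_mx i j u * ent_mx i j u = 0 by rewrite ent_mxM (negbTE ji).
have XY : ent_mx i j u * ent_mx j i (- v) = - P by rewrite ent_mxM eqxx mulrN uv ent_mxN.
have YX : ent_mx j i (- v) * ent_mx i j u = - Q by rewrite ent_mxM eqxx mulNr vu ent_mxN.
have PX : P * ent_mx i j u = ent_mx i j u by rewrite ent_mxM eqxx mul1r.
move: (ent_mx i j u) (ent_mx j i (- v)) XX XY YX PX => X Y XX XY YX PX.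
rewrite [(1 + X) * (1 + Y)]mulrDr mulr1 [(1 + X) * Y]mulrDl mul1r XY.
rewrite mulrDr mulr1 !mulrDl mul1r XX addr0 YX mulNr PX.
rewrite [X + (- Q - X)]addrC subrK.
by rewrite [LHS](AC (2*2*1) (1*4*5*2*3)).
Qed.

(** A product of two monomial matrices is diagonal, here with entries [h] and
    [c' h' c] at [i] and [j]. If conjugation by [c] turns the inverse [h'] of
    [h] into [h], both entries are equal to [h]. This is how diagonal matrices
    are obtained as products of elementary ones without commutativity. *)
Lemma weyl_diag i j h h' c c' : i != j -> h * h' = 1 -> h' * h = 1 -> c * c' = 1 -> c' * c = 1 ->
  c' * h' * c = h ->
  uval (weyl i j (- (h * c)) (- (c' * h')) * weyl i j c c')%g =
  diag3 (fun k => if (k == i) || (k == j) then h else 1).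
Proof.
move=> ij hh' h'h cc' c'c chc; have ji : j != i by rewrite eq_sym.
rewrite uvalM !uval_weyl//; last 2 first.
- by rewrite mulrNN mulrA -[h * c * c']mulrA cc' mulr1 hh'.
- by rewrite mulrNN mulrA -[c' * h' * h]mulrA h'h mulr1 c'c.
rewrite !(mulrDl, mulrDr) diag3M !diag_ent !ent_diag !ent_mxM !eqxx (negbTE ij) (negbTE ji) !andbF /=.
rewrite !mul0r !mulr0 !ent_mx0 !addr0 !add0r.
rewrite mulrNN -mulrA cc' mulr1 opprK chc.
apply/matrixP => a b; rewrite !mxE.
have [<-|ab] := eqVneq a b; last first.
  rewrite (_ : (a == i) && (b == i) = false); last by apply/negP => /andP[/eqP ai /eqP bi]; rewrite ai bi eqxx in ab.
  rewrite (_ : (a == j) && (b == j) = false) ?addr0//.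
  by apply/negP => /andP[/eqP ai /eqP bi]; rewrite ai bi eqxx in ab.
rewrite !andbb; case: (eqVneq a i) => [->|ai]/=; first by rewrite (negbTE ij) mul0r add0r addr0.
by case: eqVneq => _ /=; rewrite ?mul0r ?add0r ?mulr1 ?addr0.
Qed.

End Elementary.

(** * Products of elementary groups *)

Definition i0 : 'I_3 := @Ordinal 3 0 isT.
Definition i1 : 'I_3 := @Ordinal 3 1 isT.
Definition i2 : 'I_3 := @Ordinal 3 2 isT.

Section ElementaryProduct.
Local Open Scope ring_scope.
Context (A : nat -> finNzRingType).

Definition elem_set n : {set unitgrp 'M[A n]_3} :=
  [set u | [exists i, exists j, exists x, (i != j) && (u == elem i j x)]].
Definition E3 n : {group unitgrp 'M[A n]_3} := <<elem_set n>>%G.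
Definition E3type n : finGroupType := subg_of (E3 n).
(** The product of the groups generated by elementary matrices; sequences of
    ring elements parametrize its elements [elem_seq i j x]. *)
Definition Kgrp := prodgroup E3type.
HB.instance Definition _ := TopologicalGroup.on Kgrp.

Definition kval (g : Kgrp) n : unitgrp 'M[A n]_3 := sgval (g n : subg_of (E3 n)).

Lemma kval_inj (g h : Kgrp) : (forall n, kval g n = kval h n) -> g = h.
Proof.
by move=> gh; apply: functional_extensionality_dep => n; apply: val_inj; exact: gh.
Qed.

Lemma kvalM (g h : Kgrp) n : kval (g * h)%g n = (kval g n * kval h n)%g.
Proof. by []. Qed.
Lemma kval1 n : kval 1%g n = 1%g.
Proof. by []. Qed.
Lemma kvalV (g : Kgrp) n : kval g^-1%g n = (kval g n)^-1%g.
Proof. by []. Qed.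

Definition kmk (u : forall n, unitgrp 'M[A n]_3) : Kgrp := fun n => subg (E3 n) (u n).

Lemma kvalK (u : forall n, unitgrp 'M[A n]_3) n : u n \in E3 n -> kval (kmk u) n = u n.
Proof. exact: subgK. Qed.

Lemma elem_E3 n i j (x : A n) : elem i j x \in E3 n.
Proof.
have [<-|ij] := eqVneq i j.
  rewrite (_ : elem i i x = 1%g) ?group1//.
  by apply: uval_inj; rewrite /uval/= eqxx.
apply: mem_gen; rewrite inE; apply/existsP; exists i; apply/existsP; exists j.
by apply/existsP; exists x; rewrite ij eqxx.
Qed.

Notation seqA := (forall n, A n).
Implicit Types (x y : seqA).

Definition elem_seq (i j : 'I_3) x : Kgrp := kmk (fun n => elem i j (x n)).

Lemma kval_elem_seq i j x n : kval (elem_seq i j x) n = elem i j (x n).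
Proof. by rewrite kvalK// elem_E3. Qed.

Definition sadd x y : seqA := fun n => x n + y n.
Definition sopp x : seqA := fun n => - x n.
Definition smul x y : seqA := fun n => x n * y n.
Definition szero : seqA := fun n => 0.
Definition sone : seqA := fun n => 1.

Lemma elem_seqD i j x y : i != j -> elem_seq i j (sadd x y) = (elem_seq i j x * elem_seq i j y)%g.
Proof. by move=> ij; apply: kval_inj => n; rewrite kvalM !kval_elem_seq elemD. Qed.

Lemma elem_seqN i j x : i != j -> elem_seq i j (sopp x) = (elem_seq i j x)^-1%g.
Proof. by move=> ij; apply: kval_inj => n; rewrite kvalV !kval_elem_seq elemN. Qed.

Lemma elem_seq0 i j : elem_seq i j szero = 1%g.
Proof. by apply: kval_inj => n; rewrite kval1 kval_elem_seq elem0. Qed.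

Lemma elem_seq_comm i j k x y : i != j -> j != k -> i != k ->
  (elem_seq i j x * elem_seq j k y = elem_seq j k y * elem_seq i j x * elem_seq i k (smul x y))%g.
Proof. by move=> ij jk ik; apply: kval_inj => n; rewrite !kvalM !kval_elem_seq elem_comm. Qed.

Lemma elem_seq_commute i j k l x y : i != j -> k != l -> j != k -> i != l ->
  commute (elem_seq i j x) (elem_seq k l y).
Proof.
move=> ij kl jk il; apply: kval_inj => n; rewrite !kvalM !kval_elem_seq.
exact: elem_commute.
Qed.

Lemma elem_seqX i j x n : i != j -> (elem_seq i j x ^+ n = elem_seq i j (fun m => x m *+ n))%g.
Proof.
move=> ij; elim: n => [|n IH].
  by rewrite expg0 -(elem_seq0 i j); congr elem_seq; apply: functional_extensionality_dep => m; rewrite mulr0n.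
rewrite expgS IH -elem_seqD//; congr elem_seq; apply: functional_extensionality_dep => m.
by rewrite mulrS.
Qed.

Section Ring.
Context (L : set Kgrp) (gL : is_subgroup L).

(** The sequences for which [L] contains every elementary matrix. When [L] is
    a subgroup they are closed under ring operations: addition comes from
    multiplying elementary matrices, and multiplication from their
    commutators. *)
Definition offdiag x := forall i j, i != j -> L (elem_seq i j x).

Let L1 : L 1%g. Proof. by case: gL. Qed.
Let LM g h : L g -> L h -> L (g * h)%g. Proof. by case: gL => _ + _; apply. Qed.
Let LV g : L g -> L g^-1%g. Proof. by case: gL => _ _; apply. Qed.

Lemma offdiagD x y : offdiag x -> offdiag y -> offdiag (sadd x y).
Proof. by move=> ox oy i j ij; rewrite elem_seqD//; apply: LM; [exact: ox|exact: oy]. Qed.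

Lemma offdiagN x : offdiag x -> offdiag (sopp x).
Proof. by move=> ox i j ij; rewrite elem_seqN//; apply: LV; exact: ox. Qed.

Lemma commut_mem i j k x y : i != j -> j != k -> i != k ->
  L (elem_seq i j x) -> L (elem_seq j k y) -> L (elem_seq i k (smul x y)).
Proof.
move=> ij jk ik Lx Ly.
have -> : elem_seq i k (smul x y) = ((elem_seq j k y * elem_seq i j x)^-1 * (elem_seq i j x * elem_seq j k y))%g.
  by rewrite elem_seq_comm// mulKg.
by apply: LM; [apply: LV|]; exact: LM.
Qed.

Lemma ord3_third (i j : 'I_3) : i != j -> exists k : 'I_3, i != k /\ k != j.
Proof.
by case: i => [[|[|[|//]]] ?]; case: j => [[|[|[|//]]] ?] //= _;
   first [by exists ord0 | by exists (inord 1); rewrite -!val_eqE/= inordK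
         | by exists (inord 2); rewrite -!val_eqE/= inordK].
Qed.

(** A third index is available between two distinct ones, so that the
    commutator relation applies. *)
Lemma offdiagM x y : offdiag x -> offdiag y -> offdiag (smul x y).
Proof.
move=> ox oy i j ij; have [k [ik kj]] := ord3_third ij.
by apply: (@commut_mem i k j) => //; [exact: ox|exact: oy].
Qed.

(** Commutators with the elementary matrices with entry 1, along the cycle 0,
    1, 2, carry an entry from one position to every other one. *)
Lemma offdiag_of01 x :
  L (elem_seq i0 i1 sone) -> L (elem_seq i1 i2 sone) -> L (elem_seq i2 i0 sone) ->
  L (elem_seq i0 i1 x) -> offdiag x.
Proof.
move=> L01 L12 L20 X01.
have sm1 z : smul z sone = z by apply: functional_extensionality_dep => n; rewrite /smul mulr1.
have s1m z : smul sone z = z by apply: functional_extensionality_dep => n; rewrite /smul mul1r.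
have L10 : L (elem_seq i1 i0 sone) by rewrite -[sone]sm1; apply: (@commut_mem i1 i2 i0).
have X02 : L (elem_seq i0 i2 x) by rewrite -[x]sm1; apply: (@commut_mem i0 i1 i2).
have X21 : L (elem_seq i2 i1 x) by rewrite -[x]s1m; apply: (@commut_mem i2 i0 i1).
have X12 : L (elem_seq i1 i2 x) by rewrite -[x]s1m; apply: (@commut_mem i1 i0 i2).
have X20 : L (elem_seq i2 i0 x) by rewrite -[x]sm1; apply: (@commut_mem i2 i1 i0).
have X10 : L (elem_seq i1 i0 x) by rewrite -[x]sm1; apply: (@commut_mem i1 i2 i0).
move=> i j; case: i => [[|[|[|//]]] hi]; case: j => [[|[|[|//]]] hj] //= _.
- have -> : Ordinal hi = i0 by apply: val_inj.
  by have -> : Ordinal hj = i1 by apply: val_inj.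
- have -> : Ordinal hi = i0 by apply: val_inj.
  by have -> : Ordinal hj = i2 by apply: val_inj.
- have -> : Ordinal hi = i1 by apply: val_inj.
  by have -> : Ordinal hj = i0 by apply: val_inj.
- have -> : Ordinal hi = i1 by apply: val_inj.
  by have -> : Ordinal hj = i2 by apply: val_inj.
- have -> : Ordinal hi = i2 by apply: val_inj.
  by have -> : Ordinal hj = i0 by apply: val_inj.
- have -> : Ordinal hi = i2 by apply: val_inj.
  by have -> : Ordinal hj = i1 by apply: val_inj.
Qed.

Definition single n (a : A n) : seqA := dfwith szero n a.

Lemma singleE n (a : A n) : single a n = a. Proof. exact: dfwithin. Qed.
Lemma singleO n (a : A n) k : k != n -> single a k = 0.
Proof. by rewrite eq_sym; exact: dfwithout. Qed.

Definition gsingle n (u : unitgrp 'M[A n]_3) : Kgrp := upd 1%g (subg (E3 n) u : E3type n).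

Lemma kval_gsingle n (u : unitgrp 'M[A n]_3) : u \in E3 n -> kval (gsingle u) n = u.
Proof. by move=> uE; rewrite /kval /gsingle updE subgK. Qed.

Lemma kval_gsingleO n (u : unitgrp 'M[A n]_3) k : k != n -> kval (gsingle u) k = 1%g.
Proof. by move=> kn; rewrite /kval /gsingle updO. Qed.

Lemma gsingleM n (u v : unitgrp 'M[A n]_3) : u \in E3 n -> v \in E3 n ->
  gsingle (u * v)%g = (gsingle u * gsingle v)%g.
Proof.
move=> uE vE; apply: kval_inj => k; rewrite kvalM; have [->|kn] := eqVneq k n.
  by rewrite !kval_gsingle ?groupM.
by rewrite !kval_gsingleO// mulg1.
Qed.

Lemma gsingle_elem n i j (a : A n) : gsingle (elem i j a) = elem_seq i j (single a).
Proof.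
apply: kval_inj => k; rewrite kval_elem_seq; have [->|kn] := eqVneq k n.
  by rewrite kval_gsingle ?elem_E3// singleE.
by rewrite kval_gsingleO// singleO// elem0.
Qed.

Lemma gsingle_mem : (forall n (a : A n), offdiag (single a)) ->
  forall n (u : unitgrp 'M[A n]_3), u \in E3 n -> L (gsingle u).
Proof.
move=> oL n.
pose P : {set unitgrp 'M[A n]_3} := [set u in E3 n | `[< L (gsingle u) >]].
have gP : group_set P.
  apply/group_setP; split.
    rewrite inE group1; apply/asboolP; rewrite (_ : gsingle 1%g = 1%g)//.
    apply: kval_inj => k; have [->|kn] := eqVneq k n; first by rewrite kval_gsingle.
    by rewrite kval_gsingleO.
  move=> u v; rewrite !inE => /andP[uE /asboolP Lu] /andP[vE /asboolP Lv].
  by rewrite groupM//=; apply/asboolP; rewrite gsingleM//; exact: LM.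
have sub : E3 n \subset group gP.
  rewrite gen_subG; apply/fintype.subsetP => u; rewrite inE.
  case/existsP => i /existsP[j /existsP[x /andP[ij /eqP ->]]].
  rewrite inE elem_E3/=; apply/asboolP; rewrite gsingle_elem; exact: oL.
move=> u /(fintype.subsetP sub); rewrite inE => /andP[_ /asboolP]; exact.
Qed.

(** Elements are corrected one coordinate at a time: the group [E3 n]
    supported in the coordinate [n] lies in [L]. *)
Lemma finite_coords_dense : (forall n (a : A n), offdiag (single a)) ->
  forall n (g : Kgrp), exists2 y, L y & forall i, (i < n)%N -> y i = g i.
Proof.
move=> oL n g; elim: n => [|n [y Ly yg]]; first by exists 1%g.
pose u := ((kval y n)^-1 * kval g n)%g.
have uE : u \in E3 n by rewrite groupM ?groupV// subgP.
exists (y * gsingle u)%g; first by apply: LM => //; exact: gsingle_mem.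
move=> i; rewrite ltnS leq_eqVlt => /orP[/eqP ->|ni]; apply: val_inj.
  by rewrite [LHS](_ : _ = kval (y * gsingle u)%g n)// kvalM kval_gsingle// mulKVg.
rewrite [LHS](_ : _ = kval (y * gsingle u)%g i)// kvalM kval_gsingleO ?ltn_eqF//.
by rewrite mulg1 /kval yg.
Qed.

Lemma finite_coords_closure : (forall n (g : Kgrp), exists2 y, L y & forall i, (i < n)%N -> y i = g i) ->
  dense L.
Proof.
move=> LK U [x Ux] oU; have [n nU] := (nbhs_cyl x U).1 (open_nbhs_nbhs (conj oU Ux)).
by have [y Ly yx] := LK n x; exists y; split=> //; exact: nU.
Qed.

End Ring.

End ElementaryProduct.

(** * Cyclic shifts and isolation of a coordinate *)

Section WeylMem.
Local Open Scope ring_scope.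
Context (A : nat -> finNzRingType) (n : nat).

Lemma weyl_E3 i j (u v : A n) : weyl i j u v \in E3 A n.
Proof. by rewrite !groupM// elem_E3. Qed.

(** The three matrices with [s] at two of the three diagonal places multiply
    to the diagonal matrix with all entries [s * s]. *)
Lemma diag3_square_E3 (s s' c c' : A n) : s * s' = 1 -> s' * s = 1 -> c * c' = 1 -> c' * c = 1 ->
  c' * s' * c = s -> exists2 u, u \in E3 A n & uval u = diag3 (fun=> s * s).
Proof.
move=> ss' s's cc' c'c csc.
have H i j : i != j -> exists2 u, u \in E3 A n & uval u = diag3 (fun k => if (k == i) || (k == j) then s else 1).
  move=> ij; exists (weyl i j (- (s * c)) (- (c' * s')) * weyl i j c c')%g.
    by rewrite groupM// weyl_E3.
  exact: weyl_diag.
have [u01 E01 u01E] := H i0 i1 isT; have [u12 E12 u12E] := H i1 i2 isT.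
have [u02 E02 u02E] := H i0 i2 isT.
exists (u01 * u12 * u02)%g; first by rewrite !groupM.
rewrite !uvalM u01E u12E u02E !diag3M; congr diag3; apply/funext => k.
by case: k => [[|[|[|//]]] hk] /=; rewrite ?mulr1 ?mul1r.
Qed.

End WeylMem.

Section Cyclic.
Local Open Scope ring_scope.
Context (N : nat).
Local Notation I := ('I_N.+1).

Lemma inZpS k : inZp k.+1 = inZp 1 + inZp k :> I.
Proof. by apply: val_inj; rewrite /= modnDm add1n. Qed.

Definition cyc : {perm I} := perm (@addrI _ (inZp 1 : I)).
Definition refl : {perm I} := perm (@oppr_inj I).

Lemma cycE k : cyc (inZp k) = inZp k.+1.
Proof. by rewrite permE -inZpS. Qed.

Lemma cycX k i : (cyc ^+ k)%g (inZp i) = inZp (i + k).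
Proof.
elim: k i => [|k IH] i; first by rewrite expg0 perm1 addn0.
by rewrite expgS permM cycE IH addSnnS.
Qed.

Lemma cyc_order : (cyc ^+ N.+1 = 1)%g.
Proof.
apply/permP => i; rewrite perm1 -[i]valZpK cycX; apply: val_inj => /=.
by rewrite modnDr.
Qed.

Lemma reflK : (refl * refl = 1)%g.
Proof. by apply/permP => i; rewrite permM perm1 !permE opprK. Qed.

Lemma refl_cyc : (refl * cyc * refl = cyc^-1)%g.
Proof.
apply: (mulgI cyc); rewrite mulgV; apply/permP => i.
rewrite !permM perm1 !permE /=; have -> : inZp 1 - (inZp 1 + i) = - i by rewrite opprD addrA subrr add0r.
exact: opprK.
Qed.

End Cyclic.

Section Periodic.
Local Open Scope ring_scope.
Context (F : finNzRingType) (m : nat -> nat).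

Definition mat_ring (n : nat) : finNzRingType := 'M[F]_((m n).+1).
Notation seqA := (forall n, mat_ring n).

(** The indices are reduced modulo the size of the matrices, so that every
    pair of natural numbers gives a matrix unit in each coordinate. *)
Definition unit_seq k l : seqA := fun n => delta_mx (inZp k) (inZp l).
(** The inverse permutation appears because permutation matrices act on row
    vectors; with it, multiplication on the left raises the row index of
    matrix units. *)
Definition cshift : seqA := fun n => perm_mx (cyc (m n))^-1.
Definition cshiftV : seqA := fun n => perm_mx (cyc (m n)).

Lemma seqP (x y : seqA) : (forall n, x n = y n) -> x = y.
Proof. exact: functional_extensionality_dep. Qed.

Lemma cshiftK : smul cshift cshiftV = sone mat_ring.
Proof. by apply: seqP => n; rewrite /smul /cshift /cshiftV -[LHS]perm_mxM mulVg perm_mx1. Qed.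

Lemma cshiftVK : smul cshiftV cshift = sone mat_ring.
Proof. by apply: seqP => n; rewrite /smul /cshift /cshiftV -[LHS]perm_mxM mulgV perm_mx1. Qed.

Lemma cshift_unit_seq k l : smul cshift (unit_seq k l) = unit_seq k.+1 l.
Proof.
apply: seqP => n; apply/matrixP => i j; rewrite /smul /cshift /unit_seq.
rewrite -[_ * _]/(_ *m _) -row_permE !mxE.
by rewrite -(inj_eq (@perm_inj _ (cyc (m n)))) permKV cycE.
Qed.

Lemma unit_seq_cshiftV k l : smul (unit_seq k l) cshiftV = unit_seq k l.+1.
Proof.
apply: seqP => n; apply/matrixP => i j; rewrite /smul /cshiftV /unit_seq.
rewrite -[_ * _]/(_ *m _) -{1}[cyc _]invgK -col_permE !mxE.
by rewrite -(inj_eq (@perm_inj _ (cyc (m n))) ((cyc (m n))^-1%g j)) permKV cycE.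
Qed.

Lemma unit_seqM k l l' k' n : smul (unit_seq k l) (unit_seq l' k') n =
  if l == l' %[mod (m n).+1] then unit_seq k k' n else 0.
Proof.
rewrite /smul /unit_seq -[_ * _]/(_ *m _) mul_delta_mx_cond -val_eqE/=.
by case: eqP => _; rewrite ?mulr1n ?mulr0n.
Qed.

Lemma unit_seqMM k l k' : smul (unit_seq k l) (unit_seq l k') = unit_seq k k'.
Proof. by apply: seqP => n; rewrite unit_seqM eqxx. Qed.

Section Full.
Hypotheses (F_nat : forall a : F, exists k, a = k%:R)
  (m_mono : forall k n, (k < n)%N -> (m k < m n)%N).
Context (J : set seqA).
Hypotheses (JD : forall x y, J x -> J y -> J (sadd x y)) (JN : forall x, J x -> J (sopp x))
  (JM : forall x y, J x -> J y -> J (smul x y)) (JE : forall k l, J (unit_seq k l)).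

Let J0 : J (szero mat_ring).
Proof.
rewrite (_ : szero mat_ring = sadd (unit_seq 0 0) (sopp (unit_seq 0 0))); first exact: JD (JN _).
by apply: seqP => n; rewrite /sadd /sopp subrr.
Qed.

(** The product of the matrix units at [0, m n + 1] and [0, 0] is the matrix
    unit at [0, 0] in the coordinates [k] where [m k + 1] divides [m n + 1],
    and zero in the others. This excludes every [k > n], as the sizes
    increase; the finitely many coordinates below [n] are removed by
    induction. *)
Lemma single_E00 n : J (single (unit_seq 0 0 n)).
Proof.
elim/ltn_ind: n => n IH.
pose z := smul (unit_seq 0 (m n).+1) (unit_seq 0 0).
have zE k : z k = if ((m k).+1 %| (m n).+1)%N then unit_seq 0 0 k else 0.
  by rewrite /z unit_seqM mod0n.
pose zz j : seqA := fun k => if (k < j)%N then 0 else z k.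
have Jzz j : (j <= n)%N -> J (zz j).
  elim: j => [|j IHj] jn.
    rewrite (_ : zz 0 = z); first exact: JM.
    by apply: seqP.
  rewrite (_ : zz j.+1 = sadd (zz j) (sopp (single (z j)))).
    apply: JD; first by apply: IHj; exact: ltnW.
    apply: JN; rewrite zE; case: ifP => _; first exact: IH.
    rewrite (_ : single _ = szero mat_ring)//; apply: seqP => k.
    by have [->|kj] := eqVneq k j; [rewrite singleE|rewrite singleO].
  apply: seqP => k; rewrite /zz /sadd /sopp ltnS; have [->|kj] := eqVneq k j.
    by rewrite leqnn ltnn singleE subrr.
  by rewrite singleO// subr0 leq_eqVlt (negbTE kj).
rewrite (_ : single _ = zz n); first exact: Jzz.
apply: seqP => k; have [->|kn] := eqVneq k n.
  by rewrite singleE /zz ltnn zE dvdnn.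
rewrite singleO// /zz; case: ltnP => // nk.
have {}nk : (n < k)%N by rewrite ltn_neqAle eq_sym kn.
by rewrite zE gtnNdvd// ltnS m_mono.
Qed.

(** The matrix units span the matrix ring additively, up to natural number
    multiples. *)
Lemma single_full n (a : mat_ring n) : J (single a).
Proof.
pose P (b : mat_ring n) := J (single b).
have P0 : P 0.
  rewrite /P (_ : single _ = szero mat_ring)//; apply: seqP => k.
  by have [->|kj] := eqVneq k n; [rewrite singleE|rewrite singleO].
have PD b c : P b -> P c -> P (b + c).
  move=> Pb Pc; rewrite /P (_ : single _ = sadd (single b) (single c)); first exact: JD.
  apply: seqP => k; rewrite /sadd; have [->|kj] := eqVneq k n; first by rewrite !singleE.
  by rewrite !singleO// addr0.
have Pn b k : P b -> P (b *+ k).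
  by move=> Pb; elim: k => [|k IH]; rewrite ?mulr0n// mulrS; exact: PD.
have Pdelta i j : P (delta_mx i j).
  rewrite /P (_ : single _ = smul (unit_seq i 0) (smul (single (unit_seq 0 0 n)) (unit_seq 0 j))).
    by apply: JM => //; apply: JM => //; exact: single_E00.
  apply: seqP => k; have [->|kj] := eqVneq k n; last by rewrite /smul !singleO// mul0r mulr0.
  rewrite /smul !singleE.
  rewrite -[_ * unit_seq 0 j n]/(smul (unit_seq 0 0) (unit_seq 0 j) n) unit_seqMM.
  by rewrite -[_ * _]/(smul (unit_seq i 0) (unit_seq 0 j) n) unit_seqMM /unit_seq !valZpK.
rewrite (matrix_sum_delta a).
rewrite -/(P _); apply: (big_ind P) => // i _; apply: (big_ind P) => // j _.
have [k ->] := F_nat (a i j); rewrite scaler_nat; exact: Pn.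
Qed.

End Full.

End Periodic.

(** * Locally finite lifts of the integers from an ascending chain *)

Lemma countable_inj_in (T U : Type) (f : T -> U) (A : set U) :
  injective f -> (forall x, A (f x)) -> countable A -> countable [set: T].
Proof.
move=> fi fA /countable_injP[h hi]; apply/countable_injP; exists (h \o f) => x y _ _ /= hxy.
by apply: fi; apply: hi => //; apply: mem_set; exact: fA.
Qed.

Section AscendingLift.
Context (K : groupType) (tau : K) (W : nat -> set K) (S : set K).
Local Open Scope group_scope.
Hypotheses (W_sub : forall v, is_subgroup (W v)) (W_fin : forall v, finite_set (W v))
  (W_incl : forall v, W v `<=` W v.+1)
  (W_conj : forall v g, W v g -> W v.+1 (tau * g * tau^-1))
  (W_tau : forall v d, (0 < d)%N -> ~ W v (tau ^+ d))
  (S_W : forall g, S g -> exists v, W v g).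
Context (L : subgroup K).
Hypothesis L_gen : Defs.generated (tau |` S) = L.

Let W1 v : W v 1. Proof. by case: (W_sub v). Qed.
Let WM v g h : W v g -> W v h -> W v (g * h). Proof. by case: (W_sub v) => _ + _; apply. Qed.
Let WV v g : W v g -> W v g^-1. Proof. by case: (W_sub v) => _ _; apply. Qed.

Lemma W_le v w : (v <= w)%N -> W v `<=` W w.
Proof.
move=> /subnK <-; elim: (w - v)%N => // k IH.
by rewrite addSn; apply: (subset_trans IH); exact: W_incl.
Qed.

(** Conjugation by [tau] does not preserve the groups [W v] but only shifts
    their index, so that an element of exponent [b - a] can be brought into
    some [W v] only after multiplying it by powers of [tau] on both sides. *)
Definition shifted a b v g := W v (tau ^+ a * g * (tau ^+ b)^-1).

Lemma shifted_bump c a b v g : shifted a b v g -> shifted (c + a) (c + b) (c + v) g.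
Proof.
rewrite /shifted; elim: c => // c IH /IH /W_conj; rewrite !addSn !expgS.
by rewrite [(tau * tau ^+ (c + b))^-1]invgM !mulgA.
Qed.

Lemma shifted_le a b v w g : (v <= w)%N -> shifted a b v g -> shifted a b w g.
Proof. by move=> vw; exact: (W_le vw). Qed.

Definition hasexp g (k : int) := exists a b v, shifted a b v g /\ k = (b%:Z - a%:Z)%R.

(** Two expressions of [g] are compared after bumping the exponents on the
    left to a common value; their quotient is a power of [tau] lying in some
    [W v], hence trivial. *)
Lemma hasexp_unique g k l : hasexp g k -> hasexp g l -> k = l.
Proof.
have key a b c d v w : (a <= c)%N -> shifted a b v g -> shifted c d w g -> (c + b = d + a)%N.
  move=> ac /(shifted_bump (c - a)) + Hw; rewrite subnK// => Hv.
  set b' := (c - a + b)%N in Hv; set v' := (c - a + v)%N in Hv.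
  have Hv' := W_le (leq_addr w v') Hv; have Hw' := W_le (leq_addl v' w) Hw.
  have H : W (v' + w) (tau ^+ b' * (tau ^+ d)^-1).
    have := WM (WV Hv') Hw'; rewrite !invgM invgK !mulgA.
    by rewrite mulgKV -[_ * g^-1 * g]mulgA mulVg mulg1.
  have [bd|bd|bd] := ltngtP b' d.
  - exfalso; apply: (@W_tau (v' + w) (d - b')); first by rewrite subn_gt0.
    have := WV H; rewrite invgM invgK => /=; rewrite -{1}(subnK (ltnW bd)) expgnDr mulgK; exact.
  - exfalso; apply: (@W_tau (v' + w) (b' - d)); first by rewrite subn_gt0.
    by move: H; rewrite -{1}(subnK (ltnW bd)) expgnDr mulgK.
  - by rewrite /b' in bd; lia.
move=> [a [b [v [H1 ->]]]] [c [d [w [H2 ->]]]].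
have [ac|/ltnW ca] := leqP a c.
  by have := key _ _ _ _ _ _ ac H1 H2; lia.
by have := key _ _ _ _ _ _ ca H2 H1; lia.
Qed.

Lemma hasexpM g h k l : hasexp g k -> hasexp h l -> hasexp (g * h) (k + l)%R.
Proof.
move=> [a [b [v [H1 ->]]]] [c [d [w [H2 ->]]]].
exists (c + a)%N, (b + d)%N, (c + v + (b + w))%N; split; last by lia.
have {}H1 := shifted_le (leq_addr (b + w) _) (shifted_bump c H1).
have {}H2 := shifted_le (leq_addl (c + v) _) (shifted_bump b H2).
have := WM H1 H2; rewrite /shifted !mulgA [(b + c)%N]addnC mulgKV; exact.
Qed.

Lemma hasexpV g k : hasexp g k -> hasexp g^-1 (- k)%R.
Proof.
move=> [a [b [v [H1 ->]]]]; exists b, a, v; split; last by lia.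
by have := WV H1; rewrite !invgM invgK mulgA.
Qed.

Lemma hasexp1 : hasexp 1 0%R.
Proof. by exists 0%N, 0%N, 0%N; split => //; rewrite /shifted mulg1 mulgV. Qed.

Lemma hasexp_tau : hasexp tau 1%R.
Proof. by exists 0%N, 1%N, 0%N; split => //; rewrite /shifted expg0 mul1g expg1 mulgV. Qed.

Lemma hasexp_L g : (L : set K) g -> exists k, hasexp g k.
Proof.
rewrite -L_gen; apply: (@generated_min _ _ [set g | exists k, hasexp g k]).
  split; first by exists 0%R; exact: hasexp1.
    by move=> x y [k xk] [l yl]; exists (k + l)%R; exact: hasexpM.
  by move=> x [k xk]; exists (- k)%R; exact: hasexpV.
move=> h [->|/S_W[v Wh]]; first by exists 1%R; exact: hasexp_tau.
by exists 0%R, 0%N, 0%N, v; split => //; rewrite /shifted expg0 mul1g invg1 mulg1.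
Qed.

(** For fixed exponents, multiplication by the powers of [tau] maps the
    shifted elements injectively into a finite group. *)
Lemma countable_L : countable (L : set K).
Proof.
pose U (x : nat * nat * nat) := [set g | shifted x.1.1 x.1.2 x.2 g].
apply: (@sub_countable _ _ _ (\bigcup_(x in [set: nat * nat * nat]) U x)).
  by apply: subset_card_le => g /hasexp_L[k [a [b [v [H _]]]]]; exists ((a, b), v).
apply: bigcup_countable => // x _; apply: finite_set_countable.
pose f g := tau ^+ x.1.1 * g * (tau ^+ x.1.2)^-1.
apply: (@finite_preimage _ _ (W x.2) f) => //.
by move=> g h _ _ /mulIg /mulgI.
Qed.

Let LT := subgroup_type L.
Let valLT (s : LT) : (L : set K) (\val s). Proof. exact: set_mem (valP s). Qed.

Definition lift_exp (s : LT) : Zgroup := sval (cid (hasexp_L (valLT s))).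

Lemma lift_expP s : hasexp (\val s) (lift_exp s).
Proof. by rewrite /lift_exp; case: cid. Qed.

Lemma lift_expE s k : hasexp (\val s) k -> lift_exp s = k.
Proof. exact: (hasexp_unique (lift_expP s)). Qed.

Lemma lift_expM : {morph lift_exp : s u / s * u >-> s * u}.
Proof.
move=> s u; apply: lift_expE; rewrite gmulfM; apply: hasexpM; exact: lift_expP.
Qed.

Lemma lift_exp1 : lift_exp 1 = 1.
Proof. by apply: lift_expE; rewrite gmulf1; exact: hasexp1. Qed.

HB.instance Definition _ := isMultiplicative.Build LT Zgroup lift_exp lift_expM.
HB.instance Definition _ := Multiplicative_isUMagmaMorphism.Build LT Zgroup lift_exp lift_exp1.

Definition lift_ker_set : set LT := [set s | lift_exp s = 1].
Lemma lift_ker_subgroup : is_subgroup lift_ker_set.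
Proof.
split; rewrite /lift_ker_set/=; first exact: lift_exp1.
  by move=> x y xk yk; rewrite lift_expM xk yk mulg1.
by move=> x xk; transitivity (lift_exp x)^-1; [exact: gmulfV|rewrite xk invg1].
Qed.
Definition lift_ker := Subgroup lift_ker_subgroup.

Lemma lift_ker_shifted (x : subgroup_type lift_ker) :
  exists a v, shifted a a v (\val (\val x)).
Proof.
have k0 : lift_exp (\val x) = (0%R : int) by exact: (set_mem (valP x)).
have [a [b [v [H]]]] := lift_expP (\val x).
rewrite k0 => ab; exists a, v.
by have {2}-> : a = b by lia.
Qed.

(** Bumping exponents allows finitely many elements of exponent zero to be
    conjugated into the same [W v] by the same power of [tau]. *)
Lemma lift_ker_common (S' : set (subgroup_type lift_ker)) : finite_set S' ->
  exists a v, forall x, S' x -> shifted a a v (\val (\val x)).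
Proof.
move=> /finite_seqP[s ->]; elim: s => [|x s [a [v IH]]]; first by exists 0%N, 0%N.
have [b [w xb]] := lift_ker_shifted x.
exists (a + b)%N, ((a + w) + (b + v))%N => y /=; rewrite inE => /orP[/eqP ->|ys].
  exact: shifted_le (leq_addr _ _) (shifted_bump a xb).
by rewrite [(a + b)%N]addnC; apply: shifted_le (leq_addl _ _) (shifted_bump b (IH y ys)).
Qed.

(** A finite subset generates a subgroup conjugate to a subgroup of the finite
    group [W v]. *)
Lemma lift_ker_locally_finite : locally_finite (subgroup_type lift_ker).
Proof.
split.
  apply: (@countable_inj_in _ _ (fun x => \val (\val x)) (L : set K)); last exact: countable_L.
    by move=> x y /val_inj /val_inj.
  by move=> x; exact: valLT.
move=> S' _ /lift_ker_common[a [v Sav]].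
pose f (x : subgroup_type lift_ker) := tau ^+ a * \val (\val x) * (tau ^+ a)^-1.
have f1 : f 1 = 1 by rewrite /f !gmulf1 mulg1 mulgV.
have fM x y : f (x * y) = f x * f y.
  by rewrite /f !gmulfM !mulgA mulgKV.
have fV x : f x^-1 = (f x)^-1.
  by rewrite /f !gmulfV !invgM invgK mulgA.
apply: (@sub_finite_set _ _ (f @^-1` W v)).
  apply: generated_min; last by move=> x /Sav.
  split; rewrite /preimage/=; first by rewrite f1.
    by move=> x y fx fy; rewrite fM; exact: WM.
  by move=> x fx; rewrite fV; exact: WV.
apply: finite_preimage => // x y _ _ /mulIg /mulgI /val_inj; exact: val_inj.
Qed.

(** The exponent of [tau] is a surjective morphism to the integers, by
    [hasexp_unique], and its kernel is locally finite. *)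
Theorem ascending_lift : locally_finite_lift LT Zgroup.
Proof.
split.
  apply: (@countable_inj_in _ _ (fun x : LT => \val x) (L : set K)); last exact: countable_L.
    exact: val_inj.
  exact: valLT.
exists (subgroup_type lift_ker), (\val : {multiplicative subgroup_type lift_ker -> LT}),
  (lift_exp : {multiplicative LT -> Zgroup}); split.
- exact: lift_ker_locally_finite.
- exact: val_inj.
- apply/seteqP; split => [_ [x _ <-]|s s1]; first exact: (set_mem (valP x)).
  have ks : s \in lift_ker_set by exact: mem_set.
  by exists (Sub s ks : subgroup_type lift_ker) => //; exact: SubK.
- apply/seteqP; split => // k _.
  have Ltau : tau \in (L : set K) by apply: mem_set; rewrite -L_gen; apply: sub_generated; left.
  pose T : LT := Sub tau Ltau.
  have hn n : hasexp (\val (T ^+ n)) (n%:Z)%R.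
    elim: n => [|n IH]; first by rewrite expg0 gmulf1; exact: hasexp1.
    rewrite expgS gmulfM (_ : (n.+1%:Z)%R = (1%:Z + n%:Z)%R); last by lia.
    by apply: hasexpM IH; exact: hasexp_tau.
  case: (intP k) => [|n|n].
  + by exists 1 => //; exact: lift_exp1.
  + by exists (T ^+ n.+1) => //; apply: lift_expE; exact: hn.
  + exists (T ^+ n.+1)^-1 => //; apply: lift_expE; rewrite gmulfV.
    apply: hasexpV; exact: hn.
Qed.

End AscendingLift.

(** * Windows and their shifts *)

Section Windows.
Local Open Scope ring_scope.
Context (F : finNzRingType) (m : nat -> nat).
Hypothesis (m_mono : forall k n, (k < n)%N -> (m k < m n)%N).
Local Notation A := (mat_ring F m).
Local Notation K := (Kgrp A).
Notation seqA := (forall n, mat_ring F m n).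

Lemma m_ge n : (n <= m n)%N.
Proof. by elim: n => // n IH; apply: leq_ltn_trans IH (m_mono _). Qed.

Definition mx_at (g : K) n : 'M[A n]_3 := uval (kval g n).

Lemma mx_atM g h n : mx_at (g * h)%g n = mx_at g n * mx_at h n. Proof. by []. Qed.
Lemma mx_at1 n : mx_at 1%g n = 1. Proof. by []. Qed.
Lemma mx_at_inj g h : (forall n, mx_at g n = mx_at h n) -> g = h.
Proof. by move=> gh; apply: kval_inj => n; apply: uval_inj; exact: gh. Qed.
Lemma mx_at_elem_seq i j (x : seqA) n : i != j -> mx_at (elem_seq i j x) n = 1 + ent_mx i j (x n).
Proof. by move=> ij; rewrite /mx_at kval_elem_seq uval_elem. Qed.
Lemma mx_at_elem_seqV i j (x : seqA) n : i != j -> mx_at (elem_seq i j x)^-1%g n = 1 + ent_mx i j (- x n).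
Proof. by move=> ij; rewrite /mx_at kvalV kval_elem_seq uval_elemV. Qed.

(** The embedding of small matrices as the upper left corner. *)
Definition embed v n (a : 'M[F]_(v.+1)) : A n :=
  (pid_mx v.+1 : 'M[F]_((m n).+1, v.+1)) *m a *m (pid_mx v.+1 : 'M[F]_(v.+1, (m n).+1)).

Lemma embedD v n (a b : 'M[F]_(v.+1)) : embed n (a + b) = embed n a + embed n b.
Proof. by rewrite /embed mulmxDr mulmxDl. Qed.

Lemma embed0 v n : embed n (0 : 'M[F]_(v.+1)) = 0.
Proof. by rewrite /embed mulmx0 mul0mx. Qed.

Lemma embed_sum v n (I : Type) (r : seq I) (f : I -> 'M[F]_(v.+1)) :
  embed n (\sum_(i <- r) f i) = \sum_(i <- r) embed n (f i).
Proof. by elim: r => [|i r IH]; rewrite ?big_nil ?embed0// !big_cons embedD IH. Qed.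

Lemma embedM v n (a b : 'M[F]_(v.+1)) : (v <= m n)%N -> embed n (a * b) = embed n a * embed n b.
Proof.
move=> vm; rewrite /embed -[RHS]/(_ *m _) !mulmxA -[_ *m pid_mx _ *m pid_mx _]mulmxA.
have e : minn (m n).+1 (minn v.+1 v.+1) = v.+1 by rewrite minnn; apply/minn_idPr; rewrite ltnS.
by rewrite mul_pid_mx e pid_mx_1 mulmx1 -?mulmxA.
Qed.

Definition embed3 v n (a : 'M['M[F]_(v.+1)]_3) : 'M[A n]_3 := map_mx (embed n) a.

Lemma embed3D v n (a b : 'M['M[F]_(v.+1)]_3) : embed3 n (a + b) = embed3 n a + embed3 n b.
Proof. by apply/matrixP => i j; rewrite !mxE embedD. Qed.

Lemma embed30 v n : embed3 n (0 : 'M['M[F]_(v.+1)]_3) = 0.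
Proof. by apply/matrixP => i j; rewrite !mxE embed0. Qed.

Lemma embed3M v n (a b : 'M['M[F]_(v.+1)]_3) : (v <= m n)%N -> embed3 n (a * b) = embed3 n a * embed3 n b.
Proof.
move=> vm; apply/matrixP => i j; rewrite !mxE embed_sum; apply: eq_bigr => k _.
by rewrite !mxE embedM.
Qed.

Lemma embed3_ent v n i j (a : 'M[F]_(v.+1)) : embed3 n (ent_mx i j a) = ent_mx i j (embed n a).
Proof. by apply/matrixP => k l; rewrite !mxE; case: ifP => _; rewrite ?embed0. Qed.

(** A single small matrix describes all coordinates from [v] on, while the
    coordinates below [v] are arbitrary; the group of such elements is
    therefore finite. *)
Definition windowed v (g : K) := exists a : 'M['M[F]_(v.+1)]_3,
  forall n, (v <= n)%N -> mx_at g n = 1 + embed3 n a.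

Definition window_group v : set K := [set g | windowed v g /\ windowed v g^-1%g].

Lemma windowedM v g h : windowed v g -> windowed v h -> windowed v (g * h)%g.
Proof.
move=> [a ga] [b hb]; exists (a + b + a * b) => n vn.
have vm : (v <= m n)%N by exact: leq_trans vn (m_ge n).
by rewrite mx_atM ga// hb// !embed3D embed3M// mulrDl mul1r mulrDr mulr1 -!addrA [embed3 n b + (_ + _)]addrCA.
Qed.

Lemma window_group_subgroup v : is_subgroup (window_group v).
Proof.
split.
- have w1 : windowed v 1%g by exists 0 => n _; rewrite embed30 addr0.
  by split; rewrite ?invg1.
- by move=> g h [gw gVw] [hw hVw]; split; rewrite ?invgM; exact: windowedM.
- by move=> g [gw gVw]; split; rewrite ?invgK.
Qed.

(** An element is determined by the matrix describing it and by its first [v]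
    coordinates. *)
Lemma window_group_finite v : finite_set (window_group v).
Proof.
pose T := ('M['M[F]_(v.+1)]_3 * {dffun forall i : 'I_v, E3type A i})%type.
pose P (x : T) : set K := [set g | (forall n, (v <= n)%N -> mx_at g n = 1 + embed3 n x.1) /\ restr v g = x.2].
apply: (@sub_finite_set _ _ ((fun x : T => xget 1%g (P x)) @` setT)); last first.
  by apply: finite_image; exact: finite_finset.
move=> g [[a ga] _]; exists (a, restr v g) => //.
case: xgetP => [h _ [ha /= hg]|/(_ g)]; last by case; split.
apply: mx_at_inj => n; have [vn|nv] := leqP v n; first by rewrite ga// ha.
by rewrite /mx_at /kval ((restrP v h g).1 hg n nv).
Qed.

Lemma embed_widen v n (a : 'M[F]_(v.+1)) : embed n a = embed n (pid_mx v.+1 *m a *m pid_mx v.+1 : 'M[F]_(v.+2)).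
Proof.
have e1 : minn v.+2 (minn v.+2 v.+1) = v.+1 by lia.
have e2 : minn v.+2 (minn v.+1 v.+2) = v.+1 by lia.
have P1 : (pid_mx v.+2 : 'M[F]_((m n).+1, v.+2)) *m (pid_mx v.+1 : 'M[F]_(v.+2, v.+1)) = pid_mx v.+1.
  by rewrite mul_pid_mx e1.
have P2 : (pid_mx v.+1 : 'M[F]_(v.+1, v.+2)) *m (pid_mx v.+2 : 'M[F]_(v.+2, (m n).+1)) = pid_mx v.+1.
  by rewrite mul_pid_mx e2.
by rewrite /embed -P1 -P2 !mulmxA.
Qed.

Lemma windowed_incl v g : windowed v g -> windowed v.+1 g.
Proof.
move=> [a ga]; exists (map_mx (fun b => pid_mx v.+1 *m b *m pid_mx v.+1) a) => n vn.
rewrite ga; last exact: ltnW.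
by congr (_ + _); apply/matrixP => i j; rewrite !mxE -embed_widen.
Qed.

Lemma window_group_incl v : window_group v `<=` window_group v.+1.
Proof. by move=> g [gw gVw]; split; exact: windowed_incl. Qed.

(** The inclusion of [v.+1] indices into [v.+2] indices that raises each index
    by one. *)
Definition shift_mx v : 'M[F]_(v.+2, v.+1) := \matrix_(i, j) (i == j.+1 :> nat)%:R.

Lemma pid_fullE r n (i : 'I_n) (j : 'I_r) : (pid_mx r : 'M[F]_(n, r)) i j = (i == j :> nat)%:R.
Proof. by rewrite mxE; case: eqP => //= ->; rewrite ltn_ord. Qed.

Lemma cycV_eq v n (i : 'I_((m n).+1)) (j : 'I_v.+1) : (v < m n)%N ->
  (((cyc (m n))^-1%g i) == j :> nat) = (i == j.+1 :> nat).
Proof.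
move=> vm; have jm : (j.+1 < (m n).+1)%N by apply: leq_ltn_trans (ltn_ord j) _; rewrite ltnS.
have -> : (((cyc (m n))^-1%g i) == j :> nat) = ((cyc (m n))^-1%g i == inZp j).
  by rewrite -val_eqE/= modn_small// ltnW.
rewrite -(inj_eq (@perm_inj _ (cyc (m n)))) permKV cycE -val_eqE/=.
by rewrite modn_small.
Qed.

Lemma shift_mx_off v (j : 'I_v.+1) (k : 'I_v.+2) (jv : (j.+1 < v.+2)%N) :
  k != Ordinal jv -> shift_mx v k j = 0.
Proof.
move=> kj; rewrite mxE (_ : (k == j.+1 :> nat) = false)//.
by apply/negbTE; apply: contra kj => /eqP kj; apply/eqP/val_inj.
Qed.

Lemma cshift_pid v n : (v < m n)%N ->
  (cshift F m n : 'M[F]_((m n).+1)) *m (pid_mx v.+1 : 'M[F]_((m n).+1, v.+1)) = (pid_mx v.+2 : 'M[F]_((m n).+1, v.+2)) *m shift_mx v.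
Proof.
move=> vm; apply/matrixP => i j; rewrite -row_permE mxE [RHS]mxE pid_fullE cycV_eq//.
have jv : (j.+1 < v.+2)%N by rewrite ltnS.
rewrite (bigD1 (Ordinal jv))//= pid_fullE mxE/= eqxx mulr1 big1 ?addr0//.
by move=> k kj; rewrite (shift_mx_off kj) mulr0.
Qed.

Lemma pid_fullE' r n (i : 'I_r) (j : 'I_n) : (pid_mx r : 'M[F]_(r, n)) i j = (j == i :> nat)%:R.
Proof. by rewrite mxE ltn_ord andbT eq_sym. Qed.

Lemma pid_cshiftV v n : (v < m n)%N ->
  (pid_mx v.+1 : 'M[F]_(v.+1, (m n).+1)) *m (cshiftV F m n : 'M[F]_((m n).+1)) = (shift_mx v)^T *m (pid_mx v.+2 : 'M[F]_(v.+2, (m n).+1)).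
Proof.
move=> vm; apply/matrixP => i j; rewrite /cshiftV -[cyc _]invgK -col_permE mxE [RHS]mxE pid_fullE' cycV_eq//.
have iv : (i.+1 < v.+2)%N by rewrite ltnS.
rewrite (bigD1 (Ordinal iv))//= pid_fullE' !mxE/= eqxx mul1r big1 ?addr0//.
by move=> k kj; rewrite mxE (shift_mx_off kj) mul0r.
Qed.

(** Conjugation by the cyclic shift moves the corner by one step along the
    diagonal; since [v < m n] nothing wraps around. *)
Lemma embed_conj v n (a : 'M[F]_(v.+1)) : (v < m n)%N ->
  cshift F m n * embed n a * cshiftV F m n = embed n (shift_mx v *m a *m (shift_mx v)^T).
Proof.
move=> vm; rewrite /embed -[_ * _ * _]/(_ *m _ *m _) !mulmxA cshift_pid//.
by rewrite -!mulmxA pid_cshiftV// !mulmxA.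
Qed.

Lemma unit_seqE v n k l : (v <= m n)%N -> (k <= v)%N -> (l <= v)%N ->
  unit_seq F m k l n = embed n (delta_mx (inord k) (inord l) : 'M[F]_(v.+1)).
Proof.
move=> vm kv lv; apply/matrixP => i j; rewrite /embed.
rewrite -(mul_delta_mx (0 : 'I_1)) mulmxA -colE -mulmxA -rowE.
rewrite !mxE big_ord1 !mxE !inordK ?ltnS//.
have small x : (x <= v)%N -> (x %% (m n).+1)%N = x.
  by move=> xv; rewrite modn_small// ltnS (leq_trans xv).
rewrite -!val_eqE/= !small// lv andbT (eq_sym l).
by case: eqP => [->|_]; rewrite ?kv ?mul0r//= mul1r.
Qed.

Section Tau.
Context (tau : K).
Hypothesis tauE : forall n, mx_at tau n = diag3 (fun=> cshift F m n).

Lemma tauVE n : mx_at tau^-1%g n = diag3 (fun=> cshiftV F m n).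
Proof.
have tv1 : diag3 (fun=> cshiftV F m n) * diag3 (fun=> cshift F m n) = 1.
  by rewrite diag3M -[RHS]diag31; congr diag3; apply/funext => _; exact: (congr1 (fun x : seqA => x n) (cshiftVK F m)).
have H : mx_at tau n * mx_at tau^-1%g n = 1 by rewrite -mx_atM mulgV.
by rewrite -[LHS]mul1r -tv1 -mulrA -tauE H mulr1.
Qed.

Lemma tau_conj_elem_seq i j x : i != j ->
  (tau * elem_seq i j x * tau^-1)%g = elem_seq i j (smul (smul (cshift F m) x) (cshiftV F m)).
Proof.
move=> ij; apply: mx_at_inj => n; rewrite !mx_atM tauE tauVE !mx_at_elem_seq// mulrDr mulr1 diag_ent mulrDl ent_diag.
congr (_ + _).
by rewrite diag3M -[RHS]diag31; congr diag3; apply/funext => _; exact: (congr1 (fun x : seqA => x n) (cshiftK F m)).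
Qed.

Lemma embed3_conj v n (a : 'M['M[F]_(v.+1)]_3) : (v < m n)%N ->
  diag3 (fun=> cshift F m n) * embed3 n a * diag3 (fun=> cshiftV F m n) = embed3 n (map_mx (fun b => shift_mx v *m b *m (shift_mx v)^T) a).
Proof.
move=> vm; apply/matrixP => i j.
rewrite mxE (bigD1 j)//= [diag3 _ j j]mxE eqxx big1 ?addr0; last first.
  by move=> k kj; rewrite [diag3 _ k j]mxE (negbTE kj) mulr0.
rewrite mxE (bigD1 i)//= [diag3 _ i i]mxE eqxx big1 ?addr0; last first.
  by move=> k ki; rewrite [diag3 _ i k]mxE eq_sym (negbTE ki) mul0r.
by rewrite !mxE embed_conj.
Qed.

Lemma windowed_conj v g : windowed v g -> windowed v.+1 (tau * g * tau^-1)%g.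
Proof.
move=> [a ga]; exists (map_mx (fun b => shift_mx v *m b *m (shift_mx v)^T) a) => n vn.
have vm : (v < m n)%N by exact: leq_trans vn (m_ge n).
rewrite !mx_atM ga ?(ltnW vn)// mulrDr mulr1 mulrDl tauE tauVE embed3_conj//; congr (_ + _).
by rewrite diag3M -[RHS]diag31; congr diag3; apply/funext => _; exact: (congr1 (fun x : seqA => x n) (cshiftK F m)).
Qed.

Lemma window_group_conj v g : window_group v g -> window_group v.+1 (tau * g * tau^-1)%g.
Proof.
move=> [gw gVw]; split; first exact: windowed_conj.
by rewrite !invgM invgK mulgA; exact: windowed_conj.
Qed.

Lemma mx_at_tauX d k l n : mx_at (tau ^+ d)%g n * ent_mx i0 i0 (unit_seq F m k l n) = ent_mx i0 i0 (unit_seq F m (k + d) l n).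
Proof.
elim: d k => [|d IH] k; first by rewrite expg0 mx_at1 mul1r addn0.
rewrite expgSr mx_atM -mulrA tauE diag_ent.
rewrite (_ : cshift F m n * unit_seq F m k l n = unit_seq F m k.+1 l n) ?IH ?addSnnS//.
exact: (congr1 (fun x : seqA => x n) (cshift_unit_seq F m k l)).
Qed.

(** Far enough in the sequence, a power of [tau] moves the matrix unit at
    [v.+1, 0] to another one, whereas a windowed element fixes it. *)
Lemma window_group_tau v d : (0 < d)%N -> ~ window_group v (tau ^+ d)%g.
Proof.
move=> d0 [[a ga] _].
pose n := (v + d).+1.
have vn : (v <= n)%N by rewrite /n; lia.
have nm := m_ge n.
have H := mx_at_tauX d v.+1 0 n; rewrite ga// mulrDl mul1r in H.
have PE : embed3 n a * ent_mx i0 i0 (unit_seq F m v.+1 0 n) = 0.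
  apply/matrixP => i j; rewrite !mxE big1// => k _; rewrite !mxE.
  case: ifP => _; last by rewrite mulr0.
  rewrite /embed /unit_seq -[_ * _]/(_ *m _) -!mulmxA.
  rewrite (_ : (pid_mx v.+1 : 'M[F]_(v.+1, (m n).+1)) *m _ = 0) ?mulmx0//.
  apply/matrixP => x y; rewrite !mxE big1// => z _; rewrite pid_fullE' mxE.
  case: eqP => [zx|_]; last by rewrite mul0r.
  rewrite (_ : (z == inZp v.+1) = false) ?mulr0//.
  apply/negbTE; rewrite -val_eqE/= zx modn_small; last by rewrite ltnS; lia.
  by have := ltn_ord x; rewrite neq_ltn => ->.
rewrite PE addr0 in H.
have /matrixP/(_ i0 i0)/matrixP/(_ (inZp v.+1) (inZp 0)) := H.
rewrite !mxE !eqxx/= => /eqP.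
rewrite (_ : (inZp v.+1 == inZp (v.+1 + d) :> 'I_((m n).+1)) = false) ?oner_eq0//.
apply/negbTE; rewrite -val_eqE/= !modn_small; try by rewrite ltnS; lia.
by rewrite neq_ltn; apply/orP; left; lia.
Qed.

End Tau.

Lemma window_group_elem_seq v i j k l : i != j -> (k <= v)%N -> (l <= v)%N -> window_group v (elem_seq i j (unit_seq F m k l)).
Proof.
move=> ij kv lv.
have E n : (v <= n)%N -> unit_seq F m k l n = embed n (delta_mx (inord k) (inord l) : 'M[F]_(v.+1)).
  by move=> vn; apply: unit_seqE => //; exact: leq_trans (m_ge n).
split.
  by exists (ent_mx i j (delta_mx (inord k) (inord l))) => n vn; rewrite mx_at_elem_seq// E// embed3_ent.
exists (ent_mx i j (- delta_mx (inord k) (inord l))) => n vn; rewrite mx_at_elem_seqV// E// embed3_ent.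
by congr (_ + ent_mx _ _ _); rewrite /embed mulmxN mulNmx.
Qed.

End Windows.

(** * Generating the matrix units *)

Section Generation.
Local Open Scope ring_scope.
Context (F : finNzRingType) (m : nat -> nat).
Local Notation A := (mat_ring F m).
Local Notation K := (Kgrp A).
Local Notation seqA := (forall n, mat_ring F m n).

(** The size [m n + 1] being odd, the cyclic permutation is the square of its
    power of exponent [(m n + 2) / 2]. The reflection [refl] conjugates this
    power to its inverse, as [diag3_square_E3] requires. *)
Lemma tau_exists : (forall n, ~~ odd (m n)) ->
  exists tau : K, forall n, mx_at tau n = diag3 (fun=> cshift F m n).
Proof.
move=> m_even.
have H n : exists u : unitgrp 'M[A n]_3, u \in E3 A n /\ uval u = diag3 (fun=> cshift F m n).
  pose h := (m n)./2.+1.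
  have hh : (h + h = (m n).+2)%N by have := odd_double_half (m n); rewrite (negbTE (m_even n)); rewrite /h; lia.
  pose s : A n := perm_mx ((cyc (m n))^-1 ^+ h)%g.
  pose s' : A n := perm_mx (cyc (m n) ^+ h)%g.
  pose c : A n := perm_mx (refl (m n)).
  have pM (p q : {perm 'I_((m n).+1)}) : (perm_mx p : A n) * perm_mx q = perm_mx (p * q)%g.
    by rewrite -[LHS]/(_ *m _) -perm_mxM.
  have p1 : (perm_mx 1%g : A n) = 1 by exact: perm_mx1.
  have [|||||u uE us] := @diag3_square_E3 A n s s' c c.
  - by rewrite pM expVgn mulVg.
  - by rewrite pM expVgn mulgV.
  - by rewrite pM reflK.
  - by rewrite pM reflK.
  - rewrite !pM; congr perm_mx.
    have rV : ((refl (m n))^-1 = refl (m n))%g.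
      by apply: (mulgI (refl (m n))); rewrite mulgV reflK.
    have cJ : (cyc (m n) ^ refl (m n) = (cyc (m n))^-1)%g.
      by rewrite conjgE rV mulgA refl_cyc.
    by rewrite -cJ -conjXg conjgE rV mulgA.
  exists u; split => //; rewrite us; congr diag3; apply/funext => _.
  rewrite pM /cshift -expgnDr hh expVgn expgS cyc_order.
  by rewrite mulg1.
exists (kmk (fun n => sval (cid (H n)))) => n.
by rewrite /mx_at; case: (svalP (cid (H n))) => uE us; rewrite kvalK.
Qed.

Context (L : set K) (gL : is_subgroup L).

(** Conjugation by [tau] moves the three given matrix units along the
    diagonal; products of neighbouring ones then reach any position. *)
Lemma offdiag_unit_seq_ladder :
  offdiag L (unit_seq F m 0 0) -> offdiag L (unit_seq F m 1 0) -> offdiag L (unit_seq F m 0 1) ->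
  (forall x, offdiag L x -> offdiag L (smul (smul (cshift F m) x) (cshiftV F m))) ->
  forall k l, offdiag L (unit_seq F m k l).
Proof.
move=> o00 o10 o01 oconj.
have conj k l : offdiag L (unit_seq F m k l) -> offdiag L (unit_seq F m k.+1 l.+1).
  by move=> /oconj; rewrite cshift_unit_seq unit_seq_cshiftV.
have okk k : offdiag L (unit_seq F m k k) by elim: k => // k; exact: conj.
have oSk k : offdiag L (unit_seq F m k.+1 k) by elim: k => // k; exact: conj.
have okS k : offdiag L (unit_seq F m k k.+1) by elim: k => // k; exact: conj.
have up d k : offdiag L (unit_seq F m (d + k) k).
  elim: d => // d IH; rewrite -(unit_seqMM F m _ (d + k)); apply: offdiagM => //; exact: oSk.
have down d k : offdiag L (unit_seq F m k (d + k)).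
  elim: d => // d IH; rewrite -(unit_seqMM F m _ (d + k)); apply: offdiagM => //; exact: okS.
move=> k l; have [lk|/ltnW kl] := leqP l k.
  by rewrite -(subnK lk).
by rewrite -(subnK kl).
Qed.

Lemma offdiag_unit_seq_unit : offdiag L (unit_seq F m 0 0) -> offdiag L (cshift F m) -> offdiag L (cshiftV F m) ->
  forall k l, offdiag L (unit_seq F m k l).
Proof.
move=> o00 ot ov k l; elim: k => [|k IH]; last by rewrite -cshift_unit_seq; exact: offdiagM.
by elim: l => // l IH; rewrite -unit_seq_cshiftV; exact: offdiagM.
Qed.

Lemma offdiag_conj_tau tau : L tau -> (forall n, mx_at tau n = diag3 (fun=> cshift F m n)) ->
  forall x, offdiag L x -> offdiag L (smul (smul (cshift F m) x) (cshiftV F m)).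
Proof.
move=> Lt tE x ox i j ij; rewrite -(tau_conj_elem_seq tE)//.
have [_ LM LV] := gL; apply: (LM); last exact: LV.
by apply: (LM) => //; exact: ox.
Qed.

(** Finitely many coordinates can be changed at will once the sequences
    supported in one coordinate are available. *)
Lemma offdiag_eventually (x y : seqA) N : (forall n (a : A n), offdiag L (single a)) ->
  offdiag L x -> (forall n, (N <= n)%N -> y n = x n) -> offdiag L y.
Proof.
move=> os ox xy.
pose z k : seqA := fun n => if (n < k)%N then y n else x n.
have oz k : offdiag L (z k).
  elim: k => [|k IH]; first by rewrite (_ : z 0 = x); [|apply: seqP].
  rewrite (_ : z k.+1 = sadd (z k) (single (y k - x k))); first exact: offdiagD.
  apply: seqP => n; rewrite /z /sadd ltnS; have [->|nk] := eqVneq n k.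
    by rewrite leqnn ltnn singleE addrC subrK.
  by rewrite singleO// addr0 leq_eqVlt (negbTE nk).
rewrite (_ : y = z N)//; apply: seqP => n; rewrite /z; case: ltnP => // Nn; exact: xy.
Qed.

End Generation.

(** * Regular permutations and the encoding of sequences *)

Section Regular.
Local Open Scope ring_scope.
Context (Q : finGroupType).
Local Open Scope group_scope.

Lemma card_predK : #|Q| = #|Q|.-1.+1.
Proof. by rewrite prednK//; apply/card_gt0P; exists 1. Qed.

Definition rk (x : Q) : 'I_(#|Q|.-1.+1) := cast_ord card_predK (enum_rank x).
Definition unrk (i : 'I_(#|Q|.-1.+1)) : Q := enum_val (cast_ord (esym card_predK) i).

Lemma rkK : cancel rk unrk.
Proof. by move=> x; rewrite /rk /unrk cast_ordK enum_rankK. Qed.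
Lemma unrkK : cancel unrk rk.
Proof. by move=> i; rewrite /rk /unrk enum_valK cast_ordKV. Qed.

Lemma rk_perm_subproof (f : {perm Q}) : injective (fun i => rk (f (unrk i))).
Proof. by move=> i j /(can_inj rkK) /perm_inj /(can_inj unrkK). Qed.
Definition rk_perm (f : {perm Q}) := perm (@rk_perm_subproof f).

Lemma rk_permE f i : rk_perm f i = rk (f (unrk i)).
Proof. by rewrite permE. Qed.
Lemma rk_permM f g : rk_perm (f * g) = rk_perm f * rk_perm g.
Proof. by apply/permP => i; rewrite permM !rk_permE rkK permM. Qed.
Lemma rk_perm1 : rk_perm 1 = 1.
Proof. by apply/permP => i; rewrite rk_permE !perm1 unrkK. Qed.

Definition rmul (h : Q) : {perm Q} := perm (@mulIg _ h).

Lemma rmulM g h : rmul (g * h) = rmul g * rmul h.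
Proof. by apply/permP => x; rewrite permM !permE mulgA. Qed.
Lemma rmul1 : rmul 1 = 1.
Proof. by apply/permP => x; rewrite !permE mulg1. Qed.

(** Right multiplication by [h], transported to the ordinals of size [#|Q|];
    the size is written as a successor to fit the type of non-empty square
    matrices. *)
Definition regular_perm h := rk_perm (rmul h).
Lemma regular_permM g h : regular_perm (g * h) = regular_perm g * regular_perm h.
Proof. by rewrite /regular_perm rmulM rk_permM. Qed.
Lemma regular_perm1 : regular_perm 1 = 1.
Proof. by rewrite /regular_perm rmul1 rk_perm1. Qed.
Lemma regular_perm_inj h : regular_perm h = 1 -> h = 1.
Proof.
move=> /permP /(_ (rk 1)); rewrite rk_permE rkK perm1 => /(can_inj rkK).
by rewrite permE mul1g.
Qed.

(** A base point of the coset [x <[h]>], depending on this coset only. *)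
Definition cbase (h x : Q) : Q := repr (x *: <[h]>)%g.
(** On each coset of the group generated by [h], the reflection sending [b
    h^k] to [b h^-k], where [b] is the base point. *)
Definition cflip (h x : Q) : Q := cbase h x * x^-1 * cbase h x.

Lemma cbaseP h x : exists2 k : nat, x = cbase h x * h ^+ k & cbase h (x * h) = cbase h x.
Proof.
have : cbase h x \in (x *: <[h]>)%g by apply: mem_repr (lcoset_refl _ _).
rewrite mem_lcoset => /groupVr; rewrite invgM invgK => /cycleP[k hk].
exists k; first by rewrite -hk mulKVg.
by rewrite /cbase lcosetM lcoset_id// cycle_id.
Qed.

Lemma cflipK h : involutive (cflip h).
Proof.
move=> x; have [k xk _] := cbaseP h x.
have e : cflip h x = cbase h x * (h ^+ k)^-1 by rewrite /cflip {2}xk invgM mulgA mulgKV.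
have b : cbase h (cflip h x) = cbase h x.
  have bx : cbase h x = x * (h ^+ k)^-1 by rewrite {2}xk mulgK.
  by rewrite e [X in X * _]bx -mulgA /cbase lcosetM lcoset_id// groupM ?groupV ?mem_cycle.
by rewrite {1}/cflip b e invgM invgK mulgA mulgKV -xk.
Qed.

Lemma cflip_mul h x : cflip h (x * h) = cflip h x * h^-1.
Proof.
have [k xk bh] := cbaseP h x.
have flipE y j : y = cbase h x * h ^+ j -> cbase h x * y^-1 * cbase h x = cbase h x * (h ^+ j)^-1.
  by move=> ->; rewrite invgM mulgA mulgKV.
rewrite /cflip bh (flipE _ k.+1); last by rewrite expgSr mulgA -xk.
by rewrite (flipE _ k)// expgS invgM mulgA.
Qed.

Definition flip_perm h : {perm Q} := perm (can_inj (cflipK h)).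

Lemma flip_permP h : flip_perm h * rmul h^-1 * flip_perm h = rmul h.
Proof.
apply/permP => x; rewrite !permM !permE.
by rewrite -cflip_mul cflipK.
Qed.

Lemma flip_permK h : flip_perm h * flip_perm h = 1.
Proof. by apply/permP => x; rewrite permM perm1 !permE cflipK. Qed.

Definition reflector h := rk_perm (flip_perm h).

(** Reflecting each cycle of the permutation given by [h] reverses it, which
    conjugates the permutation to its inverse by an involution. *)
Lemma reflectorP h : reflector h * regular_perm h^-1 * reflector h = regular_perm h.
Proof. by rewrite /reflector /regular_perm -!rk_permM flip_permP. Qed.
Lemma reflectorK h : reflector h * reflector h = 1.
Proof. by rewrite /reflector -rk_permM flip_permK rk_perm1. Qed.

End Regular.

Section Encoding.
Local Open Scope ring_scope.
Context (F : finNzRingType) (m v : nat -> nat).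
Hypothesis vm : forall n, (n.+1 * (v n).+1 <= (m n).+1)%N.
Local Notation A := (mat_ring F m).
Local Notation K := (Kgrp A).
Local Notation seqA := (forall n, mat_ring F m n).

Let v_le n : (v n <= m n)%N.
Proof. by rewrite -ltnS; apply: leq_trans (vm n); rewrite mulSn leq_addr. Qed.

(** The idempotent of the upper left corner of size [v n + 1]. *)
Definition corner : seqA := fun n => embed m n (1 : 'M[F]_((v n).+1)).
(** The shift by one block, a block having the size of the corner. *)
Definition bshift : seqA := fun n => cshift F m n ^+ (v n).+1.

Let pM n (p q : {perm 'I_((m n).+1)}) : (perm_mx p : A n) * perm_mx q = perm_mx (p * q)%g.
Proof. by rewrite -[LHS]/(_ *m _) -perm_mxM. Qed.
Let p1 n : (perm_mx 1%g : A n) = 1. Proof. exact: perm_mx1. Qed.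

Lemma perm_mxX n (p : {perm 'I_((m n).+1)}) k : (perm_mx p : A n) ^+ k = perm_mx (p ^+ k)%g.
Proof. by elim: k => [|k IH]; rewrite ?expr0 ?expg0 ?p1// exprS IH pM expgS. Qed.

Lemma corner_perm0 n (p : {perm 'I_((m n).+1)}) :
  (forall i : 'I_((m n).+1), (i < (v n).+1)%N -> ((v n).+1 <= p i)%N) ->
  corner n * perm_mx p * corner n = 0.
Proof.
move=> pv; rewrite /corner /embed !mulmx1 -[_ * _ * _]/(_ *m _ *m _).
set P := (pid_mx (v n).+1 : 'M[F]_((m n).+1, (v n).+1)).
set P' := (pid_mx (v n).+1 : 'M[F]_((v n).+1, (m n).+1)).
have H : P' *m (perm_mx p *m P) = 0.
  apply/matrixP => i j; rewrite !mxE big1// => k _; rewrite pid_fullE' -row_permE mxE pid_fullE.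
  case: eqP => [ki|_]; last by rewrite mul0r.
  have kv : (k < (v n).+1)%N by rewrite ki.
  have := pv k kv; case: eqP => [->|_]; last by rewrite mulr0.
  by rewrite leqNgt ltn_ord.
by rewrite !mulmxA -[_ *m perm_mx p]mulmxA -[P *m _ *m P]mulmxA -[P' *m _ *m P]mulmxA H mulmx0 mul0mx.
Qed.

Lemma corner_shift0 n a : ((v n).+1 <= a)%N -> (a + (v n).+1 <= (m n).+1)%N ->
  corner n * cshift F m n ^+ a * corner n = 0 /\ corner n * cshiftV F m n ^+ a * corner n = 0.
Proof.
move=> va am; split.
  rewrite /cshift perm_mxX; apply: corner_perm0 => i iv; rewrite leqNgt; apply/negP => jv.
  set j := _ i in jv.
  have : i = (cyc (m n) ^+ a)%g j by rewrite /j expVgn permKV.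
  rewrite -[j]valZpK cycX => /(congr1 val)/=; rewrite modn_small; lia.
rewrite /cshiftV perm_mxX; apply: corner_perm0 => i iv.
rewrite -[i]valZpK cycX /= modn_small; lia.
Qed.

(** The sequence [Y j], supported by the corner columns, is moved to the block
    of columns number [j]; only the [n + 1] first blocks are guaranteed to fit
    in the coordinate [n]. *)
Definition encode (Y : nat -> seqA) : seqA := fun n =>
  \sum_(j < n.+1) Y j n * cshiftV F m n ^+ (j * (v n).+1).

(** Shifting back by [j] blocks brings [Y j] to the corner and moves all other
    blocks off it. *)
Lemma encode_decode Y j n : (forall j n, Y j n * corner n = Y j n) -> (j <= n)%N ->
  encode Y n * bshift n ^+ j * corner n = Y j n.
Proof.
move=> Yc jn; rewrite /encode !mulr_suml.
have jn' : (j < n.+1)%N by rewrite ltnS.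
set q := (v n).+1.
have ttq k : cshift F m n ^+ k * cshiftV F m n ^+ k = 1 /\ cshiftV F m n ^+ k * cshift F m n ^+ k = 1.
  by rewrite /cshift /cshiftV !perm_mxX !pM expVgn mulgV mulVg p1.
rewrite (bigD1 (Ordinal jn'))//= big1 ?addr0.
  by rewrite /bshift -exprM mulnC -mulrA -mulrA [cshiftV F m n ^+ _ * _]mulrA (ttq _).2 mul1r Yc.
move=> k kj; rewrite -[Y k n]Yc /bshift -exprM [(q * j)%N]mulnC -!mulrA.
have {}kj : (k != j :> nat) by apply: contra kj => /eqP kj; apply/eqP/val_inj.
have [kj'|jk|/eqP] := ltngtP k j; last by rewrite (negbTE kj).
  have -> : (j * q = k * q + (j - k) * q)%N by rewrite -mulnDl subnKC// ltnW.
  rewrite exprD [cshiftV F m n ^+ _ * _]mulrA [cshiftV F m n ^+ _ * _]mulrA (ttq _).2 mul1r.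
  rewrite [corner n * _]mulrA (corner_shift0 _ _).1 ?mulr0//; have := vm n; rewrite -/q; nia.
have -> : (k * q = (k - j) * q + j * q)%N by rewrite -mulnDl subnK// ltnW.
rewrite exprD -[_ * _ * (cshift F m n ^+ _ * _)]mulrA [cshiftV F m n ^+ (j * q) * _]mulrA (ttq _).2 mul1r.
rewrite [corner n * _]mulrA (corner_shift0 _ _).2 ?mulr0//; have := vm n; have := ltn_ord k; rewrite -/q; nia.
Qed.

(** Decoding is a ring operation, correct in all coordinates from [j] on; the
    other coordinates are corrected by [offdiag_eventually]. *)
Lemma offdiag_encoded (L : set K) (Y : nat -> seqA) : is_subgroup L ->
  (forall n (a : A n), offdiag L (single a)) ->
  (forall j n, Y j n * corner n = Y j n) ->
  offdiag L (sone A) -> offdiag L corner -> offdiag L bshift -> offdiag L (encode Y) ->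
  forall j, offdiag L (Y j).
Proof.
move=> gL os Yc o1 oc ob oY j.
have obj k : offdiag L (fun n => bshift n ^+ k).
  elim: k => [|k IH]; first by rewrite (_ : (fun n => _) = sone A)//; apply: seqP => n; rewrite expr0.
  rewrite (_ : (fun n => _) = smul bshift (fun n => bshift n ^+ k)); first exact: offdiagM.
  by apply: seqP => n; rewrite exprS.
apply: (offdiag_eventually gL os (x := smul (smul (encode Y) (fun n => bshift n ^+ j)) corner) (N := j)).
  by apply: offdiagM => //; exact: offdiagM.
by move=> n jn; rewrite /smul encode_decode.
Qed.

(** A permutation of the indices of the corner, extended by the identity to
    the whole set of indices. *)
Definition perm_embed n (p : {perm 'I_((v n).+1)}) : A n := 1 + embed m n (perm_mx p - 1).

Lemma perm_embedM n (p q : {perm 'I_((v n).+1)}) : perm_embed (p * q)%g = perm_embed p * perm_embed q.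
Proof.
have E : (perm_mx (p * q)%g - 1 : 'M[F]_((v n).+1)) =
    (perm_mx p - 1) + ((perm_mx q - 1) + (perm_mx p - 1) * (perm_mx q - 1)).
  rewrite perm_mxM -[perm_mx p *m _]/(perm_mx p * perm_mx q).
  set x := perm_mx p; set y := perm_mx q.
  by rewrite mulrBl mul1r [_ + (_ - _)]addrC subrK mulrBr mulr1 [RHS]addrC addrA subrK.
rewrite /perm_embed E; move: (perm_mx p - 1) (perm_mx q - 1) => a b.
by rewrite !embedD embedM ?v_le// mulrDl mul1r mulrDr mulr1 -!addrA; congr (_ + _); rewrite addrCA.
Qed.

Lemma perm_embed1 n : perm_embed (1%g : {perm 'I_((v n).+1)}) = 1.
Proof. by rewrite /perm_embed perm_mx1 subrr embed0 addr0. Qed.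

Lemma embed_inj n (a : 'M[F]_((v n).+1)) : embed m n a = 0 -> a = 0.
Proof.
move=> a0; have PP : (pid_mx (v n).+1 : 'M[F]_((v n).+1, (m n).+1)) *m (pid_mx (v n).+1 : 'M[F]_((m n).+1, (v n).+1)) = 1%:M.
  have e : minn (m n).+1 (minn (v n).+1 (v n).+1) = (v n).+1.
    by rewrite minnn; apply/minn_idPr; rewrite ltnS.
  by rewrite mul_pid_mx e pid_mx_1.
have -> : a = (pid_mx (v n).+1 : 'M[F]_((v n).+1, (m n).+1)) *m embed m n a *m (pid_mx (v n).+1 : 'M[F]_((m n).+1, (v n).+1)).
  by rewrite /embed !mulmxA PP mul1mx -mulmxA PP mulmx1.
by rewrite a0 mulmx0 mul0mx.
Qed.

Lemma perm_embed_inj n (p : {perm 'I_((v n).+1)}) : perm_embed p = 1 -> p = 1%g.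
Proof.
rewrite /perm_embed -[RHS]addr0 => /addrI /embed_inj /eqP; rewrite subr_eq0 => /eqP p1'.
apply/permP => i; rewrite perm1; move/matrixP: p1' => /(_ i (p i)); rewrite !mxE eqxx => /esym/eqP.
by case: (eqVneq i (p i)) => [<-//|_]; rewrite eq_sym oner_eq0.
Qed.

End Encoding.

(** * The copy of a residually finite group, and Heisenberg generators *)

Section Corestriction.
Local Open Scope ring_scope.
Context (H K : groupType) (L : subgroup K) (f : H -> K).
Hypotheses (fM : forall g h, f (g * h)%g = (f g * f h)%g) (fL : forall h, (L : set K) (f h)).

Definition corestr (h : H) : subgroup_type L := Sub (f h) (mem_set (fL h)).

Let corestrM g h : (corestr (g * h) = corestr g * corestr h)%g.
Proof. by apply: val_inj; rewrite /= fM. Qed.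

HB.instance Definition _ := isMultiplicative.Build H (subgroup_type L) corestr corestrM.
Lemma multiplicative_corestriction : injective f ->
  exists F : {multiplicative H -> subgroup_type L}, injective F.
Proof.
move=> f_inj; exists (corestr : {multiplicative H -> subgroup_type L}).
by move=> g h /(congr1 val); exact: f_inj.
Qed.

End Corestriction.

Section MultiplicativeMaps.
Local Open Scope ring_scope.
Context (G H : groupType) (f : {multiplicative G -> H}).
Local Open Scope group_scope.

Lemma multiplicative1 : f 1 = 1.
Proof. by apply: (mulgI (f 1)); rewrite -gmulfM !mulg1. Qed.

Lemma multiplicativeV x : f x^-1 = (f x)^-1.
Proof. by apply: (mulgI (f x)); rewrite -gmulfM !mulgV multiplicative1. Qed.

End MultiplicativeMaps.

Section Copy.
Local Open Scope ring_scope.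
Context (F : finNzRingType) (m : nat -> nat) (Q : nat -> finGroupType).
Definition vQ (n : nat) := #|Q n|.-1.
Hypothesis vm : forall n, (n.+1 * (vQ n).+1 <= (m n).+1)%N.
Context (H : groupType) (rho : forall n, {multiplicative H -> Q n}).
Local Notation A := (mat_ring F m).
Local Notation K := (Kgrp A).
Local Notation seqA := (forall n, mat_ring F m n).

Definition corner_seq (p : forall n, {perm 'I_((vQ n).+1)}) : seqA :=
  fun n => embed m n (perm_mx (p n) - 1).

Definition regular_seq h := corner_seq (fun n => regular_perm (rho n h)).
Definition reflector_seq h := corner_seq (fun n => reflector (rho n h)).

Lemma corner_seq_corner p n : corner_seq p n * corner F m vQ n = corner_seq p n.
Proof.
by rewrite /corner_seq /corner -embedM ?mulr1// -ltnS; apply: leq_trans (vm n); rewrite mulSn leq_addr.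
Qed.

(** The same matrices as [perm_embed], written as one plus a sequence
    supported by the corner, the form in which they can be encoded. *)
Definition perm_unit (p : forall n, {perm 'I_((vQ n).+1)}) : seqA := sadd (sone A) (corner_seq p).

Lemma perm_unitM p q n :
  perm_unit (fun n => p n * q n)%g n = perm_unit p n * perm_unit q n.
Proof. exact: (perm_embedM F vm). Qed.

Lemma perm_unit1 n : perm_unit (fun=> 1%g) n = 1.
Proof. exact: (perm_embed1 F m vQ n). Qed.

Lemma perm_unit_eq p q : (forall n, p n = q n) -> perm_unit p = perm_unit q.
Proof. by move=> pq; congr perm_unit; apply: functional_extensionality_dep. Qed.

Let P h := perm_unit (fun n => regular_perm (rho n h)).
Let C h := perm_unit (fun n => reflector (rho n h)).

Let PM g h : P (g * h)%g = smul (P g) (P h).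
Proof.
apply: seqP => n; rewrite /smul -perm_unitM; congr (_ n); apply: perm_unit_eq => k.
by rewrite gmulfM regular_permM.
Qed.

Let P1 : P 1%g = sone A.
Proof.
apply: seqP => n; transitivity (perm_unit (fun=> 1%g) n); last exact: perm_unit1.
congr (_ n); apply: perm_unit_eq => k.
by rewrite multiplicative1 regular_perm1.
Qed.

Let CK h : smul (C h) (C h) = sone A.
Proof.
apply: seqP => n; transitivity (perm_unit (fun=> 1%g) n); last exact: perm_unit1.
rewrite /smul -perm_unitM; congr (_ n).
by apply: perm_unit_eq => k; exact: reflectorK.
Qed.

Let CPC h : smul (smul (C h) (P h^-1%g)) (C h) = P h.
Proof.
apply: seqP => n; rewrite /smul -!perm_unitM; congr (_ n).
by apply: perm_unit_eq => k; rewrite multiplicativeV reflectorP.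
Qed.

Definition kweyl (x y : seqA) : K := (elem_seq i0 i1 x * elem_seq i1 i0 (sopp y) * elem_seq i0 i1 x)%g.

Lemma kval_kweyl x y n : kval (kweyl x y) n = weyl i0 i1 (x n) (y n).
Proof. by rewrite !kvalM !kval_elem_seq. Qed.

(** In each coordinate this is, by [weyl_diag], the diagonal matrix with
    entries [P h], [P h], 1, and it is visibly a product of elementary
    matrices with entries in the ring generated by the sequences [P] and [C]. *)
Definition copy h : K :=
  (kweyl (sopp (smul (P h) (C h))) (sopp (smul (C h) (P h^-1%g))) * kweyl (C h) (C h))%g.

Lemma mx_at_copy h n : mx_at (copy h) n = diag3 (fun k => if (k == i0) || (k == i1) then P h n else 1).
Proof.
have at_n x y : x = y -> x n = y n :> A n by move=> ->.
rewrite /mx_at /copy kvalM !kval_kweyl; apply: weyl_diag => //.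
- by have /at_n := PM h h^-1%g; rewrite mulgV P1 => /esym.
- by have /at_n := PM h^-1%g h; rewrite mulVg P1 => /esym.
- by have /at_n := CK h.
- by have /at_n := CK h.
- by have /at_n := CPC h.
Qed.

Lemma copyM g h : copy (g * h)%g = (copy g * copy h)%g.
Proof.
apply: mx_at_inj => n; rewrite mx_atM !mx_at_copy diag3M; congr diag3; apply/funext => k.
by case: ifP => _; rewrite ?mulr1// PM.
Qed.

Lemma copy_inj : (forall h, h != 1%g -> exists n, rho n h != 1%g) -> injective copy.
Proof.
move=> rho_sep g h gh; apply/eqP; rewrite -[_ == _]negbK -(inj_eq (mulIg h^-1%g)) mulgV.
apply/negP => /rho_sep[n]; apply/negP; rewrite negbK.
have : copy (g * h^-1)%g = 1%g.
  have c1 : copy 1%g = 1%g by apply: (mulgI (copy 1%g)); rewrite -copyM !mulg1.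
  by rewrite copyM gh -copyM mulgV c1.
move=> /(congr1 (fun x => mx_at x n)); rewrite mx_at_copy mx_at1.
move=> /matrixP/(_ i0 i0); rewrite !mxE !eqxx /= => Pn.
by apply/eqP; apply: regular_perm_inj; exact: (perm_embed_inj vm (n := n)) Pn.
Qed.

(** The entries of the elementary factors are ring expressions in 1 and in the
    two families of corner sequences. *)
Lemma copy_mem (L : set K) : is_subgroup L -> offdiag L (sone A) ->
  (forall h, offdiag L (regular_seq h)) -> (forall h, offdiag L (reflector_seq h)) ->
  forall h, L (copy h).
Proof.
move=> gL L1 LR LF h.
have [_ LM _] := gL.
have oP g : offdiag L (P g) by exact: (offdiagD gL L1 (LR g)).
have oC g : offdiag L (C g) by exact: (offdiagD gL L1 (LF g)).
have kM x y : offdiag L x -> offdiag L y -> L (kweyl x y).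
  by move=> ox oy; apply: (LM); [apply: (LM); [exact: ox|exact: (offdiagN gL oy)]|exact: ox].
by apply: (LM); apply: kM => //; apply: (offdiagN gL); apply: (offdiagM gL).
Qed.

End Copy.

Section HeisenbergFamily.
Local Open Scope ring_scope.
Context (A : nat -> finNzRingType) (p : nat).
Hypothesis Ap : forall n (a : A n), a *+ p = 0.
Local Notation K := (Kgrp A).
Local Notation seqA := (forall n, A n).

(** The successor in the cycle 0, 1, 2. Two elementary matrices at places of
    the form [s, nxt s] commute, or their commutator is an elementary matrix
    commuting with both. *)
Definition nxt (s : 'I_3) : 'I_3 := if s == i0 then i1 else if s == i1 then i2 else i0.

(** The hypothesis of [haar_spectral_gap] on a pair of generators. *)
Definition heis (g h : K) := exists z : K,
  [/\ (z ^+ p = 1)%g, (g * h = h * g * z)%g, commute g z & commute h z].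

Lemma heis_sym g h : heis g h -> heis h g.
Proof.
case=> z [zp ghz gz hz]; exists z^-1%g; split; try exact: commuteV.
- by rewrite expVgn zp invg1.
- by rewrite ghz mulgK.
Qed.

Lemma heis_commute g h : commute g h -> heis g h.
Proof. by move=> gh; exists 1%g; split; rewrite ?expg1n ?mulg1//; exact: commute1. Qed.

Lemma elem_seq_torsion i j (x : seqA) : i != j -> (elem_seq i j x ^+ p = 1)%g.
Proof.
move=> ij; rewrite elem_seqX// (_ : (fun n => _) = szero A) ?elem_seq0//.
by apply: functional_extensionality_dep => n; rewrite Ap.
Qed.

Lemma heis_elem_seq i j k (x y : seqA) : i != j -> j != k -> i != k -> heis (elem_seq i j x) (elem_seq j k y).
Proof.
move=> ij jk ik; exists (elem_seq i k (smul x y)); split.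
- exact: elem_seq_torsion.
- exact: elem_seq_comm.
- by apply: elem_seq_commute => //; rewrite eq_sym.
- by apply: elem_seq_commute => //; rewrite eq_sym.
Qed.

(** Two places [s, nxt s] and [t, nxt t] either coincide, or are consecutive
    in one order or the other. *)
Lemma heis_nxt s t (x y : seqA) : heis (elem_seq s (nxt s) x) (elem_seq t (nxt t) y).
Proof.
have [->|st] := eqVneq s t.
  by apply: heis_commute; apply: elem_seq_commute; rewrite -?val_eqE; case: t => [[|[|[|//]]] ?].
have [->|ts] := eqVneq t (nxt s).
  by apply: heis_elem_seq; case: s {st} => [[|[|[|//]]] ?].
have -> : s = nxt t.
  by move: st ts; case: s => [[|[|[|//]]] ?]; case: t => [[|[|[|//]]] ?] //= _ _; apply: val_inj.
by apply: heis_sym; apply: heis_elem_seq; case: t {st ts} => [[|[|[|//]]] ?].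
Qed.

End HeisenbergFamily.

(** * The two dense subgroups *)

Section GapFamily.
Local Open Scope ring_scope.
Context (F : finNzRingType) (m : nat -> nat).
Hypothesis F_nat : forall a : F, exists k, a = k%:R.
Hypothesis m_mono : forall k n, (k < n)%N -> (m k < m n)%N.
Local Notation A := (mat_ring F m).
Local Notation K := (Kgrp A).
Local Notation seqA := (forall n, mat_ring F m n).

Lemma mat_ring_torsion p : (forall a : F, a *+ p = 0) -> forall n (a : A n), a *+ p = 0.
Proof. by move=> Fp n a; apply/matrixP => i j; rewrite mulmxnE Fp mxE. Qed.

(** Four entries at the place [0, 1], and the entry 1 at the two other places:
    enough to move entries everywhere and to generate all matrix units. *)
Definition gap_data (k : 'I_6) : 'I_3 * seqA :=
  nth (i0, sone A) [:: (i0, sone A); (i0, cshift F m); (i0, cshiftV F m); (i0, unit_seq F m 0 0);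
                       (i1, sone A); (i2, sone A)] k.

Definition gap_gen k : K := elem_seq (gap_data k).1 (nxt (gap_data k).1) (gap_data k).2.

Section Generated.
Context (L : set K) (gL : is_subgroup L).

Lemma gap_gen_offdiag : (forall k, L (gap_gen k)) ->
  [/\ offdiag L (sone A), offdiag L (cshift F m), offdiag L (cshiftV F m) & offdiag L (unit_seq F m 0 0)].
Proof.
move=> Lk; have L01 := Lk (@Ordinal 6 0 isT); have L12 := Lk (@Ordinal 6 4 isT).
have L20 := Lk (@Ordinal 6 5 isT).
have lift x : L (elem_seq i0 i1 x) -> offdiag L x by exact: (offdiag_of01 gL L01 L12 L20).
split; apply: lift.
- exact: L01.
- exact: (Lk (@Ordinal 6 1 isT)).
- exact: (Lk (@Ordinal 6 2 isT)).
- exact: (Lk (@Ordinal 6 3 isT)).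
Qed.

Lemma offdiag_single : (forall k l, offdiag L (unit_seq F m k l)) ->
  forall n (a : A n), offdiag L (single a).
Proof.
move=> LE n a; apply: (single_full (J := offdiag L) F_nat m_mono) => //.
- by move=> x y; exact: offdiagD.
- by move=> x; exact: offdiagN.
- by move=> x y; exact: offdiagM.
Qed.

Lemma gap_gen_single : (forall k, L (gap_gen k)) -> forall n (a : A n), offdiag L (single a).
Proof.
by move=> /gap_gen_offdiag[_ Lt Lv LE]; apply: offdiag_single; exact: offdiag_unit_seq_unit.
Qed.

End Generated.
End GapFamily.

Section Assembly.
Local Open Scope ring_scope.
Context (R : realType) (F : finNzRingType) (p : nat) (m : nat -> nat) (Q : nat -> finGroupType).
Hypotheses (p_prime : prime p) (p49 : (49 <= p)%N).
Hypothesis F_nat : forall a : F, exists k, a = k%:R.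
Hypothesis F_char : forall a : F, a *+ p = 0.
Hypothesis m_mono : forall k n, (k < n)%N -> (m k < m n)%N.
Hypothesis vm : forall n, (n.+1 * (vQ Q n).+1 <= (m n).+1)%N.
Context (H : groupType) (rho : forall n, {multiplicative H -> Q n}).
Hypothesis rho_sep : forall h, h != 1%g -> exists n, rho n h != 1%g.
Context (dec : nat -> H).
Hypothesis dec_surj : forall h, exists j, dec j = h.
Local Notation A := (mat_ring F m).
Local Notation K := (Kgrp A).
Local Notation seqA := (forall n, mat_ring F m n).

Definition ladder_seq (s : 'I_3) : seqA :=
  if s == i0 then unit_seq F m 0 0 else if s == i1 then unit_seq F m 1 0 else unit_seq F m 0 1.

Definition ladder_gens : set K :=
  [set elem_seq t.1.1 t.1.2 (ladder_seq t.2) | t in [set t : 'I_3 * 'I_3 * 'I_3 | t.1.1 != t.1.2]].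

(** Block decoding data and the two sequences encoding the regular
    permutations and the reflectors of all elements of [H]. *)
Definition code_gen (k : 'I_4) : K :=
  elem_seq i0 i1 (nth (sone A) [:: corner F m (vQ Q); bshift F m (vQ Q);
    encode (vQ Q) (fun j => regular_seq F m rho (dec j));
    encode (vQ Q) (fun j => reflector_seq F m rho (dec j))] k).

Context (tau : K) (tauE : forall n, mx_at tau n = diag3 (fun=> cshift F m n)).

Definition lift_gens : set K := [set tau] `|` ladder_gens.
Definition all_gens : set K := range (@gap_gen F m) `|` lift_gens `|` range code_gen.

Lemma finite_lift_gens : finite_set lift_gens.
Proof. by rewrite finite_setU; split; [exact: finite_set1|apply: finite_image; exact: finite_finset]. Qed.

Lemma finite_all_gens : finite_set all_gens.
Proof.
rewrite !finite_setU; split; first split.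
- by apply: finite_image; exact: finite_finset.
- by rewrite -finite_setU; exact: finite_lift_gens.
- by apply: finite_image; exact: finite_finset.
Qed.

(** The elementary generators lie in [window_group 1]. *)
Lemma lift_gens_lift : locally_finite_lift (subgroup_type (gensub lift_gens)) Zgroup.
Proof.
apply: (ascending_lift (W := window_group (F:=F) (m:=m)) (tau := tau) (S := ladder_gens)) => //.
- exact: window_group_subgroup.
- exact: window_group_finite.
- by move=> v; exact: window_group_incl.
- by move=> v g; exact: window_group_conj.
- by move=> v d; exact: window_group_tau.
- move=> _ [[[i j] s] /= ij <-]; exists 1%N; rewrite /ladder_seq.
  by case: ifP => _; [|case: ifP => _]; exact: window_group_elem_seq.
Qed.

(** Only three matrix units are given; conjugation by [tau] supplies the other
    ones. *)
Lemma lift_gens_dense : dense (gensub lift_gens : set K).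
Proof.
have gL := subgroupP (gensub lift_gens).
have Lg g : lift_gens g -> (gensub lift_gens : set K) g by exact: sub_generated.
have Ls s : offdiag (gensub lift_gens : set K) (ladder_seq s).
  by move=> i j ij; apply: Lg; right; exists (i, j, s).
have LE k l : offdiag (gensub lift_gens : set K) (unit_seq F m k l).
  apply: (offdiag_unit_seq_ladder gL).
  - exact: (Ls i0).
  - exact: (Ls i1).
  - exact: (Ls i2).
  - by move=> x; apply: (offdiag_conj_tau gL _ tauE); apply: Lg; left.
apply: finite_coords_closure; apply: (finite_coords_dense gL).
exact: (offdiag_single F_nat m_mono gL LE).
Qed.

Lemma all_gens_offdiag_code k : offdiag (gensub all_gens : set K)
  (nth (sone A) [:: corner F m (vQ Q); bshift F m (vQ Q);
    encode (vQ Q) (fun j => regular_seq F m rho (dec j));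
    encode (vQ Q) (fun j => reflector_seq F m rho (dec j))] (k : 'I_4)).
Proof.
have gL := subgroupP (gensub all_gens).
have Lgap k' : (gensub all_gens : set K) (gap_gen F m k') by apply: sub_generated; left; left; exists k'.
apply: (offdiag_of01 gL).
- exact: (Lgap (@Ordinal 6 0 isT)).
- exact: (Lgap (@Ordinal 6 4 isT)).
- exact: (Lgap (@Ordinal 6 5 isT)).
- by apply: sub_generated; right; exists k.
Qed.

Lemma all_gens_copy h : (gensub all_gens : set K) (copy F m rho h).
Proof.
have gL := subgroupP (gensub all_gens).
have Lgap k : (gensub all_gens : set K) (gap_gen F m k) by apply: sub_generated; left; left; exists k.
have Lsingle := gap_gen_single F_nat m_mono gL Lgap.
have [L1 _ _ _] := gap_gen_offdiag gL Lgap.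
have Lcorner := all_gens_offdiag_code (@Ordinal 4 0 isT).
have Lshift := all_gens_offdiag_code (@Ordinal 4 1 isT).
apply: (copy_mem gL L1) => {}h; have [j <-] := dec_surj h.
- apply: (offdiag_encoded vm (Y := fun j => regular_seq F m rho (dec j)) gL Lsingle _ L1 Lcorner Lshift).
    by move=> k n; exact: corner_seq_corner.
  exact: (all_gens_offdiag_code (@Ordinal 4 2 isT)).
- apply: (offdiag_encoded vm (Y := fun j => reflector_seq F m rho (dec j)) gL Lsingle _ L1 Lcorner Lshift).
    by move=> k n; exact: corner_seq_corner.
  exact: (all_gens_offdiag_code (@Ordinal 4 3 isT)).
Qed.

Lemma all_gens_dense : dense (gensub all_gens : set K).
Proof.
have gL := subgroupP (gensub all_gens).
apply: finite_coords_closure; apply: (finite_coords_dense gL).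
apply: (gap_gen_single F_nat m_mono gL) => k.
by apply: sub_generated; left; left; exists k.
Qed.

(** Six generators of prime order at least 49 allow [eps = 1 / 7], which satisfies
    [6 * eps < 1 <= p * eps ^+ 2]. *)
Lemma all_gens_spectral_gap :
  spectral_gap (haar R (G := E3type A)) (@left_translation (prodgroup (E3type A)) (gensub all_gens)).
Proof.
apply: (haar_spectral_gap (a := @gap_gen F m) (p := p) (eps := 7%:R^-1)).
- exact: p_prime.
- move=> k; apply: (elem_seq_torsion (mat_ring_torsion F_char)).
  by case: k => [[|[|[|[|[|[|//]]]]]] ?].
- by move=> i j _; exact: (heis_nxt (mat_ring_torsion F_char)).
- by rewrite invr_gt0 ltr0n.
- by rewrite card_ord ltr_pdivrMr ?ltr0n// mul1r ltr_nat.
- by rewrite exprVn ler_pdivlMr ?exprn_gt0 ?ltr0n// mul1r -natrX ler_nat.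
- move=> n x; apply: (finite_coords_dense (generated_subgroup _)).
  apply: (gap_gen_single F_nat m_mono (generated_subgroup _)) => k.
  by apply: sub_generated; exists k.
- exact: finite_all_gens.
- by [].
- by move=> k; apply: sub_generated; left; left; exists k.
Qed.

End Assembly.

(** * Separating quotients and the choice of the sizes *)

Lemma F53_natr (a : 'F_53) : exists k, a = k%:R%R.
Proof. by exists (a : nat); rewrite natr_Zp. Qed.

Lemma F53_char (a : 'F_53) : (a *+ 53 = 0)%R.
Proof. by rewrite -mulr_natr (pcharf0 (pchar_Fp (isT : prime 53))) mulr0. Qed.

Lemma countable_enum (H : groupType) : countable [set: H] ->
  exists dec : nat -> H, forall h, exists j, dec j = h.
Proof.
move=> /countable_injP[f f_inj].
exists (fun j => xget 1%g [set h | f h = j]) => h; exists (f h).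
have : [set h' | f h' = f h] (xget 1%g [set h' | f h' = f h]).
  exact: (xgetPex 1%g (ex_intro _ h erefl)).
by move=> /= /f_inj; apply; rewrite inE.
Qed.

(** As [H] is countable, one finite quotient for each element, in an
    enumeration, is enough. *)
Lemma separating_quotients (H : groupType) (dec : nat -> H) : residually_finite H ->
  (forall h, exists j, dec j = h) ->
  exists (Q : nat -> finGroupType) (rho : forall n, {multiplicative H -> Q n}),
    forall h, h != 1%g -> exists n, rho n h != 1%g.
Proof.
move=> Hrf dec_surj.
have sel n : exists Q : finGroupType, exists r : {multiplicative H -> Q},
    dec n != 1%g -> r (dec n) != 1%g.
  have [d1|/Hrf[Q [r rn]]] := eqVneq (dec n) 1%g; last by exists Q, r.
  by exists {perm bool}, (@one_fun H {perm bool}).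
exists (fun n => sval (cid (sel n))), (fun n => sval (cid (svalP (cid (sel n))))) => h h1.
have [n hn] := dec_surj h; exists n; rewrite -hn.
by apply: (svalP (cid (svalP (cid (sel n))))); rewrite hn.
Qed.

(** Sums make the sizes increasing and large enough for [n + 1] blocks;
    doubling makes them even. *)
Definition sizes (v : nat -> nat) n := (\sum_(k < n.+1) k.+1 * (v k).+1).*2.

Lemma sizes_mono v k n : k < n -> sizes v k < sizes v n.
Proof.
move: k n; apply: (homo_ltn ltn_trans) => n.
by rewrite /sizes ltn_double [X in _ < X]big_ord_recr/= -[X in X < _]addn0 ltn_add2l.
Qed.

Lemma sizes_ge v n : n.+1 * (v n).+1 <= (sizes v n).+1.
Proof. rewrite /sizes big_ord_recr/= -addnn; lia. Qed.

Theorem theorem2 (R : realType) (H : groupType) :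
  countable [set: H] -> residually_finite H ->
  exists (K : topologicalGroupType) (L4 : subgroup K),
    [/\ compact_group K, finitely_generated (subgroup_type L4) &
        dense (L4 : set K)] /\
    [/\ exists f : {multiplicative H -> subgroup_type L4}, injective f,
        exists L1 : subgroup K,
          [/\ (L1 : set K) `<=` (L4 : set K),
              finitely_generated (subgroup_type L1),
              locally_finite_lift (subgroup_type L1) Zgroup &
              dense (L1 : set K)] &
        exists mu : probability (borel K) R,
          haar_probability mu /\ spectral_gap mu (@left_translation K L4)].
Proof.
move=> /countable_enum[dec dec_surj] /separating_quotients/(_ dec_surj)[Q [rho rho_sep]].
pose F : finNzRingType := 'F_53; pose m := sizes (vQ Q).
have m_mono : forall k n, k < n -> m k < m n by exact: sizes_mono.
have vm n : n.+1 * (vQ Q n).+1 <= (m n).+1 by exact: sizes_ge.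
have m_even n : ~~ odd (m n) by rewrite odd_double.
have [tau tauE] := tau_exists F m_even.
have F_nat : forall a : F, exists k, a = k%:R%R := F53_natr.
have F_char : forall a : F, (a *+ 53 = 0)%R := F53_char.
pose gens := all_gens rho dec tau.
exists (prodgroup (E3type (mat_ring F m))), (gensub gens); split; split.
- exact: prodgroup_compact.
- exact: gensub_finitely_generated (finite_all_gens _ _ _).
- exact: all_gens_dense F_nat m_mono _ _ _ _.
- apply: (multiplicative_corestriction (f := copy F m rho)).
  + by apply: copyM.
  + by move=> h; apply: all_gens_copy => //.
  + exact: copy_inj.
- exists (gensub (lift_gens tau)); split.
  + apply: generated_min; first exact: generated_subgroup.
    by move=> g lg; apply: sub_generated; left; right.
  + exact: gensub_finitely_generated (finite_lift_gens _).
  + exact: lift_gens_lift m_mono _ tauE.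
  + exact: lift_gens_dense F_nat m_mono _ tauE.
- exists (haar R (G := E3type (mat_ring F m))); split.
  + by split; [exact: haar_left_invariant|exact: haar_regular].
  + by apply: (all_gens_spectral_gap R (p := 53)).
Qed.
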